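(* Let $X$ be a UMD Banach space and let $1<p<\infty$. Let $\mathcal{H}$ be the Hilbert transform and $\mathcal{S}_0$ the dyadic shift operator, both acting on $X$-valued functions. Then $$\|\mathcal{H}\|_{L^p_X\to L^p_X}\le \|\mathcal{S}_0\|_{L^p_X\to L^p_X}.$$
   Context: For $\mathbb{H}=\mathbb{R}$, or $\mathbb{T}=[-\pi,\pi)$ (the torus), or an interval, $L^p_X(\mathbb{H})$ is the Bochner–Lebesgue space of strongly measurable $f:\mathbb{H}\to X$ with $\|f\|_{L^p_X}=\left(\int_{\mathbb{H}}|f(x)|_X^p\,dx\right)^{1/p}<\infty$. A linear operator $T$ acting on scalar functions acts on $X$-valued functions of the form $f=\sum_{k=1}^N f_k\otimes x_k$ (with $f_k$ scalar functions in a dense class, $x_k\in X$) by $Tf=\sum_k (Tf_k)\,x_k$, and its $L^p_X$ operator norm is understood by density. Hilbert transform: $\mathcal{H}$ is either $\mathcal{H}_{\mathbb{R}}f(x)=\mathrm{p.v.}\frac1\pi\int_{\mathbb{R}}\frac{f(t)}{x-t}\,dt$ on $L^p_X(\mathbb{R})$ or $\mathcal{H}_{\mathbb{T}}f(x)=\mathrm{p.v.}\frac{1}{2\pi}\int_{\mathbb{T}}f(t)\cot\left(\frac{x-t}{2}\right)dt$ on $L^p_X(\mathbb{T})$ (the two have the same $L^p_X$ operator norm). Dyadic shift: the dyadic intervals are $\mathcal{D}=\{[m2^{-k},(m+1)2^{-k}):m,k\in\mathbb{Z}\}$. For a dyadic interval $I$, $I_-$ and $I_+$ are its left and right halves and $h_I=|I|^{-1/2}(\mathbf{1}_{I_+}-\mathbf{1}_{I_-})$.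 The dyadic shift on $\mathbb{R}$ is densely defined on Haar functions by $\mathcal{S}_0 h_{I_+}=h_{I_-}$, $\mathcal{S}_0 h_{I_-}=-h_{I_+}$ for all $I\in\mathcal{D}$. The dyadic shift on $I_0=[0,1)$ is defined by the same rule for all dyadic $I\subseteq I_0$, together with $\mathcal{S}_0\mathbf{1}_{I_0}=0$, $\mathcal{S}_0h_{I_0}=0$. Either version of $\mathcal{S}_0$ (on $L^p_X(\mathbb{R})$ or on $L^p_X(I_0)$) may be used; they have the same $L^p_X$ operator norm. UMD: $X$ is UMD if for some (equivalently every) $1<p<\infty$ the $\pm1$ martingale transforms $h_I\mapsto\alpha_I h_I$, $\alpha_I\in\{-1,1\}$, are bounded on $L^p_X$ uniformly in $(\alpha_I)$. *)

(* Defs.v *)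
From HB Require Import structures.
From mathcomp Require Import all_boot all_order all_algebra.
From mathcomp Require Import all_classical all_reals all_analysis.

Set Implicit Arguments.
Unset Strict Implicit.
Unset Printing Implicit Defensive.

Import Order.TTheory GRing.Theory Num.Theory.
Import numFieldNormedType.Exports.

Local Open Scope classical_set_scope.
Local Open Scope ring_scope.

Definition Lp_norm (R : realType) (X : normedModType R) (D : set R) (p : R)
    (f : R -> X) : \bar R :=
  ((\int[lebesgue_measure]_(x in D) (`|f x| `^ p)%:E) `^ p^-1)%E.

Definition tensor_sum (R : realType) (X : normedModType R) (n : nat)
    (f : 'I_n -> R -> R) (x : 'I_n -> X) : R -> X :=
  fun t => \sum_(k < n) f k t *: x k.

(* A densely defined scalar operator is given by the restriction of its graph
   to a class of functions whose span is dense in L^p(D): [T f g] means that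
   the operator maps f to g.  The operator norm of its X-valued extension is
   the supremum of |T f| over the f = sum_k f_k (x) x_k with |f| <= 1; it
   equals +oo if the extension is unbounded. *)
Definition opnorm (R : realType) (X : normedModType R) (D : set R) (p : R)
    (T : (R -> R) -> (R -> R) -> Prop) : \bar R :=
  ereal_sup [set z | exists (n : nat) (f g : 'I_n -> R -> R) (x : 'I_n -> X),
    [/\ forall k, T (f k) (g k),
        (Lp_norm D p (tensor_sum f x) <= 1)%E
      & z = Lp_norm D p (tensor_sum g x)]].

(* The pair (k, m) encodes the dyadic interval [m 2^-k, (m + 1) 2^-k). *)
Definition dyadic : Type := (int * int)%type.

Definition dyadic_length (R : realType) (I : dyadic) : R := 2 ^ (- I.1).

Definition dyadic_set (R : realType) (I : dyadic) : set R :=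
  `[I.2%:~R * dyadic_length R I, (I.2 + 1)%:~R * dyadic_length R I[.

Arguments dyadic_set R I : clear implicits.

Definition left_half (I : dyadic) : dyadic := (I.1 + 1, 2 * I.2).
Definition right_half (I : dyadic) : dyadic := (I.1 + 1, 2 * I.2 + 1).

Definition haar (R : realType) (I : dyadic) : R -> R := fun t =>
  (Num.sqrt (dyadic_length R I))^-1 *
  (\1_(dyadic_set R (right_half I)) t - \1_(dyadic_set R (left_half I)) t).
Arguments haar R I : clear implicits.

Inductive shift_line (R : realType) : (R -> R) -> (R -> R) -> Prop :=
| shift_line_right (I : dyadic) :
    shift_line (haar R (right_half I)) (haar R (left_half I))
| shift_line_left (I : dyadic) :
    shift_line (haar R (left_half I)) (fun t => - haar R (right_half I) t).

Arguments shift_line R : clear implicits.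

(* (0, 0) encodes I_0 = [0, 1). *)
Inductive shift_unit (R : realType) : (R -> R) -> (R -> R) -> Prop :=
| shift_unit_right (I : dyadic) :
    dyadic_set R I `<=` `[0, 1[ ->
    shift_unit (haar R (right_half I)) (haar R (left_half I))
| shift_unit_left (I : dyadic) :
    dyadic_set R I `<=` `[0, 1[ ->
    shift_unit (haar R (left_half I)) (fun t => - haar R (right_half I) t)
| shift_unit_one : shift_unit (\1_(`[0, 1[ : set R)) (fun=> 0)
| shift_unit_top : shift_unit (haar R (0, 0)) (fun=> 0).
Arguments shift_unit R : clear implicits.

Inductive martingale_transform (R : realType) (alpha : dyadic -> R) :
    (R -> R) -> (R -> R) -> Prop :=
| martingale_transform_haar (I : dyadic) :
    martingale_transform alpha (haar R I) (fun t => alpha I * haar R I t).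

Definition UMD (R : realType) (X : normedModType R) : Prop :=
  exists2 p : R, 1 < p & exists C : R, forall alpha : dyadic -> R,
    (forall I, alpha I = 1 \/ alpha I = -1) ->
    (opnorm X setT p (martingale_transform alpha) <= C%:E)%E.

Definition test_function (R : realType) (f : R -> R) : Prop :=
  (forall (n : nat) (x : R), derivable (derive1n n f) x 1) /\
  (exists M : R, forall x, M < `|x| -> f x = 0).

Definition pv_line (R : realType) (f : R -> R) (x : R) : R :=
  lim ((fun e : R => pi^-1 *
    \int[lebesgue_measure]_(t in [set t | (e < `|x - t|)%R]) (f t / (x - t)))
    @ 0^'+).

Inductive hilbert_line (R : realType) : (R -> R) -> (R -> R) -> Prop :=
| hilbert_line_test (f : R -> R) :
    test_function f -> hilbert_line f (pv_line f).
Arguments hilbert_line R : clear implicits.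

Definition torus (R : realType) : set R := `[- pi, pi[.
Arguments torus R : clear implicits.

(* On the torus, [x - t] also approaches the singularities [- 2 pi] and [2 pi]
   of the kernel when x = - pi, so the truncation uses the periodic distance. *)
Definition pv_torus (R : realType) (f : R -> R) (x : R) : R :=
  lim ((fun e : R => (2 * pi)^-1 *
    \int[lebesgue_measure]_(t in torus R `&`
        [set t | (e < `|x - t| < 2 * pi - e)%R])
      (f t * (cos ((x - t) / 2) / sin ((x - t) / 2))))
    @ 0^'+).

(* The span of this class is the space of trigonometric polynomials. *)
Inductive hilbert_torus (R : realType) : (R -> R) -> (R -> R) -> Prop :=
| hilbert_torus_cos (n : nat) : let f t := cos (n%:R * t) in
    hilbert_torus f (pv_torus f)
| hilbert_torus_sin (n : nat) : let f t := sin (n%:R * t) in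
    hilbert_torus f (pv_torus f).
Arguments hilbert_torus R : clear implicits.

(* Main.v *)
(* A point of [0,1) drives a walk by its binary digits: one digit picks a
   coordinate axis, the next one the sign of a step along it.  Let a martingale
   U gain +-a at the steps along the x-axis and +-b at those along the y-axis,
   and let V gain +-b and -+a at the same steps.  Then V is the dyadic shift of
   U, since the shift exchanges, up to sign, the Haar functions of the two halves
   of an interval.  If u + iv is holomorphic, then by the Cauchy-Riemann equations
   u and v, taken along a walk in the plane, form such a pair up to an error that
   vanishes with the step size.  For u = sum_k exp(- n_k y) cos(n_k x + a_k) x_k
   on the half-plane, start the walk at height s over a uniformly distributed
   point of the torus and stop it at the boundary: the exit point is uniformly
   distributed, v tends to 0 at height s as s grows, and the estimate of V by U
   becomes the estimate of the Hilbert transform of trigonometric polynomials on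
   the torus.

   On the line, replace a test function f by f(L sin(t / L)), and this one by
   P(t) = q(sin(t / L)) with a polynomial q approximating f(L u) in C^1 on [-1,1].
   P is symmetric about pi L / 2 and its conjugate is antisymmetric, so that the
   estimate on the torus descends to the half period |t| <= pi L / 2, on which P
   is close to the single bump f.  As L grows, the conjugate of P converges
   pointwise to the Hilbert transform of f, and Fatou's lemma concludes. *)
Require Import Defs.
From HB Require Import structures.
From mathcomp Require Import all_boot all_order all_algebra.
From mathcomp Require Import all_classical all_reals all_analysis.
From mathcomp Require Import measurable_realfun.
From mathcomp Require Import ring lra.

Set Implicit Arguments.
Unset Strict Implicit.
Unset Printing Implicit Defensive.

Import Order.TTheory GRing.Theory Num.Theory.
Import numFieldNormedType.Exports.

Local Open Scope classical_set_scope.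
Local Open Scope ring_scope.

(** * Martingales on the dyadic tree *)

Section operator_norm.
Context {R : realType} {X : normedModType R}.
Implicit Types (D : set R) (p C : R) (T : (R -> R) -> (R -> R) -> Prop).
Implicit Types F G : R -> X.

(** Replacing [u] and [v] by martingales must cost nothing in the limit, although the walk makes
    about [s ^ 5 / h ^+ 2] steps of size [h]. One step changes the error by an amount of order
    [h ^+ 2], so along a single path the errors may add up to a constant that does not shrink with
    [h]. As the waves are harmonic, the mean of one change is only of order [h ^+ 3]; a
    second-moment estimate then bounds the expected error, for fixed [s], by a multiple of the
    square root of [h]. The pathwise bound still serves: below it, the [p]-th power is Lipschitz.
    Started at height [s], the walk ends at height [s ^ 2] with probability at most [1 / s] and is
    still moving after its last step with probability at most [2 / s ^ 2]; such paths are estimated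
    trivially. The conjugate operator is not bounded in the sup norm, so on the line the polynomial
    must approximate with a small Lipschitz error. For Lipschitz [f] the product of
    [f (x - s) - f (x + s)] with the kernel is bounded, which gives explicit rates of order [1 / L].
    The dyadic and the analytic halves of the proof meet only in [walk_bound]. *)

Definition extends T F G := exists (n : nat) (f g : 'I_n -> R -> R)
  (x : 'I_n -> X),
  [/\ forall k, T (f k) (g k), F = tensor_sum f x & G = tensor_sum g x].

Lemma extends0 T : extends T (fun=> 0) (fun=> 0).
Proof.
exists 0%N, (fun _ _ => 0), (fun _ _ => 0), (fun=> 0); split; first by case.
- by apply/funext => t; rewrite /tensor_sum big_ord0.
- by apply/funext => t; rewrite /tensor_sum big_ord0.
Qed.

Lemma extends1 T f g (x : X) : T f g ->
  extends T (fun t => f t *: x) (fun t => g t *: x).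
Proof.
move=> Tfg; exists 1%N, (fun=> f), (fun=> g), (fun=> x); split => //.
- by apply/funext => t; rewrite /tensor_sum big_ord1.
- by apply/funext => t; rewrite /tensor_sum big_ord1.
Qed.

Lemma extendsD T F1 G1 F2 G2 : extends T F1 G1 -> extends T F2 G2 ->
  extends T (fun t => F1 t + F2 t) (fun t => G1 t + G2 t).
Proof.
move=> [n1 [f1 [g1 [x1 [T1 -> ->]]]]] [n2 [f2 [g2 [x2 [T2 -> ->]]]]].
pose cat (A : Type) (a : 'I_n1 -> A) (b : 'I_n2 -> A) (k : 'I_(n1 + n2)) :=
  match fintype.split k with inl i => a i | inr j => b j end.
have catl A a b i : @cat A a b (lshift n2 i) = a i.
  by rewrite /cat (unsplitK (inl i)).
have catr A a b i : @cat A a b (rshift n1 i) = b i.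
  by rewrite /cat (unsplitK (inr i)).
exists (n1 + n2)%N, (cat _ f1 f2), (cat _ g1 g2), (cat _ x1 x2); split.
- by move=> k; rewrite /cat; case: fintype.split.
- apply/funext => t; rewrite /tensor_sum big_split_ord/=.
  by congr (_ + _); apply: eq_bigr => i _; rewrite ?catl ?catr.
- apply/funext => t; rewrite /tensor_sum big_split_ord/=.
  by congr (_ + _); apply: eq_bigr => i _; rewrite ?catl ?catr.
Qed.

Lemma extendsZ T (c : R) F G : extends T F G ->
  extends T (fun t => c *: F t) (fun t => c *: G t).
Proof.
move=> [n [f [g [x [Tfg -> ->]]]]]; exists n, f, g, (fun k => c *: x k).
split=> //; apply/funext => t; rewrite /tensor_sum scaler_sumr;
  by apply: eq_bigr => i _; rewrite scalerA mulrC -scalerA.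
Qed.

Lemma extendsN T F G : extends T F G ->
  extends T (fun t => - F t) (fun t => - G t).
Proof.
move=> /(extendsZ (-1)); under eq_fun do rewrite scaleN1r.
by move=> H; under [X in extends _ _ X]eq_fun do rewrite -scaleN1r.
Qed.

Lemma opnorm_ge0 D p T : 0 < p -> (0 <= opnorm X D p T)%E.
Proof.
move=> p0; have [n [f [g [x [Tfg fE gE]]]]] := extends0 T.
have Lp0 : Lp_norm D p (fun=> 0%R : X) = 0%E.
  rewrite /Lp_norm integral0_eq ?poweR0r ?invr_eq0 ?gt_eqF// => t _.
  by rewrite normr0 powR0 ?gt_eqF.
by apply: ereal_sup_ubound; exists n, f, g, x; rewrite -fE -gE Lp0.
Qed.

Lemma integral_normpZ D p (c : R) F : measurable D -> 0 < c ->
  measurable_fun D (fun t => `|F t| `^ p) ->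
  (\int[lebesgue_measure]_(t in D) (`|c *: F t| `^ p)%:E =
   (c `^ p)%:E * \int[lebesgue_measure]_(t in D) (`|F t| `^ p)%:E)%E.
Proof.
move=> mD c0 mF; rewrite -ge0_integralZl//.
- by apply: eq_integral => t _; rewrite normrZ powRM// gtr0_norm// EFinM.
- exact/measurable_EFinP.
- by rewrite lee_fin powR_ge0.
Qed.

(** Passes from the unit ball in [opnorm] to [p]-th powers of norms. The pair is scaled by the power
    [- p^-1] of [A + e]; the positive [e] avoids dividing by zero when [A = 0] and is removed at the
    end. *)
Lemma opnorm_extends D p T C A F G : measurable D -> 0 < p ->
  opnorm X D p T = C%:E -> extends T F G ->
  measurable_fun D (fun t => `|F t| `^ p) ->
  measurable_fun D (fun t => `|G t| `^ p) ->
  (\int[lebesgue_measure]_(t in D) (`|F t| `^ p)%:E <= A%:E)%E ->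
  (\int[lebesgue_measure]_(t in D) (`|G t| `^ p)%:E <= (C `^ p * A)%:E)%E.
Proof.
move=> mD p0 TC TFG mF mG FA.
have C0 : 0 <= C by rewrite -lee_fin -TC opnorm_ge0.
have A0 : 0 <= A.
  rewrite -lee_fin (le_trans _ FA)//.
  by apply: integral_ge0 => t _; rewrite lee_fin powR_ge0.
have bnd (e : R) : 0 < e ->
    (\int[lebesgue_measure]_(t in D) (`|G t| `^ p)%:E <=
     (C `^ p * (A + e))%:E)%E.
  move=> e0; have Ae0 : 0 < A + e by rewrite ltr_wpDl.
  pose c := (A + e) `^ (- p^-1).
  have c0 : 0 < c by rewrite powR_gt0.
  have cp : c `^ p = (A + e)^-1.
    by rewrite /c -powRrM mulNr mulVf ?gt_eqF// powR_inv1// ltW.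
  have [n [f [g [x [Tfg fE gE]]]]] := extendsZ c TFG.
  have : (Lp_norm D p (tensor_sum g x) <= C%:E)%E.
    rewrite -TC; apply: ereal_sup_ubound; exists n, f, g, x; split => //.
    rewrite -fE /Lp_norm integral_normpZ// cp.
    apply: (@le_trans _ _ (1 `^ p^-1)%E); last by rewrite poweR1r.
    apply: gt0_ler_poweR.
    - by rewrite invr_ge0 ltW.
    - rewrite in_itv/= leey andbT mule_ge0//; first by rewrite lee_fin invr_ge0 ltW.
      by apply: integral_ge0 => t _; rewrite lee_fin powR_ge0.
    - by rewrite in_itv/= leey andbT lee_fin.
    rewrite (le_trans (lee_wpmul2l _ FA)) ?lee_fin ?invr_ge0 ?ltW//.
    by rewrite ltr_pdivrMl// mulr1 ltrDl.
  rewrite -gE /Lp_norm integral_normpZ// cp.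
  set I := integral _ _ _ => IC.
  have I0 : (0 <= I)%E by apply: integral_ge0 => t _; rewrite lee_fin powR_ge0.
  have : ((A + e)^-1%:E * I <= (C `^ p)%:E)%E.
    move: IC; have : (0 <= (A + e)^-1%:E * I)%E.
      by rewrite mule_ge0// lee_fin invr_ge0 ltW.
    (* The integral of the image is not known to be finite beforehand; the value [+oo] contradicts
       the bound by [C]. *)
    case: (_ * I)%E => [r r0|_|//].
      rewrite poweR_EFin !lee_fin => rC.
      have := @ge0_ler_powR _ p (ltW p0) _ _ _ _ rC.
      rewrite !nnegrE powR_ge0 C0 => /(_ isT isT).
      by rewrite -powRrM mulVf ?gt_eqF// powRr1// -lee_fin.
    by rewrite poweRyr ?invr_eq0 ?gt_eqF// leye_eq.
  by rewrite muleC lee_pdivrMr// -EFinM.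
apply/lee_addgt0Pr => e e0.
have d0 : 0 < e / (C `^ p + 1) by rewrite divr_gt0// ltr_wpDl ?powR_ge0.
rewrite (le_trans (bnd _ d0))// -EFinD lee_fin mulrDr lerD2l.
rewrite mulrCA ler_piMr ?(ltW e0)// ler_pdivrMr ?ltr_wpDl ?powR_ge0//.
by rewrite mul1r lerDl.
Qed.

End operator_norm.

(** * Dyadic intervals and their halves *)

Section dyadic_intervals.
Context {R : realType}.
Implicit Types (I : dyadic) (t : R).

Lemma dyadic_length_gt0 I : 0 < dyadic_length R I.
Proof. by rewrite /dyadic_length exprz_gt0. Qed.

Lemma dyadic_length_left I :
  dyadic_length R (left_half I) = dyadic_length R I / 2.
Proof. by rewrite /dyadic_length/= opprD expfzDr// expr1z_inv. Qed.

Lemma dyadic_length_right I :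
  dyadic_length R (right_half I) = dyadic_length R I / 2.
Proof. exact: dyadic_length_left. Qed.

Lemma in_left_half I t : dyadic_set R (left_half I) t =
  (I.2%:~R * dyadic_length R I <= t < (I.2%:~R + 2^-1) * dyadic_length R I)
  :> Prop.
Proof.
rewrite /dyadic_set dyadic_length_left/= in_itv/= !rmorphD/= !rmorphM/=.
by congr (is_true (_ && _)); congr (_ _ _); field.
Qed.

Lemma in_right_half I t : dyadic_set R (right_half I) t =
  ((I.2%:~R + 2^-1) * dyadic_length R I <= t <
    (I.2%:~R + 1) * dyadic_length R I) :> Prop.
Proof.
rewrite /dyadic_set dyadic_length_right/= in_itv/= !rmorphD/= !rmorphM/=.
by congr (is_true (_ && _)); congr (_ _ _); field.
Qed.

Lemma in_dyadic I t : dyadic_set R I t =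
  (I.2%:~R * dyadic_length R I <= t < (I.2%:~R + 1) * dyadic_length R I)
  :> Prop.
Proof. by rewrite /dyadic_set/= in_itv/= rmorphD. Qed.

Lemma dyadic_left_sub I : dyadic_set R (left_half I) `<=` dyadic_set R I.
Proof.
move=> t; rewrite in_left_half in_dyadic => /andP[-> /lt_le_trans]; apply.
by rewrite ler_wpM2r ?(ltW (dyadic_length_gt0 I))// lerD2l; lra.
Qed.

Lemma dyadic_right_sub I : dyadic_set R (right_half I) `<=` dyadic_set R I.
Proof.
move=> t; rewrite in_right_half in_dyadic => /andP[It ->]; rewrite andbT.
by rewrite (le_trans _ It)// ler_wpM2r ?(ltW (dyadic_length_gt0 I))//; lra.
Qed.

Lemma dyadic_split I t : dyadic_set R I t ->
  dyadic_set R (left_half I) t /\ ~ dyadic_set R (right_half I) t \/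
  ~ dyadic_set R (left_half I) t /\ dyadic_set R (right_half I) t.
Proof.
rewrite in_dyadic in_left_half in_right_half => /andP[-> ->]; rewrite andbT /=.
by have [tI|It] := ltP t ((I.2%:~R + 2^-1) * dyadic_length R I);
  [left|right].
Qed.

Lemma dyadic_disjoint I t : dyadic_set R (left_half I) t ->
  ~ dyadic_set R (right_half I) t.
Proof.
rewrite in_left_half in_right_half => /andP[_ tI] /andP[It _].
by have := lt_le_trans tI It; rewrite ltxx.
Qed.

Lemma dyadic_setU I :
  dyadic_set R I = dyadic_set R (left_half I) `|` dyadic_set R (right_half I).
Proof.
apply/seteqP; split => t.
  by move=> /dyadic_split[[]|[]]; [left|right].
by move=> []; [exact: dyadic_left_sub|exact: dyadic_right_sub].
Qed.

Lemma measurable_dyadic I : measurable (dyadic_set R I).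
Proof. exact: measurable_itv. Qed.

Lemma lebesgue_dyadic I :
  lebesgue_measure (dyadic_set R I) = (dyadic_length R I)%:E.
Proof.
rewrite /dyadic_set lebesgue_measure_itv/= lte_fin ltr_pM2r ?dyadic_length_gt0//.
by rewrite rmorphD/= ltrDl ltr01 -EFinB -mulrBl addrAC subrr add0r mul1r.
Qed.

Lemma dyadic_set00 : dyadic_set R (0, 0) = `[0, 1[%classic.
Proof.
by rewrite /dyadic_set/= /dyadic_length/= oppr0 expr0z mul0r add0r mulr1.
Qed.

(** The Haar function scaled to the values -1 and 1. The shift exchanges halves of equal length, so
    it acts on these by the same rule as on [haar]. *)
Definition usign I t : R :=
  \1_(dyadic_set R (right_half I)) t - \1_(dyadic_set R (left_half I)) t.

Lemma usign_left I t : dyadic_set R (left_half I) t -> usign I t = -1.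
Proof.
move=> It; rewrite /usign !indicE (mem_set It) memNset ?sub0r//.
exact: dyadic_disjoint.
Qed.

Lemma usign_right I t : dyadic_set R (right_half I) t -> usign I t = 1.
Proof.
move=> It; rewrite /usign !indicE (mem_set It) memNset ?subr0//.
by move/dyadic_disjoint.
Qed.

Lemma usign_out I t : ~ dyadic_set R I t -> usign I t = 0.
Proof.
move=> It; rewrite /usign !indicE !memNset ?subr0//.
- by move/dyadic_left_sub.
- by move/dyadic_right_sub.
Qed.

Lemma haarE I t : haar R I t = (Num.sqrt (dyadic_length R I))^-1 * usign I t.
Proof. by []. Qed.

Lemma haar_usign I t : Num.sqrt (dyadic_length R I) * haar R I t = usign I t.
Proof.
by rewrite haarE mulrA divff ?mul1r// gt_eqF// sqrtr_gt0 dyadic_length_gt0.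
Qed.

End dyadic_intervals.

Local Opaque dyadic_set left_half right_half.

(** * Walks driven by binary digits *)

Section dyadic_tree.
Context {R : realType} {X : normedModType R}.
Variable T : (R -> R) -> (R -> R) -> Prop.
Hypothesis T_right : forall I, dyadic_set R I `<=` `[0, 1[ ->
  T (haar R (right_half I)) (haar R (left_half I)).
Hypothesis T_left : forall I, dyadic_set R I `<=` `[0, 1[ ->
  T (haar R (left_half I)) (fun t => - haar R (right_half I) t).

Variables (S : Type) (step : S -> bool -> bool -> S).

(** The transition operator: axis [d] and sign [r] are independent fair choices, so
    [iter n mean phi s] is the expectation of [phi] after [n] steps from [s]. *)
Definition mean (phi : S -> R) (s : S) : R :=
  (phi (step s false false) + phi (step s false true) +
   phi (step s true false) + phi (step s true true)) / 4.

Definition bsign (r : bool) : R := if r then 1 else -1.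

Variables (al be mu mv : S -> X).
Hypothesis mu_step : forall s d r,
  mu (step s d r) = mu s + bsign r *: (if d then be s else al s).
Hypothesis mv_step : forall s d r,
  mv (step s d r) = mv s + bsign r *: (if d then - al s else be s).

(* [Z t] is the final state of the walk driven by the digits of [t]. *)
Definition realizes (I : dyadic) (m0 n0 : R -> X) (E : (S -> R) -> R) :=
  exists (F G : R -> X) (Z : R -> S),
  [/\ extends T F G,
      forall t, ~ dyadic_set R I t -> F t = 0 /\ G t = 0,
      forall t, dyadic_set R I t ->
        mu (Z t) = m0 t + F t /\ mv (Z t) = n0 t + G t
    & forall phi : S -> R, (forall s, 0 <= phi s) ->
        measurable_fun (dyadic_set R I) (phi \o Z) /\
        (\int[lebesgue_measure]_(t in dyadic_set R I) (phi (Z t))%:E =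
          (dyadic_length R I * E phi)%:E)%E].

Lemma realizes_ext I m0 n0 m1 n1 E0 E1 :
  (forall t, dyadic_set R I t -> m0 t = m1 t) ->
  (forall t, dyadic_set R I t -> n0 t = n1 t) ->
  (forall phi, E0 phi = E1 phi) ->
  realizes I m0 n0 E0 -> realizes I m1 n1 E1.
Proof.
move=> m01 n01 E01 [F [G [Z [TFG FG0 mZ phiZ]]]]; exists F, G, Z.
split => //; first by move=> t It; rewrite -m01// -n01//; exact: mZ.
by move=> phi phi0; rewrite -E01; exact: phiZ.
Qed.

(** The Haar sums of one half vanish on the other, so adding them glues the two walks; as the halves
    have equal length, the expectations are averaged. *)
Lemma realizes_glue I m0 n0 E1 E2 :
  realizes (left_half I) m0 n0 E1 -> realizes (right_half I) m0 n0 E2 ->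
  realizes I m0 n0 (fun phi => (E1 phi + E2 phi) / 2).
Proof.
move=> [F1 [G1 [Z1 [TFG1 FG1 mZ1 phi1]]]] [F2 [G2 [Z2 [TFG2 FG2 mZ2 phi2]]]].
pose Z t := if t \in dyadic_set R (left_half I) then Z1 t else Z2 t.
have ZL t : dyadic_set R (left_half I) t -> Z t = Z1 t.
  by move=> It; rewrite /Z mem_set.
have ZR t : dyadic_set R (right_half I) t -> Z t = Z2 t.
  by move=> It; rewrite /Z memNset// => /dyadic_disjoint.
exists (fun t => F1 t + F2 t), (fun t => G1 t + G2 t), Z; split.
- exact: extendsD.
- move=> t It.
  have [|-> ->] := FG1 t; first by move/dyadic_left_sub.
  have [|-> ->] := FG2 t; first by move/dyadic_right_sub.
  by rewrite addr0.
- move=> t /dyadic_split [[tL tR]|[tL tR]].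
    by rewrite ZL//; have [-> ->] := FG2 _ tR; rewrite !addr0; exact: mZ1.
  by rewrite ZR//; have [-> ->] := FG1 _ tL; rewrite !add0r; exact: mZ2.
move=> phi phi0; have [m1 i1] := phi1 _ phi0; have [m2 i2] := phi2 _ phi0.
have mL : measurable_fun (dyadic_set R (left_half I)) (phi \o Z).
  by apply: eq_measurable_fun m1 => t /[!inE] tI /=; rewrite ZL.
have mR : measurable_fun (dyadic_set R (right_half I)) (phi \o Z).
  by apply: eq_measurable_fun m2 => t /[!inE] tI /=; rewrite ZR.
have mU : measurable_fun (dyadic_set R I) (phi \o Z).
  rewrite dyadic_setU; apply/measurable_funU => //; exact: measurable_dyadic.
split=> //.
rewrite dyadic_setU ge0_integral_setU//=.
- transitivity ((dyadic_length R (left_half I) * E1 phi)%:E +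
      (dyadic_length R (right_half I) * E2 phi)%:E)%E; last first.
    rewrite dyadic_length_left dyadic_length_right -EFinD; congr EFin.
    by field.
  congr (_ + _)%E.
    by apply: etrans i1; apply: eq_integral => t /[!inE] tI; rewrite ZL.
  by apply: etrans i2; apply: eq_integral => t /[!inE] tI; rewrite ZR.
- exact: measurable_dyadic.
- exact: measurable_dyadic.
- by rewrite -dyadic_setU; exact/measurable_EFinP.
- by move=> t _; rewrite lee_fin.
- by apply/disj_setPRL => t /= /[swap] /dyadic_disjoint.
Qed.

(** The increments of a step live on [I] without being constant there. They count as part of the
    start values while the halves are glued, and are then moved into the Haar sums. *)
Lemma realizes_absorb I m0 n0 F0 G0 E : extends T F0 G0 ->
  (forall t, ~ dyadic_set R I t -> F0 t = 0 /\ G0 t = 0) ->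
  realizes I (fun t => m0 t + F0 t) (fun t => n0 t + G0 t) E ->
  realizes I m0 n0 E.
Proof.
move=> T0 out0 [F [G [Z [TFG out mZ phiZ]]]].
exists (fun t => F0 t + F t), (fun t => G0 t + G t), Z; split => //.
- exact: extendsD.
- by move=> t It; have [-> ->] := out0 _ It; have [-> ->] := out _ It;
    rewrite addr0.
- by move=> t It; rewrite !addrA; exact: mZ.
Qed.

Lemma extends_right I (x : X) : dyadic_set R I `<=` `[0, 1[ ->
  extends T (fun t => usign (right_half I) t *: x)
            (fun t => usign (left_half I) t *: x).
Proof.
move=> I01.
have := extends1 (Num.sqrt (dyadic_length R (right_half I)) *: x) (T_right I01).
congr extends; apply/funext => t; rewrite scalerA mulrC.
  by rewrite haar_usign.
by rewrite dyadic_length_right -dyadic_length_left haar_usign.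
Qed.

Lemma extends_left I (x : X) : dyadic_set R I `<=` `[0, 1[ ->
  extends T (fun t => usign (left_half I) t *: x)
            (fun t => - (usign (right_half I) t *: x)).
Proof.
move=> I01.
have := extends1 (Num.sqrt (dyadic_length R (left_half I)) *: x) (T_left I01).
congr extends; apply/funext => t; rewrite scalerA mulrC.
  by rewrite haar_usign.
by rewrite dyadic_length_left -dyadic_length_right mulrN haar_usign scaleNr.
Qed.

(** A step uses two generations: halving [I] picks the axis, halving the half picks the sign. The
    Haar function of the left half carries [al s], that of the right half [be s]. The shift sends
    the first to the right half with a minus sign and the second to the left half, which is the
    pattern of [mv_step]. *)
Lemma realizes_walk n I s : dyadic_set R I `<=` `[0, 1[ ->
  realizes I (fun=> mu s) (fun=> mv s) (fun phi => iter n mean phi s).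
Proof.
elim: n I s => [|n IHn] I s I01.
  exists (fun=> 0), (fun=> 0), (fun=> s); split => //.
  - exact: extends0.
  - by move=> t _; rewrite !addr0.
  - move=> phi phi0; split; first exact: measurable_cst.
    rewrite integral_cst/=; last exact: measurable_dyadic.
    by rewrite lebesgue_dyadic -EFinM mulrC.
have IL : dyadic_set R (left_half I) `<=` `[0, 1[.
  by move=> t /dyadic_left_sub /I01.
have IR : dyadic_set R (right_half I) `<=` `[0, 1[.
  by move=> t /dyadic_right_sub /I01.
have sub_left J : dyadic_set R J `<=` `[0, 1[ ->
    dyadic_set R (left_half J) `<=` `[0, 1[.
  by move=> J01 t /dyadic_left_sub /J01.
have sub_right J : dyadic_set R J `<=` `[0, 1[ ->
    dyadic_set R (right_half J) `<=` `[0, 1[.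
  by move=> J01 t /dyadic_right_sub /J01.
pose sL t : R := usign (left_half I) t; pose sR t : R := usign (right_half I) t.
apply: (@realizes_absorb _ _ _ (fun t => sL t *: al s + sR t *: be s)
   (fun t => - (sR t *: al s) + sL t *: be s)).
- by apply: extendsD; [exact: extends_left|exact: extends_right].
- move=> t It; rewrite /sL /sR !usign_out ?scale0r ?oppr0 ?addr0//.
  + by move/dyadic_right_sub.
  + by move/dyadic_left_sub.
have zL t : dyadic_set R (left_half I) t -> sR t = 0.
  move=> tI; exact: (usign_out (dyadic_disjoint tI)).
have zR t : dyadic_set R (right_half I) t -> sL t = 0.
  move=> tI; apply: usign_out; exact: (contraPnot (@dyadic_disjoint _ _ _) tI).
pose E d r phi := iter n mean phi (step s d r).
apply: (@realizes_ext _ _ _ _ _ (fun phi => ((E false false phi +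
    E false true phi) / 2 + (E true false phi + E true true phi) / 2) / 2)).
- by move=> t _; reflexivity.
- by move=> t _; reflexivity.
- by move=> phi; rewrite /E/= /mean; field.
apply: realizes_glue; apply: realizes_glue.
- apply: realizes_ext (IHn _ (step s false false) (sub_left _ IL)) => // t tI.
    have tJ := dyadic_left_sub tI.
    by rewrite mu_step zL// /sL usign_left// scale0r addr0.
  have tJ := dyadic_left_sub tI.
  by rewrite mv_step zL// /sL usign_left// scale0r oppr0 add0r.
- apply: realizes_ext (IHn _ (step s false true) (sub_right _ IL)) => // t tI.
    have tJ := dyadic_right_sub tI.
    by rewrite mu_step zL// /sL usign_right// scale0r addr0.
  have tJ := dyadic_right_sub tI.
  by rewrite mv_step zL// /sL usign_right// scale0r oppr0 add0r.
- apply: realizes_ext (IHn _ (step s true false) (sub_left _ IR)) => // t tI.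
    have tJ := dyadic_left_sub tI.
    by rewrite mu_step zR// /sR usign_left// scale0r add0r.
  have tJ := dyadic_left_sub tI.
  by rewrite mv_step zR// /sR usign_left// scale0r addr0 !scaleN1r.
- apply: realizes_ext (IHn _ (step s true true) (sub_right _ IR)) => // t tI.
    have tJ := dyadic_right_sub tI.
    by rewrite mu_step zR// /sR usign_right// scale0r add0r.
  have tJ := dyadic_right_sub tI.
  by rewrite mv_step zR// /sR usign_right// scale0r addr0 !scale1r.
Qed.

Variables (D : set R) (p C : R).
Hypotheses (mD : measurable D) (D01 : `[0, 1[ `<=` D) (p0 : 0 < p).
Hypothesis TC : opnorm X D p T = C%:E.
Variable g0 : R -> R.
Hypothesis T_top : T (haar R (0, 0)) g0.
Hypotheses (g00 : forall t, `[0, 1[%classic t -> g0 t = 0)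
  (mg0 : measurable_fun setT g0).

(* Feeding the walk to [right_half [0,1)], its opposite to [left_half [0,1)]
   gives a function of mean zero whose only large-scale Haar coefficient, the
   one on [0,1), is annihilated on [0,1); hence the start value [mu s] does not
   contribute to the image. *)
Lemma shift_walk n s :
  iter n mean (fun s' => `|mv s' - mv s| `^ p) s <=
  C `^ p * iter n mean (fun s' => `|mu s'| `^ p) s.
Proof.
set L : dyadic := left_half (0, 0); set P : dyadic := right_half (0, 0).
have L01 : dyadic_set R L `<=` `[0, 1[.
  by rewrite -dyadic_set00; exact: dyadic_left_sub.
have P01 : dyadic_set R P `<=` `[0, 1[.
  by rewrite -dyadic_set00; exact: dyadic_right_sub.
have [F1 [G1 [Z1 [T1 out1 m1 phi1]]]] := realizes_walk n s L01.
have [F2 [G2 [Z2 [T2 out2 m2 phi2]]]] := realizes_walk n s P01.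
have T0 := extends1 (mu s) T_top.
have TFG := extendsD (extendsN T1) (extendsD T2 T0).
set F := (fun t => _) in TFG; set G := (fun t => _) in TFG.
have h1 : dyadic_length R (0, 0) = 1 by rewrite /dyadic_length oppr0 expr0z.
have FL t : dyadic_set R L t -> F t = - mu (Z1 t).
  move=> tL; rewrite /F (out2 _ (dyadic_disjoint tL)).1 add0r.
  rewrite haarE usign_left// h1 sqrtr1 invr1 mul1r scaleN1r (m1 _ tL).1.
  by rewrite opprD addrC.
have FP t : dyadic_set R P t -> F t = mu (Z2 t).
  move=> tP; have tL : ~ dyadic_set R L t by move/dyadic_disjoint.
  rewrite /F (out1 _ tL).1 oppr0 add0r.
  by rewrite haarE usign_right// h1 sqrtr1 invr1 mul1r scale1r (m2 _ tP).1 addrC.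
have GL t : dyadic_set R L t -> G t = - (mv (Z1 t) - mv s).
  move=> tL; rewrite /G (out2 _ (dyadic_disjoint tL)).2 g00; last exact: L01.
  by rewrite scale0r !addr0 (m1 _ tL).2 addrC addrA addNr add0r.
have GP t : dyadic_set R P t -> G t = mv (Z2 t) - mv s.
  move=> tP; have tL : ~ dyadic_set R L t by move/dyadic_disjoint.
  rewrite /G (out1 _ tL).2 g00; last exact: P01.
  by rewrite scale0r !addr0 oppr0 add0r (m2 _ tP).2 addrC addrA addNr add0r.
have m01 : measurable (`[0, 1[%classic : set R) by exact: measurable_itv.
(* Both halves of [[0, 1)] run the walk from the same state [s], so two expectations of weight 1/2
   add up to one; the norm does not see the opposite sign on the left half. *)
have pieces (H : R -> X) (psi : S -> R) : (forall s, 0 <= psi s) ->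
    (forall t, dyadic_set R L t -> `|H t| `^ p = psi (Z1 t)) ->
    (forall t, dyadic_set R P t -> `|H t| `^ p = psi (Z2 t)) ->
    measurable_fun `[0 : R, 1[ (fun t => `|H t| `^ p) /\
    (\int[lebesgue_measure]_(t in `[0%R, 1%R[) (`|H t| `^ p)%:E =
      (iter n mean psi s)%:E)%E.
  move=> psi0 HL HP; rewrite -dyadic_set00 dyadic_setU -/L -/P.
  have [mL iL] := phi1 _ psi0; have [mP iP] := phi2 _ psi0.
  have mHL : measurable_fun (dyadic_set R L) (fun t => `|H t| `^ p).
    by apply: eq_measurable_fun mL => t /[!inE] tI /=; rewrite HL.
  have mHP : measurable_fun (dyadic_set R P) (fun t => `|H t| `^ p).
    by apply: eq_measurable_fun mP => t /[!inE] tI /=; rewrite HP.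
  have mH : measurable_fun (dyadic_set R L `|` dyadic_set R P)
      (fun t => `|H t| `^ p).
    by apply/measurable_funU => //; exact: measurable_dyadic.
  split=> //; rewrite ge0_integral_setU//=.
  - transitivity ((dyadic_length R L * iter n mean psi s)%:E +
        (dyadic_length R P * iter n mean psi s)%:E)%E; last first.
      rewrite dyadic_length_left dyadic_length_right h1 -EFinD.
      by congr EFin; field.
    congr (_ + _)%E.
      by apply: etrans iL; apply: eq_integral => t /[!inE] tI; rewrite HL.
    by apply: etrans iP; apply: eq_integral => t /[!inE] tI; rewrite HP.
  - exact: measurable_dyadic.
  - exact: measurable_dyadic.
  - exact/measurable_EFinP.
  - by apply/disj_setPRL => t /= /[swap] /dyadic_disjoint.
have [mF iF] : measurable_fun `[0 : R, 1[ (fun t => `|F t| `^ p) /\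
    (\int[lebesgue_measure]_(t in `[0%R, 1%R[) (`|F t| `^ p)%:E =
      (iter n mean (fun s' => `|mu s'| `^ p) s)%:E)%E.
  apply: pieces => [s'|t tL|t tP]; first exact: powR_ge0.
    by rewrite FL// normrN.
  by rewrite FP.
have [mG iG] : measurable_fun `[0 : R, 1[ (fun t => `|G t| `^ p) /\
    (\int[lebesgue_measure]_(t in `[0%R, 1%R[) (`|G t| `^ p)%:E =
      (iter n mean (fun s' => `|mv s' - mv s| `^ p) s)%:E)%E.
  apply: pieces => [s'|t tL|t tP]; first exact: powR_ge0.
    by rewrite GL// normrN.
  by rewrite GP.
have DE : D = `[0, 1[%classic `|` (D `\` `[0, 1[%classic).
  by apply/esym/setDUK.
have outLP t : (D `\` `[0, 1[%classic) t ->
    ~ dyadic_set R L t /\ ~ dyadic_set R P t.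
  by move=> [_ t01]; split; [move/L01|move/P01].
have F0 t : (D `\` `[0, 1[%classic) t -> F t = 0.
  move=> tD; have [tL tP] := outLP _ tD; case: tD => _ t01.
  rewrite /F (out1 _ tL).1 (out2 _ tP).1 haarE usign_out ?dyadic_set00//.
  by rewrite mulr0 scale0r oppr0 !addr0.
have G0 t : (D `\` `[0, 1[%classic) t -> G t = g0 t *: mu s.
  move=> tD; have [tL tP] := outLP _ tD.
  by rewrite /G (out1 _ tL).2 (out2 _ tP).2 oppr0 !add0r.
have mDc : measurable (D `\` `[0, 1[%classic) by exact: measurableD.
have mFD : measurable_fun D (fun t => `|F t| `^ p).
  rewrite DE; apply/measurable_funU => //; split => //.
  apply: (eq_measurable_fun (cst (0 : R))); last exact: measurable_cst.
  by move=> t /[!inE] tD; rewrite F0// normr0 powR0// gt_eqF.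
have mGD : measurable_fun D (fun t => `|G t| `^ p).
  rewrite DE; apply/measurable_funU => //; split => //.
  apply: (eq_measurable_fun (fun t => (`|g0 t| * `|mu s|) `^ p)).
    by move=> t /[!inE] tD; rewrite G0// normrZ.
  apply: (measurableT_comp (measurable_powR _)).
  apply: measurable_funM; last exact: measurable_cst.
  apply: measurableT_comp => //; exact: measurable_funS mg0.
have := @opnorm_extends _ _ _ _ _ _ (iter n mean (fun s' => `|mu s'| `^ p) s)
  _ _ mD p0 TC TFG mFD mGD.
have -> : (\int[lebesgue_measure]_(t in D) (`|F t| `^ p)%:E =
    \int[lebesgue_measure]_(t in `[0%R, 1%R[) (`|F t| `^ p)%:E)%E.
  have -> : `[0, 1[%classic = D `&` `[0%R, 1%R[%classic :> set R.
    by rewrite setIC; apply/esym/setIidPl.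
  rewrite integral_mkcondr; apply: eq_integral => t /[!inE] tD.
  rewrite patchE; case: ifPn => // /negP t01; rewrite F0; last first.
    by split=> // tI; apply: t01; rewrite inE.
  by rewrite normr0 powR0// gt_eqF.
(* [G] equals [g0 t *: mu s] on the rest of [D] and need not vanish there; dropping that part of the
   integral only decreases it. *)
rewrite iF lexx => /(_ isT) GD; rewrite -lee_fin; apply: le_trans GD.
rewrite -iG; apply: ge0_subset_integral => //.
- exact/measurable_EFinP.
Qed.

End dyadic_tree.

Lemma measurable_haar (R : realType) (I : dyadic) :
  measurable_fun setT (haar R I).
Proof.
apply: measurable_funM; first exact: measurable_cst.
by apply: measurable_funB; apply: measurable_indic; exact: measurable_dyadic.
Qed.

Section shift_operators.
Context {R : realType} {X : normedModType R}.
Variables (S : Type) (step : S -> bool -> bool -> S) (al be mu mv : S -> X).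
Hypothesis mu_step : forall s d r,
  mu (step s d r) = mu s + bsign r *: (if d then be s else al s).
Hypothesis mv_step : forall s d r,
  mv (step s d r) = mv s + bsign r *: (if d then - al s else be s).
Variables (p C : R).
Hypothesis p0 : 0 < p.

(** On the line, [[0, 1)] is the left half of [[0, 2)], encoded by [(-1, 0)]. The shift therefore
    sends its Haar function to one supported in [[1, 2)], which vanishes on [[0, 1)] as required of
    [g0]. *)
Lemma shift_line_walk : opnorm X setT p (shift_line R) = C%:E -> forall n s,
  iter n (mean step) (fun s' => `|mv s' - mv s| `^ p) s <=
  C `^ p * iter n (mean step) (fun s' => `|mu s'| `^ p) s.
Proof.
move=> TC n s.
have top : (0, 0) = left_half (-1, 0) by [].
apply: (shift_walk _ _ mu_step mv_step _ _ _ TC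
  (g0 := fun t => - haar R (right_half (-1, 0)) t)) => //.
- by move=> I _; exact: shift_line_right.
- by move=> I _; exact: shift_line_left.
- by rewrite top; exact: shift_line_left.
- move=> t; rewrite -dyadic_set00 top => /dyadic_disjoint It.
  by rewrite haarE usign_out ?mulr0 ?oppr0// => /dyadic_left_sub.
- apply: measurable_funN; exact: measurable_haar.
Qed.

Lemma shift_unit_walk : opnorm X `[0, 1[ p (shift_unit R) = C%:E ->
  forall n s,
  iter n (mean step) (fun s' => `|mv s' - mv s| `^ p) s <=
  C `^ p * iter n (mean step) (fun s' => `|mu s'| `^ p) s.
Proof.
move=> TC n s.
apply: (shift_walk _ _ mu_step mv_step _ _ _ TC (g0 := fun=> 0)) => //.
- exact: shift_unit_right.
- exact: shift_unit_left.
- exact: shift_unit_top.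
Qed.

End shift_operators.

(** * Harmonic functions along a lattice walk *)

Section trigonometric_estimates.
Context {R : realType}.
Implicit Types x t : R.

Lemma sin_sub_MVT x : 0 <= x ->
  exists2 c, 0 <= c <= x & x - sin x = (1 - cos c) * x.
Proof.
move=> x0.
have df y : y \in `]0, x[ ->
    is_derive y 1 (fun y => y - sin y) ((fun y => 1 - cos y) y).
  by move=> _; exact: is_deriveB.
have cf : {within `[0, x], continuous (fun y => y - sin y)}.
  apply: continuous_subspaceT => y; apply: cvgB; first exact: cvg_id.
  exact: continuous_sin.
have [c cx xE] := MVT_segment x0 df cf.
by exists c; [rewrite in_itv in cx|move: xE; rewrite sin0 !subr0].
Qed.

Lemma sin_le_id x : 0 <= x -> sin x <= x.
Proof.
move=> x0; rewrite -subr_ge0; have [c _ ->] := sin_sub_MVT x0.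
by rewrite mulr_ge0// subr_ge0 cos_le1.
Qed.

Lemma norm_sin_le x : `|sin x| <= `|x|.
Proof.
wlog x0 : x / 0 <= x => [hw|].
  have [/hw//|x0] := leP 0 x.
  by rewrite -normrN -sinN -[leRHS]normrN; apply: hw; rewrite oppr_ge0 ltW.
have [x1|x1] := leP x 1.
  rewrite !ger0_norm ?sin_le_id// sin_ge0_pi// x0/= (le_trans x1)//.
  by rewrite (le_trans _ (@pi_ge2 R))// ler1n.
by rewrite (le_trans (sin_max _))// ger0_norm// ltW.
Qed.

Lemma onem_cosE x : 1 - cos x = 2 * sin (x / 2) ^+ 2.
Proof.
rewrite {1}(_ : x = (x / 2) *+ 2); last by rewrite mulr2n -splitr.
by rewrite cos_mulr2n cos2sin2; ring.
Qed.

Lemma onem_cos_ge0 x : 0 <= 1 - cos x.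
Proof. by rewrite subr_ge0 cos_le1. Qed.

Lemma onem_cos_le x : 1 - cos x <= x ^+ 2 / 2.
Proof.
rewrite onem_cosE -[X in 2 * X]real_normK ?num_real//.
have : `|sin (x / 2)| ^+ 2 <= `|x / 2| ^+ 2.
  by rewrite ler_sqr ?nnegrE// norm_sin_le.
by rewrite [X in _ <= X -> _]real_normK ?num_real//; lra.
Qed.

Lemma norm_sin_sub_le x : `|sin x - x| <= `|x| ^+ 3 / 2.
Proof.
wlog x0 : x / 0 <= x => [hw|].
  have [/hw//|x0] := leP 0 x.
  rewrite -normrN opprB addrC -[X in _ <= `|X| ^+ _ / _]opprK normrN.
  by rewrite -[X in X + x]sinN -[X in _ + X]opprK; apply: hw; rewrite oppr_ge0 ltW.
rewrite distrC (ger0_norm x0) ger0_norm ?subr_ge0 ?sin_le_id//.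
have [c /andP[c0 cx] ->] := sin_sub_MVT x0.
rewrite exprSr mulrAC ler_wpM2r// (le_trans (onem_cos_le _))//.
by rewrite ler_wpM2r// ler_sqr.
Qed.

(** For the upper bound, [1 - x <= expR (- x)] gives [(1 - x) * expR x <= 1], to be compared with
    [(1 - x) * (1 + x + 2 * x ^+ 2) >= 1], valid for [x <= 1/2]. *)
Lemma expR_sub_le x : `|x| <= 2^-1 -> `|expR x - 1 - x| <= 2 * x ^+ 2.
Proof.
rewrite ler_norml => /andP[x0 x1].
have := expR_ge1Dx x; have := expR_ge1Dx (- x); rewrite expRN => eN e1.
rewrite ger0_norm; last by lra.
have e0 := expR_gt0 x; suff : expR x <= 1 + x + 2 * x ^+ 2 by lra.
have : (1 - x) * expR x <= 1.
  by rewrite -(@ler_pM2r _ (expR x)) // in eN; rewrite mulVf ?gt_eqF in eN.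
have : 1 <= (1 - x) * (1 + x + 2 * x ^+ 2).
  rewrite -subr_ge0 (_ : _ - 1 = x ^+ 2 * (1 - 2 * x)); last by ring.
  by rewrite mulr_ge0 ?sqr_ge0//; lra.
move=> h1 h2; have := le_trans h2 h1; rewrite ler_pM2l//; lra.
Qed.

(** Up to a factor this is the drift of a wave under one step of the lattice walk; the quadratic
    terms cancel because the wave is harmonic. With [s = t / 2] it is
    [2 * (sinh s - sin s) * (sinh s + sin s)], with factors of order [s ^+ 2] and [s]. *)
Lemma cos_cosh_le t : `|t| <= 1 ->
  `|cos t + (expR t + expR (- t)) / 2 - 2| <= 3 * `|t| ^+ 3.
Proof.
move=> t1; pose s := t / 2.
have s1 : `|s| <= 2^-1.
  by rewrite /s normrM [X in _ * X]gtr0_norm ?invr_gt0//; lra.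
have tE : t = s + s by rewrite /s -splitr.
pose sh := (expR s - expR (- s)) / 2.
have shE : `|sh - s| <= 2 * s ^+ 2.
  have := expR_sub_le s1; have := @expR_sub_le (- s).
  rewrite normrN sqrrN => /(_ s1).
  by rewrite !ler_norml => /andP[a1 a2] /andP[b1 b2]; apply/andP; split;
    rewrite /sh; lra.
have -> : cos t + (expR t + expR (- t)) / 2 - 2 =
    2 * ((sh - sin s) * (sh + sin s)).
  have -> : cos t = 1 - 2 * sin s ^+ 2 by rewrite -onem_cosE; lra.
  have h : expR s * expR (- s) = 1 by rewrite expRxMexpNx_1.
  rewrite [X in expR X]tE [X in expR (- X)]tE opprD !expRD /sh.
  apply/subr0_eq; transitivity (expR s * expR (- s) - 1); first by field.
  by rewrite h subrr.
have st : `|s| = `|t| / 2.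
  by rewrite /s normrM [X in _ * X]gtr0_norm ?invr_gt0.
have s2 : s ^+ 2 = `|s| ^+ 2 by rewrite real_normK// num_real.
have d1 : `|sh - sin s| <= 3 * `|s| ^+ 2.
  rewrite (_ : sh - sin s = (sh - s) - (sin s - s)); last by ring.
  rewrite (le_trans (ler_normB _ _))//.
  have := norm_sin_sub_le s; rewrite s2 in shE => h.
  have : `|s| ^+ 3 <= `|s| ^+ 2.
    by rewrite exprSr ler_piMr ?sqr_ge0//; lra.
  by have := sqr_ge0 `|s|; lra.
have d2 : `|sh + sin s| <= 3 * `|s|.
  rewrite (_ : sh + sin s = (sh - s) + (sin s + s)); last by ring.
  rewrite (le_trans (ler_normD _ _))//.
  have := norm_sin_le s; rewrite s2 in shE => h.
  have := ler_normD (sin s) s.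
  have : `|s| ^+ 2 <= `|s| * 2^-1 by rewrite expr2 ler_wpM2l.
  by lra.
rewrite !normrM ger0_norm//.
apply: (@le_trans _ _ (2 * (3 * `|s| ^+ 2 * (3 * `|s|)))).
  by rewrite ler_pM2l// ler_pM.
rewrite st (_ : 2 * _ = 9 / 4 * `|t| ^+ 3); last by field.
by rewrite ler_wpM2r ?exprn_ge0//; lra.
Qed.

End trigonometric_estimates.

(** * Expectations along a walk and a second-moment bound *)

Section mean_operator.
Context {R : realType} {S : Type}.
Variable step : S -> bool -> bool -> S.
Implicit Types (phi psi : S -> R) (s : S).

Local Notation M n := (iter n (mean step)).

(** Functions are compared only at states that can occur: [P k] is an invariant of the states at
    time [k], for instance a bound growing with the number of steps. *)
Lemma iter_mean_le_inv (P : nat -> S -> Prop) n k phi psi s :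
  (forall k s d r, P k s -> P k.+1 (step s d r)) ->
  (forall s, P (k + n)%N s -> phi s <= psi s) ->
  P k s -> M n phi s <= M n psi s.
Proof.
move=> Pstep; elim: n k s => [|n IHn] k s le_phi Pk /=.
  by apply: le_phi; rewrite addn0.
have h d r : M n phi (step s d r) <= M n psi (step s d r).
  apply: (IHn k.+1); last exact: Pstep.
  by move=> s'; rewrite addSnnS; exact: le_phi.
by rewrite /mean ler_pM2r ?invr_gt0//; do 3 (apply: lerD; last exact: h).
Qed.

Lemma iter_mean_le n phi psi s : (forall s, phi s <= psi s) ->
  M n phi s <= M n psi s.
Proof.
by move=> le_phi; apply: (@iter_mean_le_inv (fun _ _ => True) n 0).
Qed.

Lemma iter_meanD n phi psi s :
  M n (fun s => phi s + psi s) s = M n phi s + M n psi s.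
Proof. by elim: n s => //= n IHn s; rewrite /mean !IHn; field. Qed.

Lemma iter_meanZ n (c : R) phi s : M n (fun s => c * phi s) s = c * M n phi s.
Proof. by elim: n s => //= n IHn s; rewrite /mean !IHn; field. Qed.

Lemma iter_mean_cst n (c : R) s : M n (fun=> c) s = c.
Proof. by elim: n s => //= n IHn s; rewrite /mean !IHn; field. Qed.

Lemma iter_mean_sum n (I : Type) (r : seq I) (f : I -> S -> R) s :
  M n (fun s => \sum_(i <- r) f i s) s = \sum_(i <- r) M n (f i) s.
Proof.
elim: r => [|i r IHr].
  by rewrite big_nil -[RHS](iter_mean_cst n 0 s); congr (iter n _ _ s);
    apply/funext => s'; rewrite big_nil.
rewrite big_cons -IHr -iter_meanD; congr (iter n _ _ s).
by apply/funext => s'; rewrite big_cons.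
Qed.

Lemma iter_mean_map (S' : Type) (step' : S' -> bool -> bool -> S') (f : S -> S')
    n (phi : S' -> R) s :
  (forall s d r, f (step s d r) = step' (f s) d r) ->
  M n (phi \o f) s = iter n (mean step') phi (f s).
Proof.
by move=> fstep; elim: n s => //= n IHn s; rewrite /mean !IHn !fstep.
Qed.

Variables (E : S -> R) (d e : R).
Hypotheses (d0 : 0 <= d) (e0 : 0 <= e).
Hypothesis E_inc : forall s b r, `|E (step s b r) - E s| <= d.
Hypothesis E_drift : forall s, `|mean step E s - E s| <= e.

(** Adding 1 to [E s ^+ 2] makes the growth multiplicative: the drift contributes at most
    [2 * |E| * e <= e * (E ^+ 2 + 1)] and the increments [d ^+ 2], hence the factor
    [1 + (e + d ^+ 2)] per step. *)
Lemma iter_mean_sqr n s : E s = 0 ->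
  M n (fun s => E s ^+ 2) s <= (1 + (e + d ^+ 2)) ^+ n - 1.
Proof.
move=> Es; pose phi s := E s ^+ 2 + 1.
have step1 s' : mean step phi s' <= (1 + (e + d ^+ 2)) * phi s'.
  have inc b r : E (step s' b r) ^+ 2 <=
      E s' ^+ 2 + 2 * E s' * (E (step s' b r) - E s') + d ^+ 2.
    have : (E (step s' b r) - E s') ^+ 2 <= d ^+ 2.
      rewrite -[leLHS]real_normK ?num_real// ler_sqr ?nnegrE//.
    by rewrite -subr_ge0 => h; rewrite -subr_ge0; apply: le_trans h _;
      rewrite le_eqVlt; apply/orP; left; apply/eqP; ring.
  have drift : 2 * E s' * (mean step E s' - E s') <= e * (E s' ^+ 2 + 1).
    rewrite (le_trans (ler_norm _))// !normrM [X in X * _ * _]ger0_norm//.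
    apply: (@le_trans _ _ (2 * `|E s'| * e)).
      by rewrite ler_wpM2l// mulr_ge0.
    rewrite mulrC ler_wpM2l// -[X in X + 1]real_normK ?num_real//.
    by have := sqr_ge0 (`|E s'| - 1); rewrite sqrrB1; lra.
  have := inc false false; have := inc false true.
  have := inc true false; have := inc true true.
  move: drift; rewrite /phi /mean => h1 h2 h3 h4 h5.
  have d20 : 0 <= d ^+ 2 by exact: sqr_ge0.
  have : 0 <= d ^+ 2 * E s' ^+ 2 by rewrite mulr_ge0// sqr_ge0.
  by lra.
have main m s' : M m phi s' <= (1 + (e + d ^+ 2)) ^+ m * phi s'.
  elim: m s' => [|m IHm] s'; first by rewrite expr0 mul1r.
  rewrite iterSr (le_trans (iter_mean_le m s' step1))// iter_meanZ.
  by rewrite [X in _ <= X * _]exprS -mulrA ler_wpM2l// addr_ge0// addr_ge0// sqr_ge0.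
have := main n s; rewrite /phi iter_meanD iter_mean_cst Es expr0n/= add0r mulr1.
by rewrite lerBrDr.
Qed.

(** From the second moment by [|E| <= E ^+ 2 / (2 * l) + l / 2], which takes the place of the
    Cauchy-Schwarz inequality. *)
Lemma iter_mean_norm n s (l : R) : 0 < l -> E s = 0 ->
  (1 + (e + d ^+ 2)) ^+ n - 1 <= l ^+ 2 -> M n (fun s => `|E s|) s <= l.
Proof.
move=> l0 Es nl; have le1 s' : `|E s'| <= (2 * l)^-1 * E s' ^+ 2 + l / 2.
  rewrite -[E s' ^+ 2]real_normK ?num_real//.
  rewrite -(@ler_pM2l _ (2 * l)) ?mulr_gt0// mulrDr mulVKf ?gt_eqF ?mulr_gt0//.
  by have := sqr_ge0 (`|E s'| - l); rewrite sqrrB; lra.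
rewrite (le_trans (iter_mean_le n s le1))// iter_meanD iter_mean_cst iter_meanZ.
have := le_trans (iter_mean_sqr n Es) nl.
rewrite -(@ler_pM2l _ (2 * l)^-1) ?invr_gt0 ?mulr_gt0// => h.
rewrite [leRHS]splitr lerD2r (le_trans h)//.
by rewrite le_eqVlt; apply/orP; left; apply/eqP; field; rewrite gt_eqF.
Qed.

End mean_operator.

(** * Harmonic waves in the upper half-plane *)

Section waves.
Context {R : realType}.
Implicit Types (n : nat) (a x y h : R).

Definition cos_wave n a x y : R := expR (- (n%:R * y)) * cos (n%:R * x + a).
(** The harmonic conjugate that vanishes at infinite height. At frequency 0 the formula would leave
    the constant [sin a], hence the case distinction. *)
Definition sin_wave n a x y : R :=
  if n == 0%N then 0 else expR (- (n%:R * y)) * sin (n%:R * x + a).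

Lemma cos_wave_x n a x y h : cos_wave n a (x + h) y =
  cos (n%:R * h) * cos_wave n a x y - sin (n%:R * h) * sin_wave n a x y.
Proof.
rewrite /cos_wave /sin_wave mulrDr addrAC cosD; case: eqP => [->|_].
  by rewrite !mul0r sin0; ring.
by ring.
Qed.

Lemma sin_wave_x n a x y h : sin_wave n a (x + h) y =
  cos (n%:R * h) * sin_wave n a x y + sin (n%:R * h) * cos_wave n a x y.
Proof.
rewrite /cos_wave /sin_wave mulrDr addrAC sinD; case: eqP => [->|_].
  by rewrite !mul0r sin0; ring.
by ring.
Qed.

Lemma cos_wave_y n a x y h :
  cos_wave n a x (y + h) = expR (- (n%:R * h)) * cos_wave n a x y.
Proof. by rewrite /cos_wave mulrDr opprD expRD; ring. Qed.

Lemma sin_wave_y n a x y h :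
  sin_wave n a x (y + h) = expR (- (n%:R * h)) * sin_wave n a x y.
Proof.
by rewrite /sin_wave; case: ifP => _; rewrite ?mulr0// mulrDr opprD expRD; ring.
Qed.

Lemma norm_cos_wave n a x y : 0 <= y -> `|cos_wave n a x y| <= 1.
Proof.
move=> y0; rewrite /cos_wave normrM mulr_ile1// ?cos_max//.
by rewrite ger0_norm ?expR_ge0// expR_le1 oppr_le0 mulr_ge0.
Qed.

Lemma norm_sin_wave n a x y : 0 <= y -> `|sin_wave n a x y| <= expR (- y).
Proof.
move=> y0; rewrite /sin_wave; case: eqP => [_|/eqP n0].
  by rewrite normr0 expR_ge0.
rewrite normrM -[leRHS]mulr1 ler_pM// ?sin_max//.
by rewrite ger0_norm ?expR_ge0// ler_expR lerN2 ler_peMl// ler1n lt0n.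
Qed.

Lemma norm_sin_wave1 n a x y : 0 <= y -> `|sin_wave n a x y| <= 1.
Proof.
by move=> y0; rewrite (le_trans (norm_sin_wave _ _ _ y0))// expR_le1 oppr_le0.
Qed.

Lemma cos_wave_periodic n a x y : cos_wave n a (x + pi *+ 2) y = cos_wave n a x y.
Proof.
rewrite /cos_wave; congr (_ * _); rewrite mulrDr addrAC.
by rewrite [n%:R * (pi *+ 2)]mulr_natl (periodicn (@cosD2pi R)).
Qed.

Lemma sin_wave_periodic n a x y : sin_wave n a (x + pi *+ 2) y = sin_wave n a x y.
Proof.
rewrite /sin_wave; case: ifP => // _; congr (_ * _); rewrite mulrDr addrAC.
by rewrite [n%:R * (pi *+ 2)]mulr_natl (periodicn (@sinD2pi R)).
Qed.

Lemma continuous_cos_wave n a y : continuous (cos_wave n a ^~ y).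
Proof.
move=> x; apply: cvgM; first exact: cvg_cst.
apply: continuous_comp; last exact: continuous_cos.
by apply: cvgD; [apply: cvgM; [exact: cvg_cst|exact: cvg_id]|exact: cvg_cst].
Qed.

Lemma continuous_sin_wave n a y : continuous (sin_wave n a ^~ y).
Proof.
move=> x; rewrite /sin_wave; case: (n == 0%N); first exact: cvg_cst.
apply: cvgM; first exact: cvg_cst.
apply: continuous_comp; last exact: continuous_sin.
by apply: cvgD; [apply: cvgM; [exact: cvg_cst|exact: cvg_id]|exact: cvg_cst].
Qed.

End waves.

(** * The lattice walk and its two martingales *)

Section walk.
Context {R : realType} {X : normedModType R}.
Variables (K : nat) (n : 'I_K -> nat) (a : 'I_K -> R) (x_ : 'I_K -> X).
Variables (m : nat) (h : R).

(** The height is stored as a multiple of [h], so that the absorbing levels 0 and [m] are hit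
    exactly; the abscissa is an arbitrary real. *)
Definition pos_step (z : R * nat) (d r : bool) : R * nat :=
  if (0 < z.2 < m)%N then
    if d then (z.1, if r then z.2.+1 else z.2.-1) else (z.1 + bsign r * h, z.2)
  else z.

(* position, then the two martingales, coordinate by coordinate *)
Definition state : Type := ((R * nat) * ('I_K -> R) * ('I_K -> R))%type.

Implicit Types (z : R * nat) (s : state) (k : 'I_K).

Definition cosp k z : R := cos_wave (n k) (a k) z.1 (z.2%:R * h).
Definition sinp k z : R := sin_wave (n k) (a k) z.1 (z.2%:R * h).

(* [h] times the partial derivatives of [cosp] *)
Definition slope_x k z : R :=
  if (0 < z.2 < m)%N then - ((n k)%:R * h) * sinp k z else 0.
Definition slope_y k z : R :=
  if (0 < z.2 < m)%N then - ((n k)%:R * h) * cosp k z else 0.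

Definition walk_step s (d r : bool) : state :=
  (pos_step s.1.1 d r,
   fun k => s.1.2 k +
     bsign r * (if d then slope_y k s.1.1 else slope_x k s.1.1),
   fun k => s.2 k +
     bsign r * (if d then - slope_x k s.1.1 else slope_y k s.1.1)).

Definition vsum (c : 'I_K -> R) : X := \sum_k c k *: x_ k.

Definition wmu s : X := vsum s.1.2.
Definition wmv s : X := vsum s.2.

Lemma wmu_step s d r : wmu (walk_step s d r) = wmu s + bsign r *:
  (if d then vsum (slope_y ^~ s.1.1) else vsum (slope_x ^~ s.1.1)).
Proof.
rewrite /wmu /vsum; case: d => /=; rewrite scaler_sumr -big_split/=;
  by apply: eq_bigr => k _; rewrite scalerA scalerDl.
Qed.

Lemma wmv_step s d r : wmv (walk_step s d r) = wmv s + bsign r *: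
  (if d then - vsum (slope_x ^~ s.1.1) else vsum (slope_y ^~ s.1.1)).
Proof.
rewrite /wmv /vsum; case: d => /=; rewrite ?scalerN scaler_sumr -?sumrN
  -big_split/=;
  by apply: eq_bigr => k _; rewrite scalerA scalerDl ?mulrN ?scaleNr.
Qed.

Definition err_cos k s : R := cosp k s.1.1 - s.1.2 k.
(** By the Cauchy-Riemann equations the second martingale follows [- sinp], hence the plus sign. It
    will start at 0, with [c] the initial value of [sinp]. *)
Definition err_sin k (c : R) s : R := sinp k s.1.1 + s.2 k - c.

Hypothesis h0 : 0 <= h.
Variable b : R.
Hypotheses (b1 : b * h <= 2^-1) (nb : forall k, (n k)%:R <= b).

Let t k := (n k)%:R * h.

Let t_ge0 k : 0 <= t k. Proof. by rewrite /t mulr_ge0. Qed.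

Let t_le k : t k <= b * h. Proof. by rewrite /t ler_wpM2r. Qed.

Let t_le2 k : t k <= 2^-1. Proof. exact: le_trans (t_le k) b1. Qed.

(** What the addition formulas for a wave [P] with conjugate [Q] leave over once the terms linear in
    [t k], which the martingales reproduce, are removed. *)
Definition wave_increments (E : state -> R) k s (P Q : R) := forall d r,
  E (walk_step s d r) - E s =
  if (0 < s.1.1.2 < m)%N then
    if d then (expR (- (bsign r * t k)) - 1 + bsign r * t k) * P
    else (cos (t k) - 1) * P - bsign r * (sin (t k) - t k) * Q
  else 0.

Lemma bsign_norm r : `|bsign r : R| = 1.
Proof. by case: r => /=; rewrite ?normrN1 ?normr1. Qed.

Lemma wave_increments_le E k s P Q : wave_increments E k s P Q ->
  `|P| <= 1 -> `|Q| <= 1 -> forall d r,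
  `|E (walk_step s d r) - E s| <= 2 * (b * h) ^+ 2.
Proof.
move=> EPQ P1 Q1 d r; rewrite EPQ.
have bh2 : t k ^+ 2 <= (b * h) ^+ 2.
  by rewrite ler_sqr ?nnegrE// (le_trans (t_ge0 k) (t_le k)).
case: ifP => _; last by rewrite normr0 mulr_ge0// sqr_ge0.
apply: (@le_trans _ _ (2 * t k ^+ 2)); last by rewrite ler_pM2l.
case: d.
  have := @expR_sub_le _ (- (bsign r * t k)).
  rewrite normrN normrM bsign_norm mul1r (ger0_norm (t_ge0 k)) => /(_ (t_le2 k)).
  have -> : (- (bsign r * t k)) ^+ 2 = t k ^+ 2.
    by rewrite sqrrN exprMn; case: r; rewrite /bsign ?sqrrN expr1n mul1r.
  rewrite opprK => h1.
  by rewrite normrM -[leRHS]mulr1 ler_pM.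
rewrite (le_trans (ler_normB _ _))// !normrM bsign_norm mul1r.
have c1 := onem_cos_le (t k); have c0 := onem_cos_ge0 (t k).
have s1 := norm_sin_sub_le (t k); rewrite (ger0_norm (t_ge0 k)) in s1.
have : t k ^+ 3 <= t k ^+ 2.
  by rewrite exprSr ler_piMr ?sqr_ge0// (le_trans (t_le2 k))//; lra.
rewrite -[cos _ - 1]opprB normrN (ger0_norm c0) => t3.
have := @ler_pM _ _ _ _ _ c0 (normr_ge0 P) c1 P1.
have := @ler_pM _ _ _ _ _ (normr_ge0 _) (normr_ge0 Q) s1 Q1.
by have := sqr_ge0 (t k); lra.
Qed.

(** Averaging over the sign [r] cancels the [Q]-term. The four moves together leave
    [(cos t + cosh t - 2) / 2 * P], which is of third order. *)
Lemma wave_drift_le E k s P Q : wave_increments E k s P Q -> `|P| <= 1 ->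
  `|mean walk_step E s - E s| <= 2 * (b * h) ^+ 3.
Proof.
move=> EPQ P1.
have -> : mean walk_step E s - E s =
    ((E (walk_step s false false) - E s) + (E (walk_step s false true) - E s) +
     (E (walk_step s true false) - E s) + (E (walk_step s true true) - E s)) / 4.
  by rewrite /mean; field.
have bh3 : t k ^+ 3 <= (b * h) ^+ 3.
  by apply: lerXn2r; rewrite ?nnegrE// (le_trans (t_ge0 k) (t_le k)).
rewrite !EPQ; case: ifP => _; last first.
  rewrite !addr0 mul0r normr0 mulr_ge0// exprn_ge0//.
  exact: le_trans (t_ge0 k) (t_le k).
apply: (@le_trans _ _ (2 * t k ^+ 3)); last by rewrite ler_pM2l.
rewrite /bsign (_ : _ / 4 =
  (cos (t k) + (expR (t k) + expR (- t k)) / 2 - 2) / 2 * P); last first.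
  by rewrite !mulN1r !mul1r !opprK; field.
have := @cos_cosh_le _ (t k); rewrite (ger0_norm (t_ge0 k)).
have tk2 := t_le2 k; have t30 : 0 <= t k ^+ 3 by rewrite exprn_ge0.
move=> /(_ ltac:(lra)) h1.
rewrite !normrM [X in _ * X * _]gtr0_norm ?invr_gt0// -[leRHS]mulr1 ler_pM//.
by lra.
Qed.

Lemma err_cos_increments k s :
  wave_increments (err_cos k) k s (cosp k s.1.1) (sinp k s.1.1).
Proof.
move=> d r; case: s => [[[x i] mu] nu]; rewrite /err_cos /walk_step/=.
rewrite /pos_step /slope_x /slope_y/=; case: ifP => [/andP[i0 _]|_]; last first.
  by case: d; ring.
rewrite /cosp /sinp; case: d => /=; last first.
  rewrite cos_wave_x /bsign /t; case: r; rewrite ?mul1r ?mulN1r ?mulrN ?cosN ?sinN;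
  by ring.
have -> : (if r then i.+1 else i.-1)%:R * h = i%:R * h + bsign r * h.
  by rewrite -mulrDl; case: r; rewrite /bsign ?natr1// -[in RHS](prednK i0) -natr1 addrK.
by rewrite cos_wave_y /t [(n k)%:R * (bsign r * h)]mulrCA; ring.
Qed.

Lemma err_sin_increments k c s :
  wave_increments (err_sin k c) k s (sinp k s.1.1) (- cosp k s.1.1).
Proof.
move=> d r; case: s => [[[x i] mu] nu]; rewrite /err_sin /walk_step/=.
rewrite /pos_step /slope_x /slope_y/=; case: ifP => [/andP[i0 _]|_]; last first.
  by case: d; ring.
rewrite /cosp /sinp; case: d => /=; last first.
  rewrite sin_wave_x /bsign /t; case: r; rewrite ?mul1r ?mulN1r ?mulrN ?cosN ?sinN;
  by ring.
have -> : (if r then i.+1 else i.-1)%:R * h = i%:R * h + bsign r * h.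
  by rewrite -mulrDl; case: r; rewrite /bsign ?natr1// -[in RHS](prednK i0) -natr1 addrK.
by rewrite sin_wave_y /t [(n k)%:R * (bsign r * h)]mulrCA; ring.
Qed.

End walk.

Section power_lipschitz.
Context {R : realType}.
Implicit Types (p u v B : R).

Lemma powR_lipschitz p B u v : 1 <= p -> 0 <= u <= B -> 0 <= v ->
  u `^ p <= v `^ p + p * B `^ (p - 1) * `|u - v|.
Proof.
move=> p1 /andP[u0 uB] v0; have p0 : 0 < p by exact: lt_le_trans p1.
have B0 : 0 <= B by exact: le_trans uB.
have [uv|vu] := leP u v.
  rewrite ler_wpDr//; first by rewrite !mulr_ge0 ?powR_ge0// ltW.
  by rewrite ge0_ler_powR ?nnegrE// ltW.
rewrite gtr0_norm ?subr_gt0//.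
have le_pow c : 0 <= c -> c <= B -> c `^ (p - 1) <= B `^ (p - 1).
  by move=> c0 cB; rewrite ge0_ler_powR ?nnegrE// subr_ge0.
(* The case [v = 0] is treated directly, since [powR] is differentiated at positive points only. *)
move: v0; rewrite le_eqVlt => /predU1P[v0|v0].
  rewrite -v0 powR0 ?gt_eqF// add0r subr0 -mulr_powRB1// mulrC.
  by rewrite ler_wpM2r// (le_trans (le_pow _ u0 uB))// ler_peMl ?powR_ge0.
have df c : c \in `]v, u[ -> is_derive c 1 (@powR R ^~ p) ((fun c => p * c `^ (p - 1)) c).
  rewrite in_itv/= => /andP[vc _]; have c0 : 0 < c by exact: lt_trans vc.
  have cI : c \in `]0, +oo[ by rewrite in_itv/= c0.
  have := derivableP (@derivable_powR R 1 p c cI).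
  by rewrite -derive1E powR_derive1.
have cf : {within `[v, u], continuous (@powR R ^~ p)}.
  apply: derivable_within_continuous => c; rewrite in_itv/= => /andP[vc _].
  by apply: derivable_powR; rewrite in_itv/= andbT (lt_le_trans v0).
have [c] := MVT vu df cf; rewrite in_itv/= => /andP[vc cu] uvE.
rewrite -lerBlDl uvE ler_wpM2r ?subr_ge0 ?(ltW vu)// ler_wpM2l ?(ltW p0)//.
by apply: le_pow; [rewrite ltW// (lt_trans v0)|rewrite ltW// (lt_le_trans cu)].
Qed.

End power_lipschitz.

(** * The shift inequality transferred to harmonic functions *)

Section walk_inequality.
Context {R : realType} {X : normedModType R}.
Variables (K : nat) (n : 'I_K -> nat) (a : 'I_K -> R) (x_ : 'I_K -> X).
Variables (m : nat) (h b p Cp A : R).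
Hypotheses (h0 : 0 <= h) (b0 : 0 <= b) (b1 : b * h <= 2^-1) (nb : forall k, (n k)%:R <= b).
Hypotheses (p1 : 1 <= p) (Cp0 : 0 <= Cp) (xA : \sum_k `|x_ k| <= A).
Let step := walk_step n a m h.
Hypothesis shift_le : forall N s,
  iter N (mean step) (fun s' => `|wmv x_ s' - wmv x_ s| `^ p) s <=
  Cp * iter N (mean step) (fun s' => `|wmu x_ s'| `^ p) s.

Let U z := vsum x_ (fun k => cosp n a h k z).
Let V z := vsum x_ (fun k => sinp n a h k z).
Let d : R := 2 * (b * h) ^+ 2.
Let e : R := 2 * (b * h) ^+ 3.

Lemma norm_vsum_le (c : 'I_K -> R) (g : R) : 0 <= g ->
  (forall k, `|c k| <= g) -> `|vsum x_ c| <= A * g.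
Proof.
move=> g0 cg; rewrite (le_trans (ler_norm_sum _ _ _))//.
apply: (@le_trans _ _ (\sum_k `|x_ k| * g)).
  by apply: ler_sum => k _; rewrite normrZ mulrC ler_wpM2l.
by rewrite -mulr_suml ler_wpM2r.
Qed.

(** Each martingale is exchanged for its wave. [A * (2 + N%:R * d)] bounds all values that occur, so
    it fixes the Lipschitz constant of the [p]-th power; smallness comes only from the mean errors,
    at most [l]. The last term is the price of replacing [V - V z] by [V], as [V z] decays
    exponentially in the height of [z]. *)
Lemma walk_inequality N (l : R) z : 0 < l ->
  (1 + (e + d ^+ 2)) ^+ N - 1 <= l ^+ 2 ->
  iter N (mean (pos_step m h)) (fun z => `|V z| `^ p) z <=
  Cp * iter N (mean (pos_step m h)) (fun z => `|U z| `^ p) z +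
  p * (A * (2 + N%:R * d)) `^ (p - 1) * (A * l * (1 + Cp)) +
  p * (A * 2) `^ (p - 1) * (A * expR (- (z.2%:R * h))).
Proof.
move=> l0 Nl; set B := A * (2 + _).
have A0 : 0 <= A by rewrite (le_trans _ xA)// sumr_ge0.
have bh0 : 0 <= b * h by rewrite mulr_ge0.
have d0 : 0 <= d by rewrite mulr_ge0// sqr_ge0.
have y0 z' : 0 <= (z' : R * nat).2%:R * h by rewrite mulr_ge0.
have cos1 k z' : `|cosp n a h k z'| <= 1 by exact: norm_cos_wave.
have sin1 k z' : `|sinp n a h k z'| <= 1 by exact: norm_sin_wave1.
pose c k := sinp n a h k z.
(* The first martingale starts at the value of the wave; the second may start at 0, since the shift
   inequality involves only its change [wmv x_ s - wmv x_ s0]. *)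
pose s0 : state K := (z, fun k => cosp n a h k z, fun=> 0).
pose Ec k s := err_cos n a h k s; pose Es k s := err_sin n a h k (c k) s.
have Ec0 k : Ec k s0 = 0 by rewrite /Ec /err_cos/= subrr.
have Es0 k : Es k s0 = 0 by rewrite /Es /err_sin/= addr0 subrr.
have Ec_inc k s D r : `|Ec k (step s D r) - Ec k s| <= d.
  exact: (wave_increments_le h0 b1 nb (err_cos_increments _ _ _ _ _ _)).
have Es_inc k s D r : `|Es k (step s D r) - Es k s| <= d.
  by apply: (wave_increments_le h0 b1 nb (err_sin_increments _ _ _ _ _ _ _));
    rewrite ?normrN.
have Ec_l k : iter N (mean step) (fun s => `|Ec k s|) s0 <= l.
  apply: (@iter_mean_norm _ _ _ _ d e) => //.
  - by rewrite mulr_ge0// exprn_ge0.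
  - move=> s; exact: (wave_drift_le h0 b1 nb (err_cos_increments _ _ _ _ _ _)).
have Es_l k : iter N (mean step) (fun s => `|Es k s|) s0 <= l.
  apply: (@iter_mean_norm _ _ _ _ d e) => //.
  - by rewrite mulr_ge0// exprn_ge0.
  - move=> s; exact: (wave_drift_le h0 b1 nb (err_sin_increments _ _ _ _ _ _ _)).
(* The crude pathwise bound: errors grow by at most [d] per step. *)
pose P (j : nat) (s : state K) := forall k, `|Ec k s| <= j%:R * d /\
  `|Es k s| <= j%:R * d.
have Pstep j s D r : P j s -> P j.+1 (step s D r).
  move=> Pj k; have [Pc Ps] := Pj k; split.
    rewrite -[Ec _ _](subrK (Ec k s)) (le_trans (ler_normD _ _))//.
    by rewrite -natr1 mulrDl mul1r addrC lerD.
  rewrite -[Es _ _](subrK (Es k s)) (le_trans (ler_normD _ _))//.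
  by rewrite -natr1 mulrDl mul1r addrC lerD.
have P0 : P 0%N s0 by move=> k; rewrite Ec0 Es0 normr0 mul0r.
have VA z' : `|V z'| <= A by rewrite -[A]mulr1 norm_vsum_le.
have UA z' : `|U z'| <= A by rewrite -[A]mulr1 norm_vsum_le.
have NdA : 0 <= A * (N%:R * d) by rewrite !mulr_ge0.
have BE : B = A + A + A * (N%:R * d) by rewrite /B mulrDr mulr_natr mulr2n.
have wsum (E : 'I_K -> state K -> R) :
    (forall k, iter N (mean step) (fun s => `|E k s|) s0 <= l) ->
    iter N (mean step) (fun s => \sum_k `|x_ k| * `|E k s|) s0 <= A * l.
  move=> El; rewrite iter_mean_sum.
  apply: (@le_trans _ _ (\sum_k `|x_ k| * l)).
    by apply: ler_sum => k _; rewrite iter_meanZ ler_wpM2l.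
  by rewrite -mulr_suml ler_wpM2r// ltW.
have pB0 : 0 <= p * B `^ (p - 1) by rewrite mulr_ge0 ?powR_ge0// (le_trans _ p1).
have s00 : wmv x_ s0 = 0.
  by rewrite /wmv /vsum big1// => k _; rewrite scale0r.
pose y := expR (- (z.2%:R * h)).
have Vz : `|V z| <= A * y.
  by apply: norm_vsum_le; [exact: expR_ge0|move=> k; exact: norm_sin_wave].
have stepV : iter N (mean step) (fun s => `|V s.1.1| `^ p) s0 <=
    iter N (mean step) (fun s => `|wmv x_ s - wmv x_ s0| `^ p) s0 +
    p * B `^ (p - 1) * (A * l) + p * (A * 2) `^ (p - 1) * (A * y).
  apply: (@le_trans _ _ (iter N (mean step) (fun s =>
      (`|wmv x_ s - wmv x_ s0| `^ p + (p * B `^ (p - 1) *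
        (\sum_k `|x_ k| * `|Es k s|))) + p * (A * 2) `^ (p - 1) * (A * y)) s0));
    last first.
    rewrite iter_meanD iter_mean_cst lerD2r iter_meanD lerD2l iter_meanZ.
    by rewrite ler_wpM2l// wsum.
  apply: (@iter_mean_le_inv _ _ _ P N 0) => // s PN.
  have VzA : `|V s.1.1 - V z| <= A * 2.
    by rewrite mulr_natr mulr2n (le_trans (ler_normB _ _))// lerD.
  apply: (@le_trans _ _ (`|V s.1.1 - V z| `^ p +
      p * (A * 2) `^ (p - 1) * (A * y))).
    apply: (le_trans (@powR_lipschitz _ p (A * 2) `|V s.1.1| `|V s.1.1 - V z|
      p1 _ _)) => //.
      by rewrite normr_ge0/= (le_trans (VA _))// ler_peMr// ler1n.
    rewrite lerD2l ler_wpM2l//; first by rewrite mulr_ge0 ?powR_ge0// (le_trans _ p1).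
    by rewrite (le_trans (ler_dist_dist _ _))// opprB addrC subrK.
  rewrite lerD2r.
  apply: (le_trans (@powR_lipschitz _ p B `|V s.1.1 - V z|
    `|wmv x_ s - wmv x_ s0| p1 _ _)) => //.
    by rewrite normr_ge0/= (le_trans VzA)// BE mulr_natr mulr2n lerDl.
  rewrite lerD2l ler_wpM2l// s00 subr0 -[`|wmv _ _|]normrN.
  rewrite (le_trans (ler_dist_dist _ _))// opprK.
  have -> : V s.1.1 - V z + wmv x_ s = vsum x_ (fun k => Es k s).
    rewrite /V /wmv /vsum -sumrB -big_split/=; apply: eq_bigr => k _.
    by rewrite -scalerBl -scalerDl /Es /err_sin /c; congr (_ *: _); ring.
  rewrite (le_trans (ler_norm_sum _ _ _))//.
  by apply: ler_sum => k _; rewrite normrZ mulrC.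
have stepU : iter N (mean step) (fun s => `|wmu x_ s| `^ p) s0 <=
    iter N (mean step) (fun s => `|U s.1.1| `^ p) s0 +
    p * B `^ (p - 1) * (A * l).
  apply: (@le_trans _ _ (iter N (mean step) (fun s =>
      `|U s.1.1| `^ p + (p * B `^ (p - 1) *
        \sum_k `|x_ k| * `|Ec k s|)) s0)); last first.
    rewrite iter_meanD lerD2l iter_meanZ ler_wpM2l//.
    by rewrite wsum.
  apply: (@iter_mean_le_inv _ _ _ P N 0) => // s PN.
  have UE : wmu x_ s = U s.1.1 - vsum x_ (fun k => Ec k s).
    rewrite /U /wmu /vsum -sumrB; apply: eq_bigr => k _.
    by rewrite -scalerBl /Ec /err_cos; congr (_ *: _); ring.
  apply: (le_trans (@powR_lipschitz _ p B `|wmu x_ s| `|U s.1.1|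
    p1 _ _)) => //.
    rewrite normr_ge0/= UE (le_trans (ler_normB _ _))// BE lerD//.
      by rewrite (le_trans (UA _))// lerDl.
    by apply: norm_vsum_le => [|k]; [rewrite mulr_ge0|have [] := PN k].
  rewrite lerD2l ler_wpM2l// (le_trans (ler_dist_dist _ _))// UE.
  rewrite addrAC subrr add0r normrN (le_trans (ler_norm_sum _ _ _))//.
  by apply: ler_sum => k _; rewrite normrZ mulrC.
have posE (phi : R * nat -> R) : iter N (mean (pos_step m h)) phi z =
    iter N (mean step) (fun s => phi s.1.1) s0.
  by apply/esym; exact: (@iter_mean_map _ _ step _ (pos_step m h) (fun s => s.1.1)).
rewrite !posE (le_trans stepV)//.
have := shift_le N s0; have := ler_wpM2l Cp0 stepU; rewrite mulrDr => h1 h2.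
rewrite -addrA (le_trans (lerD h2 (lexx _)))// (le_trans (lerD h1 (lexx _)))//.
by rewrite le_eqVlt; apply/orP; left; apply/eqP; rewrite /y; ring.
Qed.

End walk_inequality.

(** * Integrals of continuous functions over intervals *)

Section interval_integrals.
Context {R : realType}.
Implicit Types (f g F : R -> R) (a b c k : R).

Definition rint a b f : R := (\int[lebesgue_measure]_(x in `[a, b]) f x)%R.

Lemma integrable_itv a b f : continuous f ->
  lebesgue_measure.-integrable `[a, b] (EFin \o f).
Proof.
move=> cf; apply: continuous_compact_integrable; first exact: segment_compact.
exact: continuous_subspaceT.
Qed.

Lemma rint_EFin a b f : continuous f ->
  (\int[lebesgue_measure]_(x in `[a, b]) (f x)%:E)%E = (rint a b f)%:E.
Proof.
move=> cf; rewrite /rint /Rintegral fineK//.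
by apply: integrable_fin_num; [exact: measurable_itv|exact: integrable_itv].
Qed.

Lemma rintD a b f g : continuous f -> continuous g ->
  rint a b (fun x => f x + g x) = rint a b f + rint a b g.
Proof. by move=> cf cg; apply: RintegralD => //; exact: integrable_itv. Qed.

Lemma rintZ a b k f : continuous f ->
  rint a b (fun x => k * f x) = k * rint a b f.
Proof. by move=> cf; apply: RintegralZl => //; exact: integrable_itv. Qed.

Lemma rint_cst a b c : a <= b -> rint a b (fun=> c) = c * (b - a).
Proof.
move=> ab; rewrite /rint Rintegral_cst//; congr (_ * _).
have mE : lebesgue_measure (`[a, b]%classic : set R) = (b - a)%:E.
  rewrite lebesgue_measure_itv/= lte_fin; move: ab.
  by rewrite le_eqVlt => /predU1P[->|->//]; rewrite ltxx subrr.
exact: (congr1 fine mE).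
Qed.

Lemma le_rint a b f g : continuous f -> continuous g ->
  (forall x, a <= x <= b -> f x <= g x) -> rint a b f <= rint a b g.
Proof.
move=> cf cg fg; apply: le_Rintegral => //; exact: integrable_itv.
Qed.

Lemma rint_ge0 a b f : (forall x, a <= x <= b -> 0 <= f x) -> 0 <= rint a b f.
Proof.
by move=> f0; apply: Rintegral_ge0 => x /=; rewrite in_itv/=; exact: f0.
Qed.

(** Beginning the integral at a point [c] further left makes the derivative two-sided at all points
    used later, including the ends of the interval of integration. *)
Lemma primitive_exists c f : continuous f ->
  exists F, forall x, c < x -> is_derive x 1 F (f x).
Proof.
move=> cf; exists (fun x => rint c x f) => x cx.
have x1 : x < x + 1 by rewrite ltrDl.
have [dF FE] := continuous_FTC1_closed x1 (integrable_itv c (x + 1) cf) cx (cf x).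
exact: (DeriveDef dF (etrans (esym (derive1E _ _)) FE)).
Qed.

Lemma rint_FTC a b f F : a <= b -> continuous f ->
  (forall x, a <= x <= b -> is_derive x 1 F (f x)) -> rint a b f = F b - F a.
Proof.
rewrite le_eqVlt => /predU1P[-> _ _|ab cf dF].
  by rewrite subrr /rint set_itv1 Rintegral_set1.
have cF x : a <= x <= b -> {for x, continuous F}.
  move=> xab; apply: differentiable_continuous; apply/derivable1_diffP.
  by have [] := dF _ xab.
apply: EFin_inj; rewrite -rint_EFin// EFinB; apply: continuous_FTC2 => //.
- exact: continuous_subspaceT.
- split.
  + by move=> x; rewrite in_itv/= => /andP[ax xb];
      have [] : is_derive x 1 F (f x) by apply: dF; rewrite !ltW.
  + by apply: cvg_at_right_filter; apply: cF; rewrite lexx ltW.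
  + by apply: cvg_at_left_filter; apply: cF; rewrite lexx ltW.
- move=> x; rewrite in_itv/= => /andP[ax xb]; rewrite derive1E.
  by have [] : is_derive x 1 F (f x) by apply: dF; rewrite !ltW.
Qed.

Lemma is_derive_affine k c F x d : is_derive (k * x + c) 1 F d ->
  is_derive x 1 (fun x => F (k * x + c)) (k * d).
Proof.
move=> dF; have dl : is_derive x 1 (fun x => k * x + c) k.
  have := @is_deriveD _ _ _ (k \*: id) (cst c) x 1 _ _
    (is_deriveZ k (is_derive_id x 1)) (is_derive_cst c x 1).
  by rewrite addr0 [_ *: _]mulr1.
by rewrite mulrC; apply: is_derive1_comp.
Qed.

Lemma continuous_affine k c f : continuous f ->
  continuous (fun x => f (k * x + c)).
Proof.
move=> cf x; apply: continuous_comp; last exact: cf.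
by apply: cvgD; [apply: cvgM; [exact: cvg_cst|exact: cvg_id]|exact: cvg_cst].
Qed.

Lemma rint_affine_gt0 a b k c f : a <= b -> 0 < k -> continuous f ->
  k * rint a b (fun x => f (k * x + c)) = rint (k * a + c) (k * b + c) f.
Proof.
move=> ab k0 cf; have [F dF] := primitive_exists (k * a + c - 1) cf.
rewrite -rintZ; last exact: continuous_affine.
have ckf : continuous (fun x => k * f (k * x + c)).
  by move=> x; apply: cvgM; [exact: cvg_cst|exact: continuous_affine].
have d1 x : a <= x <= b ->
    is_derive x 1 (fun x => F (k * x + c)) (k * f (k * x + c)).
  move=> /andP[ax xb]; apply: is_derive_affine; apply: dF.
  by rewrite ltrBlDr ltr_pwDr// lerD2r ler_pM2l.
have d2 x : k * a + c <= x <= k * b + c -> is_derive x 1 F (f x).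
  by move=> /andP[ax _]; apply: dF; rewrite ltrBlDr ltr_pwDr.
have kab : k * a + c <= k * b + c by rewrite lerD2r ler_pM2l.
by rewrite (rint_FTC ab ckf d1) (rint_FTC kab cf d2).
Qed.

Lemma rint_shift a b c f : a <= b -> continuous f ->
  rint a b (fun x => f (x + c)) = rint (a + c) (b + c) f.
Proof.
move=> ab cf; have := @rint_affine_gt0 _ _ 1 c _ ab ltr01 cf.
by rewrite !mul1r; under eq_fun do rewrite mul1r.
Qed.

Lemma rint_opp a b f : a <= b -> continuous f ->
  rint a b (fun x => f (- x)) = rint (- b) (- a) f.
Proof.
move=> ab cf; have [F dF] := primitive_exists (- b - 1) cf.
have cN : continuous (fun x => f (- x)).
  by move=> x; apply: continuous_comp; [exact: opp_continuous|exact: cf].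
have d1 x : a <= x <= b -> is_derive x 1 (fun x => - F (-1 * x + 0)) (f (- x)).
  move=> /andP[ax xb].
  rewrite (_ : f (- x) = - (-1 * f (- x))); last by rewrite mulN1r opprK.
  apply: is_deriveN; apply: is_derive_affine; rewrite mulN1r addr0; apply: dF.
  by rewrite ltrBlDr ltr_pwDr// lerN2.
have d2 x : - b <= x <= - a -> is_derive x 1 F (f x).
  by move=> /andP[ax _]; apply: dF; rewrite ltrBlDr ltr_pwDr.
have Nab : - b <= - a by rewrite lerN2.
rewrite (rint_FTC ab cN d1) (rint_FTC Nab cf d2).
by rewrite !mulN1r !addr0 opprK addrC.
Qed.

Lemma rint_split a b c f : a <= b -> b <= c -> continuous f ->
  rint a c f = rint a b f + rint b c f.
Proof.
move=> ab bc cf; have [F dF] := primitive_exists (a - 1) cf.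
have a1 x : a <= x -> is_derive x 1 F (f x).
  by move=> ax; apply: dF; rewrite ltrBlDr ltr_pwDr.
have d1 u v x : a <= u -> u <= x <= v -> is_derive x 1 F (f x).
  by move=> au /andP[ux _]; apply: a1; exact: le_trans ux.
rewrite (rint_FTC (le_trans ab bc) cf (fun x => @d1 a c x (lexx a))).
rewrite (rint_FTC ab cf (fun x => @d1 a b x (lexx a))).
by rewrite (rint_FTC bc cf (fun x => @d1 b c x ab)); ring.
Qed.

Lemma rint_periodic (T : R) a b f : continuous f -> 0 <= T ->
  (forall x, f (x + T) = f x) -> rint a (a + T) f = rint b (b + T) f.
Proof.
move=> cf T0 fT; wlog ab : a b / a <= b.
  by move=> hw; have [/hw//|/ltW/hw ->] := leP a b.
rewrite [LHS](_ : _ = rint a (b + T) f - rint (a + T) (b + T) f).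
  rewrite (@rint_split a b (b + T))//; last by rewrite lerDl.
  by rewrite -rint_shift//; under eq_fun do rewrite fT; ring.
rewrite (@rint_split a (a + T) (b + T)) ?lerDl ?lerD2r//; by ring.
Qed.

Lemma rint_pi_shift c f : continuous f -> (forall x, f (x + pi *+ 2) = f x) ->
  rint (- pi) pi (fun x => f (x + c)) = rint (- pi) pi f.
Proof.
move=> cf fT; have pi0 := @pi_ge0 R.
have piE : - pi + pi *+ 2 = pi :> R by rewrite mulr2n addrA addNr add0r.
rewrite rint_shift//; last by rewrite (le_trans _ pi0)// oppr_le0.
have := @rint_periodic (pi *+ 2) (- pi + c) (- pi) f cf _ fT.
by rewrite addrAC piE; apply; rewrite mulrn_wge0.
Qed.

End interval_integrals.

(** * Exit of the height process *)

Section exit_time.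
Context {R : realType}.
Variable m : nat.
Hypothesis m0 : (0 < m)%N.

Definition idx_step (i : nat) (d r : bool) : nat :=
  if (0 < i < m)%N then if d then (if r then i.+1 else i.-1) else i else i.

Let M := mean idx_step : (nat -> R) -> nat -> R.
Let act (i : nat) : R := (0 < i < m)%N%:R.
Let w (i : nat) : R := i%:R * (m%:R - i%:R).

Lemma idx_step_le (k i : nat) d r : (i <= m)%N -> (idx_step i d r <= m)%N.
Proof.
move=> im; rewrite /idx_step; case: ifP => // /andP[_ im'].
by case: d => //; case: r => //; rewrite (leq_trans (leq_pred _)).
Qed.

Lemma mean_idx (phi : nat -> R) i : (0 < i < m)%N ->
  M phi i = phi i / 2 + (phi i.+1 + phi i.-1) / 4.
Proof. by move=> im; rewrite /M /mean /idx_step im; field. Qed.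

Lemma mean_idx_out (phi : nat -> R) i : (0 < i < m)%N = false -> M phi i = phi i.
Proof. by move=> im; rewrite /M /mean /idx_step im; field. Qed.

Lemma mean_linear (c : R) i : M (fun i => i%:R * c) i = i%:R * c.
Proof.
case im : (0 < i < m)%N; last by rewrite mean_idx_out.
have [i0 _] := andP im; rewrite mean_idx// -natr1.
rewrite -[in LHS](prednK i0) -!natr1; rewrite -[in RHS](prednK i0) -natr1.
by rewrite prednK//; field.
Qed.

(** An active step moves the height with probability 1/2, so [w] loses 1/2 on average; hence
    [2 * w i] bounds the expected number of active steps. *)
Lemma mean_quadratic i : M w i = w i - act i / 2.
Proof.
case im : (0 < i < m)%N; last first.
  by rewrite mean_idx_out// /act im mul0r subr0.
have [i0 _] := andP im; rewrite mean_idx// /act im /w -[i.+1%:R]natr1 mulr1n.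
have -> : i.-1%:R = i%:R - 1 :> R by rewrite -[in RHS](prednK i0) -natr1 addrK.
by field.
Qed.

Lemma mean_active i : M act i <= act i.
Proof.
case im : (0 < i < m)%N; last by rewrite mean_idx_out.
rewrite mean_idx// {1 4}/act im mulr1n.
have act1 j : act j <= 1 by rewrite /act; case: (_ && _).
by have := act1 i.+1; have := act1 i.-1; lra.
Qed.

(** A walk that is not at 0 is at [m] or still active. The linear function [i / m] is preserved by
    [M] and bounds the first probability. The probability of being active decreases with time and
    its sum over time is at most [2 * w i], so after [N] steps it is at most [2 * w i / N]. *)
Lemma exit_le N i : (i <= m)%N -> (0 < N)%N ->
  iter N M (fun i => (i != 0)%:R) i <=
  i%:R / m%:R + 2 * (i%:R * (m%:R - i%:R)) / N%:R.
Proof.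
move=> im N0.
have lin k j : iter k M (fun i => i%:R * m%:R^-1) j = j%:R / m%:R.
  by elim: k j => // k IHk j; rewrite iterSr -[RHS]IHk; congr (iter k M _ j);
    apply/funext => j'; exact: mean_linear.
have actk k j : iter k.+1 M act j <= iter k M act j.
  by rewrite iterSr; apply: iter_mean_le => j'; exact: mean_active.
have act_mono k l j : iter (k + l) M act j <= iter k M act j.
  by elim: l => [|l IHl]; rewrite ?addn0// addnS (le_trans (actk _ _)).
have sum_act k j : iter k M w j = w j - (\sum_(l < k) iter l M act j) / 2.
  elim: k j => [|k IHk] j; first by rewrite big_ord0 mul0r subr0.
  rewrite iterSr big_ord_recr/=.
  rewrite (_ : M w = fun i => w i + (- 2^-1) * act i); last first.
    by apply/funext => j'; rewrite mean_quadratic; ring.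
  by rewrite iter_meanD iter_meanZ IHk; ring.
have w0 : 0 <= iter N M w i.
  have -> : 0 = iter N M (fun=> 0) i :> R by rewrite iter_mean_cst.
  apply: (@iter_mean_le_inv _ _ _ (fun _ i => (i <= m)%N) N 0) => //.
  - by move=> _ j d r; exact: idx_step_le.
  - by move=> j jm; rewrite mulr_ge0// subr_ge0 ler_nat.
have actN : iter N M act i * N%:R <= 2 * w i.
  move: w0; rewrite sum_act => w0.
  suff : iter N M act i * N%:R <= \sum_(l < N) iter l M act i by lra.
  rewrite mulr_natr -[X in _ *+ X](card_ord N) -sumr_const; apply: ler_sum => l _.
  by rewrite -{1}(subnKC (ltnW (ltn_ord l))) act_mono.
apply: (@le_trans _ _ (iter N M (fun i => i%:R * m%:R^-1 + act i) i)).
  apply: (@iter_mean_le_inv _ _ _ (fun _ i => (i <= m)%N) N 0) => //.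
  - by move=> _ j d r; exact: idx_step_le.
  - move=> j jm; have [->|j0] := eqVneq j 0%N; first by rewrite mul0r add0r.
    rewrite /act lt0n j0/=; move: jm; rewrite leq_eqVlt => /predU1P[->|->].
      by rewrite divff ?ltnn ?addr0// pnatr_eq0 -lt0n.
    by rewrite lerDr divr_ge0.
by rewrite iter_meanD lin lerD2l ler_pdivlMr ?ltr0n.
Qed.

End exit_time.

(** * Averaging over the starting abscissa *)

Section average.
Context {R : realType}.
Variables (m : nat) (h : R).

Definition nice (phi : R * nat -> R) := forall i,
  continuous (fun x => phi (x, i)) /\
  forall x, phi (x + pi *+ 2, i) = phi (x, i).

Lemma nice_mean phi : nice phi -> nice (mean (pos_step m h) phi).
Proof.
move=> nphi i; split => [x|x].
  rewrite /mean /pos_step/=; case: (0 < i < m)%N.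
  - have sh (c : R) : (fun x => phi (x + c, i)) @ x --> phi (x + c, i).
      apply: (@continuous_comp _ _ _ (fun x => x + c) (fun x => phi (x, i))).
        by apply: cvgD; [exact: cvg_id|exact: cvg_cst].
      exact: (nphi i).1.
    apply: cvgM; last exact: cvg_cst.
    apply: cvgD; [apply: cvgD; [apply: cvgD|]|].
    + exact: sh.
    + exact: sh.
    + exact: (nphi _).1.
    + exact: (nphi _).1.
  - apply: cvgM; last exact: cvg_cst.
    by apply: cvgD; [apply: cvgD; [apply: cvgD|]|]; exact: (nphi _).1.
rewrite /mean /pos_step/=; case: ifP => _; last by rewrite !(nphi _).2.
by rewrite ![x + pi *+ 2 + _ * _]addrAC !(nphi _).2.
Qed.

(** A horizontal move translates a periodic function and preserves its integral over a period, so
    only the height process remains. This is the uniform distribution of the exit point. *)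
Lemma rint_mean phi i : nice phi ->
  rint (- pi) pi (fun x => mean (pos_step m h) phi (x, i)) =
  mean (idx_step m) (fun i => rint (- pi) pi (fun x => phi (x, i))) i.
Proof.
move=> nphi; have cphi j : continuous (fun x => phi (x, j)) by exact: (nphi j).1.
have csh c : continuous (fun x => phi (x + c, i)).
  have := @continuous_affine _ 1 c _ (cphi i).
  by under eq_fun do rewrite mul1r.
rewrite /mean /pos_step /idx_step/=; case: ifP => _.
  under eq_fun do rewrite mulrC.
  rewrite rintZ; last first.
    move=> x; apply: cvgD; [apply: cvgD; [apply: cvgD|]|];
    by [exact: csh|exact: cphi].
  rewrite mulrC; congr (_ * _).
  rewrite !rintD//.
  - rewrite !(rint_pi_shift _ (cphi i))//; exact: (nphi i).2.
  - by move=> x; apply: cvgD; exact: csh.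
  - by move=> x; apply: cvgD; [apply: cvgD; exact: csh|exact: cphi].
under eq_fun do rewrite mulrC.
rewrite rintZ; last first.
  by move=> x; apply: cvgD; [apply: cvgD; [apply: cvgD|]|]; exact: cphi.
rewrite mulrC; congr (_ * _); rewrite !rintD//.
- by move=> x; apply: cvgD; exact: cphi.
- by move=> x; apply: cvgD; [apply: cvgD; exact: cphi|exact: cphi].
Qed.

Lemma nice_iter N phi : nice phi -> nice (iter N (mean (pos_step m h)) phi).
Proof. by move=> nphi; elim: N => //= N; exact: nice_mean. Qed.

Lemma rint_iter_mean N phi i : nice phi ->
  rint (- pi) pi (fun x => iter N (mean (pos_step m h)) phi (x, i)) =
  iter N (mean (idx_step m)) (fun i => rint (- pi) pi (fun x => phi (x, i))) i.
Proof.
move=> nphi; elim: N i => // N IHN i /=.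
rewrite rint_mean; last exact: nice_iter.
by congr (mean _ _ i); apply/funext => j; exact: IHN.
Qed.

Lemma rint_iter_mean_le N phiU phiV i (Cp err : R) : nice phiU -> nice phiV ->
  (forall x, iter N (mean (pos_step m h)) phiV (x, i) <=
    Cp * iter N (mean (pos_step m h)) phiU (x, i) + err) ->
  iter N (mean (idx_step m)) (fun i => rint (- pi) pi (fun x => phiV (x, i))) i
  <= Cp * iter N (mean (idx_step m))
    (fun i => rint (- pi) pi (fun x => phiU (x, i))) i + pi *+ 2 * err.
Proof.
move=> niceU niceV path_le; rewrite -!rint_iter_mean//.
have cNU := (nice_iter N niceU i).1; have cNV := (nice_iter N niceV i).1.
have cZ : continuous (fun x => Cp * iter N (mean (pos_step m h)) phiU (x, i)).
  by move=> x; apply: cvgM; [exact: cvg_cst|exact: cNU].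
have cst_cont (c : R) : continuous (fun _ : R => c) by move=> x; exact: cvg_cst.
have pipi : - pi <= pi :> R.
  by rewrite (le_trans _ (@pi_ge0 R))// oppr_le0 pi_ge0.
rewrite -rintZ// mulrC [pi *+ 2](_ : _ = pi - - pi); last first.
  by rewrite opprK mulr2n.
rewrite mulrC mulrC -rint_cst// -rintD//; apply: le_rint => //.
by move=> x; apply: cvgD; [exact: cZ|exact: cvg_cst].
Qed.

End average.

(** The inequality that the shift supplies, with the [p]-th power of its operator norm as [Cp]; the
    estimates of the Hilbert transform rely on this form alone. *)
Definition walk_bound (R : realType) (X : normedModType R) (p Cp : R) : Prop :=
  forall (S : Type) (step : S -> bool -> bool -> S) (al be mu mv : S -> X),
  (forall s d r,
    mu (step s d r) = mu s + bsign r *: (if d then be s else al s)) ->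
  (forall s d r,
    mv (step s d r) = mv s + bsign r *: (if d then - al s else be s)) ->
  forall N s, iter N (mean step) (fun s' => `|mv s' - mv s| `^ p) s <=
    Cp * iter N (mean step) (fun s' => `|mu s'| `^ p) s.

Lemma powR_onep_le (R : realType) (x : R) (N : nat) (y : R) : 0 <= x ->
  N%:R * x <= y -> y <= 2^-1 -> (1 + x) ^+ N - 1 <= 2 * y.
Proof.
move=> x0 xy y2; have y0 : 0 <= y by rewrite (le_trans _ xy)// mulr_ge0.
have e0 := expR_gt0 y.
have : (1 + x) ^+ N <= expR y.
  apply: (@le_trans _ _ (expR x ^+ N)).
    by apply: lerXn2r; rewrite ?nnegrE ?expR_ge0 ?expR_ge1Dx// addr_ge0.
  by rewrite -expRM_natl ler_expR.
have := expR_ge1Dx (- y); rewrite expRN => h1.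
have h2 : (1 - y) * expR y <= 1.
  by rewrite -(@ler_pM2r _ (expR y)) // in h1; rewrite mulVf ?gt_eqF in h1.
have h3 : 1 <= (1 - y) * (1 + 2 * y).
  rewrite -subr_ge0 (_ : _ - 1 = y * (1 - 2 * y)); last by ring.
  by rewrite mulr_ge0//; lra.
have := le_trans h2 h3; rewrite ler_pM2l; last by lra.
by lra.
Qed.

Lemma continuous_norm_powR (R : realType) (X : normedModType R) (p : R)
    (f : R -> X) : 1 <= p -> continuous f -> continuous (fun x => `|f x| `^ p).
Proof.
move=> p1 cf x; have cn : continuous (fun y => `|f y|).
  by move=> y; apply: cvg_norm; exact: cf.
apply/cvgrPdist_le => e e0.
pose B := `|f x| + 1.
have B0 : 0 < p * B `^ (p - 1) + 1 by rewrite ltr_wpDl ?mulr_ge0 ?powR_ge0// (le_trans _ p1).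
pose d := Num.min 1 (e / (p * B `^ (p - 1) + 1)).
have d0 : 0 < d by rewrite lt_min ltr01 divr_gt0.
have := cn x => /cvgrPdist_le /(_ _ d0); apply: filterS => y.
rewrite le_min => /andP[d1 de].
have yB : 0 <= `|f y| <= B.
  by rewrite normr_ge0/= /B -lerBlDl (le_trans _ d1)// distrC ler_norm.
have xB : 0 <= `|f x| <= B by rewrite normr_ge0/= lerDl.
have h1 := @powR_lipschitz _ p B `|f x| `|f y| p1 xB (normr_ge0 _).
have h2 := @powR_lipschitz _ p B `|f y| `|f x| p1 yB (normr_ge0 _).
have h3 : p * B `^ (p - 1) * `| `|f x| - `|f y| | <= e.
  apply: (@le_trans _ _ ((p * B `^ (p - 1) + 1) * `| `|f x| - `|f y| |)).
    by rewrite ler_wpM2r// lerDl.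
  by rewrite mulrC -ler_pdivlMr.
rewrite distrC in h2.
by rewrite ler_norml; apply/andP; split; lra.
Qed.

(** * Passage to the boundary values *)

Section torus_waves.
Context {R : realType} {X : normedModType R}.
Variables (p Cp : R).
Hypotheses (p1 : 1 <= p) (Cp0 : 0 <= Cp) (WB : walk_bound X p Cp).
Variables (K : nat) (n : 'I_K -> nat) (a : 'I_K -> R) (x_ : 'I_K -> X).

Let U y x : X := \sum_k cos_wave (n k) (a k) x y *: x_ k.
Let V y x : X := \sum_k sin_wave (n k) (a k) x y *: x_ k.
Let IU y := rint (- pi) pi (fun x => `|U y x| `^ p).
Let IV y := rint (- pi) pi (fun x => `|V y x| `^ p).

Let A : R := \sum_k `|x_ k|.
Let b : R := 1 + \sum_k (n k)%:R.

Lemma continuous_vsum (c : 'I_K -> R -> R) : (forall k, continuous (c k)) ->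
  continuous (fun x => \sum_k c k x *: x_ k).
Proof.
move=> cc; apply: (@continuous_big _ _ +%R 0 xpredT add_continuous) => k _ x.
by apply: cvgZ; [exact: cc|exact: cvg_cst].
Qed.

Let cU y : continuous (fun x => `|U y x| `^ p).
Proof.
apply: continuous_norm_powR => //; apply: continuous_vsum => k.
exact: continuous_cos_wave.
Qed.

Let cV y : continuous (fun x => `|V y x| `^ p).
Proof.
apply: continuous_norm_powR => //; apply: continuous_vsum => k.
exact: continuous_sin_wave.
Qed.

Let A0 : 0 <= A. Proof. by rewrite sumr_ge0. Qed.

Let b_ge1 : 1 <= b. Proof. by rewrite lerDl sumr_ge0. Qed.

Let UA y x : 0 <= y -> `|U y x| <= A.
Proof.
move=> y0; rewrite -[A]mulr1; apply: (@norm_vsum_le _ _ _ x_ A) => // k.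
exact: norm_cos_wave.
Qed.

Let pipi : - pi <= pi :> R.
Proof. by rewrite (le_trans _ (@pi_ge0 R))// oppr_le0 pi_ge0. Qed.

Let IU_le y : 0 <= y -> IU y <= A `^ p * (pi *+ 2).
Proof.
move=> y0; have -> : pi *+ 2 = pi - - pi :> R by rewrite opprK mulr2n.
rewrite -rint_cst//; apply: le_rint; [exact: cU|by move=> x; exact: cvg_cst|].
move=> x _; rewrite ge0_ler_powR ?nnegrE// ?UA//; exact: le_trans p1.
Qed.

Let IV_le y : 0 <= y -> IV y <= A `^ p * (pi *+ 2).
Proof.
move=> y0; have -> : pi *+ 2 = pi - - pi :> R by rewrite opprK mulr2n.
rewrite -rint_cst//; apply: le_rint; [exact: cV|by move=> x; exact: cvg_cst|].
move=> x _; rewrite ge0_ler_powR ?nnegrE//; first exact: le_trans p1.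
rewrite -[A]mulr1; apply: (@norm_vsum_le _ _ _ x_ A) => // k.
exact: norm_sin_wave1.
Qed.

Let IU_ge0 y : 0 <= IU y.
Proof. by apply: rint_ge0 => x _; exact: powR_ge0. Qed.

Let IV_ge0 y : 0 <= IV y.
Proof. by apply: rint_ge0 => x _; exact: powR_ge0. Qed.

Let q : R := A `^ p * (pi *+ 2).

Let q_ge0 : 0 <= q. Proof. by rewrite mulr_ge0 ?powR_ge0// mulrn_wge0 ?pi_ge0. Qed.

(* The walk starts at height [s], is stopped at heights [0] and [s ^ 2], and
   makes [s ^ 5 * j ^ 2] steps of size [j ^-1]. *)
Lemma torus_walk (s j : nat) (l : R) : (0 < s)%N -> (0 < j)%N -> 0 < l ->
  b / j%:R <= 2^-1 ->
  (1 + (2 * (b / j%:R) ^+ 3 + (2 * (b / j%:R) ^+ 2) ^+ 2)) ^+ (s ^ 5 * j ^ 2)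
    - 1 <= l ^+ 2 ->
  IV 0 <= Cp * IU 0 + (1 + Cp) * q * (3 / s%:R) + (pi *+ 2) *
    (p * (A * (2 + 2 * (s ^ 5)%:R * b ^+ 2)) `^ (p - 1) * (A * l * (1 + Cp)) +
     p * (A * 2) `^ (p - 1) * (A * expR (- s%:R))).
Proof.
move=> s0 j0 l0 bj Nl; set h : R := j%:R^-1; set m := (s ^ 2 * j)%N.
set N := (s ^ 5 * j ^ 2)%N in Nl *; pose i := (s * j)%N.
have jR : 0 < j%:R :> R by rewrite ltr0n.
have sR : 0 < s%:R :> R by rewrite ltr0n.
have h0 : 0 <= h by rewrite invr_ge0 ltW.
have b0 : 0 <= b by rewrite (le_trans _ b_ge1).
have nb k : (n k)%:R <= b.
  by rewrite /b (bigD1 k)//= addrCA lerDl addr_ge0// sumr_ge0.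
have m0 : (0 < m)%N by rewrite muln_gt0 expn_gt0 s0.
have N0 : (0 < N)%N by rewrite muln_gt0 !expn_gt0 s0 j0.
have im : (i <= m)%N by rewrite leq_mul2r (leq_pexp2l s0 (isT : 1 <= 2)%N) orbT.
pose phiU z := `|vsum x_ (fun k => cosp n a h k z)| `^ p.
pose phiV z := `|vsum x_ (fun k => sinp n a h k z)| `^ p.
have phiUE x i' : phiU (x, i') = `|U (i'%:R * h) x| `^ p by [].
have phiVE x i' : phiV (x, i') = `|V (i'%:R * h) x| `^ p by [].
have niceU : nice phiU.
  move=> i'; split.
    rewrite (_ : (fun x => _) = fun x => `|U (i'%:R * h) x| `^ p); first exact: cU.
    by apply/funext => x; exact: phiUE.
  move=> x; rewrite !phiUE; congr (`|_| `^ p); apply: eq_bigr => k _.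
  by rewrite cos_wave_periodic.
have niceV : nice phiV.
  move=> i'; split.
    rewrite (_ : (fun x => _) = fun x => `|V (i'%:R * h) x| `^ p); first exact: cV.
    by apply/funext => x; exact: phiVE.
  move=> x; rewrite !phiVE; congr (`|_| `^ p); apply: eq_bigr => k _.
  by rewrite sin_wave_periodic.
have path_le x := @walk_inequality R X K n a x_ m h b p Cp A h0 b0 bj nb p1 Cp0
  (lexx _) (WB (wmu_step n a x_ m h) (wmv_step n a x_ m h)) N l (x, i) l0 Nl.
set err := (pi *+ 2) * _.
have ihE : i%:R * h = s%:R by rewrite natrM mulfK// gt_eqF.
(* The pathwise bound does not depend on [j], so the step size can be chosen after the Lipschitz
   constant is known. *)
have NdE : N%:R * (2 * (b * h) ^+ 2) = 2 * (s ^ 5)%:R * b ^+ 2.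
  by rewrite natrM natrX exprMn /h; field; rewrite gt_eqF.
pose M := mean (idx_step m) : (nat -> R) -> nat -> R.
pose JU i' := rint (- pi) pi (fun x => phiU (x, i')).
pose JV i' := rint (- pi) pi (fun x => phiV (x, i')).
have main : iter N M JV i <= Cp * iter N M JU i + err.
  apply: (@rint_iter_mean_le _ m h) => // x.
  by have := path_le x; rewrite NdE [(x, i).2%:R * h]ihE addrA.
have Q := @exit_le R m m0 N i im N0; rewrite -/M in Q.
(* The top is reached with probability at most [i / m = 1 / s]; the other term is at most
   [2 * i * m / N = 2 / s ^ 2]. *)
have Qs : iter N M (fun i => (i != 0)%:R) i <= 3 / s%:R.
  rewrite (le_trans Q)//.
  have -> : i%:R / m%:R = 1 / s%:R :> R.
    by rewrite /i /m !natrM ?natrX; field; rewrite !gt_eqF.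
  apply: (@le_trans _ _ (1 / s%:R + 2 * (i%:R * m%:R) / N%:R)).
    rewrite lerD2l ler_wpM2r ?invr_ge0// ler_wpM2l// ler_wpM2l//.
    by rewrite lerBlDr lerDl.
  have -> : i%:R * m%:R = s%:R ^+ 3 * j%:R ^+ 2 :> R.
    by rewrite /i /m !natrM ?natrX; ring.
  have -> : 2 * (s%:R ^+ 3 * j%:R ^+ 2) / N%:R = 2 / s%:R ^+ 2 :> R.
    by rewrite /N natrM !natrX; field; rewrite !gt_eqF.
  have : s%:R <= s%:R ^+ 2 :> R by rewrite expr2 ler_pMl// ler1n.
  rewrite -lef_pV2 ?posrE ?exprn_gt0// => h1.
  have -> : 3 / s%:R = 1 / s%:R + 2 / s%:R :> R by field; rewrite gt_eqF.
  by rewrite lerD2l ler_pM2l.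
have y00 : 0%:R * h = 0 by rewrite mul0r.
have JU0 : JU 0%N = IU 0.
  exact: (congr1 IU y00).
have JV0 : JV 0%N = IV 0.
  exact: (congr1 IV y00).
have yh0 i' : 0 <= i'%:R * h := mulr_ge0 (ler0n _ i') h0.
have JUq i' : JU i' <= q := IU_le (yh0 i').
have JVi i' : 0 <= JV i' := IV_ge0 (i'%:R * h).
have IVq : IV 0 <= q := IV_le (lexx 0).
have IU00 := IU_ge0 0.
clearbody JU JV; move: (IU 0) (IV 0) JU0 JV0 IVq IU00 => iu iv JU0 JV0 IVq iu0.
(* Paths that do not end at height 0 enter with the trivial bounds: 0 from below for [V], [q] from
   above for [U]. *)
have lowV : iv - q * (3 / s%:R) <= iter N M JV i.
  apply: (@le_trans _ _ (iter N M (fun i' => iv + (- q) * (i' != 0%N)%:R) i)).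
    rewrite iter_meanD iter_mean_cst iter_meanZ mulNr lerD2l lerN2.
    by rewrite ler_wpM2l.
  apply: iter_mean_le => i'; have [->|_] := eqVneq i' 0%N.
    by rewrite mulr0 addr0 JV0.
  by rewrite mulr1 (@le_trans _ _ 0)// subr_le0.
have upU : iter N M JU i <= iu + q * (3 / s%:R).
  apply: (@le_trans _ _ (iter N M (fun i' => iu + q * (i' != 0%N)%:R) i)).
    apply: iter_mean_le => i'; have [->|_] := eqVneq i' 0%N.
      by rewrite mulr0 addr0 JU0.
    by rewrite mulr1 (le_trans (JUq i'))// lerDr.
  by rewrite iter_meanD iter_mean_cst iter_meanZ lerD2l ler_wpM2l.
have := ler_wpM2l Cp0 upU; rewrite mulrDr => h1.
rewrite -lerBlDr; move: h1 (le_trans lowV main); set t := 3 / s%:R => h1 h2.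
have -> : (1 + Cp) * q * t = q * t + Cp * (q * t) by ring.
by lra.
Qed.

(** The order of choices matters. The height [s] fixes the Lipschitz constant in [B]; then the mean
    error [l] is taken below [1 / (s * B)]; then [j] is large enough to achieve it. All remaining
    errors are at most [c / s], and [s] is arbitrary. *)
Lemma torus_waves : IV 0 <= Cp * IU 0.
Proof.
have p0 : 0 < p by rewrite (lt_le_trans _ p1).
have pi2 : 0 <= pi *+ 2 :> R by rewrite mulrn_wge0 ?pi_ge0.
pose c : R := (1 + Cp) * q * 3 + 1 + (pi *+ 2) * (p * (A * 2) `^ (p - 1) * A).
have c0 : 0 <= c.
  apply: addr_ge0; last by rewrite !mulr_ge0 ?powR_ge0 ?(ltW p0).
  have : 0 <= (1 + Cp) * q by rewrite mulr_ge0// addr_ge0.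
  by lra.
have bound s : (0 < s)%N -> IV 0 <= Cp * IU 0 + c / s%:R.
  move=> s0; have sR : 0 < s%:R :> R by rewrite ltr0n.
  pose B := (pi *+ 2) *
    (p * (A * (2 + 2 * (s ^ 5)%:R * b ^+ 2)) `^ (p - 1) * (A * (1 + Cp))).
  have B0 : 0 <= B.
    by rewrite /B mulr_ge0// mulr_ge0// mulr_ge0 ?powR_ge0 ?(ltW p0)// addr_ge0.
  pose l := (s%:R * (B + 1))^-1.
  have l0 : 0 < l by rewrite invr_gt0 mulr_gt0// ltr_wpDl.
  have b0 : 0 < b by exact: lt_le_trans b_ge1.
  (* [D / j] will bound [kap] times the number [s ^ 5 * j ^ 2] of steps, because
     [kap <= 6 * (b / j) ^+ 3]. *)
  pose D := (s ^ 5)%:R * 6 * b ^+ 3.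
  have D0 : 0 <= D by rewrite !mulr_ge0 ?exprn_ge0// ltW.
  (* [powR_onep_le] requires a bound of at most 1/2 and returns its double, which must stay below
     [l ^+ 2]. *)
  pose l1 := Num.min (2^-1) (l ^+ 2 / 2).
  have l10 : 0 < l1 by rewrite lt_min invr_gt0 ltr0n divr_gt0 ?exprn_gt0.
  pose j := (Num.truncn (2 * b + D / l1)).+1.
  have jR : 2 * b + D / l1 < j%:R by rewrite truncnS_gt.
  have D1 : 0 <= D / l1 by rewrite divr_ge0// ltW.
  have j0 : 0 < j%:R :> R by rewrite ltr0n.
  have bj : b / j%:R <= 2^-1.
    by rewrite ler_pdivrMr// -ler_pdivrMl ?invr_gt0// invrK; lra.
  have bj0 : 0 <= b / j%:R by rewrite divr_ge0 ?ltW.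
  have Dj : D / j%:R <= l1.
    by rewrite ler_pdivrMr// mulrC -ler_pdivrMr//; lra.
  have := @torus_walk s j l s0 (ltn0Sn _) l0 bj.
  set kap := (2 * _ + _ : R).
  have kap0 : 0 <= kap by rewrite addr_ge0 ?sqr_ge0// mulr_ge0// exprn_ge0.
  have kapN : (s ^ 5 * j ^ 2)%:R * kap <= D / j%:R.
    apply: (@le_trans _ _ ((s ^ 5 * j ^ 2)%:R * (6 * (b / j%:R) ^+ 3))).
      rewrite ler_wpM2l// (_ : kap = 2 * (b / j%:R) ^+ 3 + 4 * (b / j%:R) ^+ 4);
        last by rewrite /kap; ring.
      have : (b / j%:R) ^+ 4 <= (b / j%:R) ^+ 3.
        by rewrite exprSr ler_piMr ?exprn_ge0//; lra.
      lra.
    rewrite le_eqVlt; apply/orP; left; apply/eqP.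
    by rewrite /D natrM !natrX; field; rewrite gt_eqF.
  have := @powR_onep_le _ kap _ _ kap0 (le_trans kapN Dj).
  rewrite /l1 ge_min lexx => /(_ isT) h1 h2.
  have /h2 : (1 + kap) ^+ (s ^ 5 * j ^ 2) - 1 <= l ^+ 2.
    rewrite (le_trans h1)//.
    have : l1 <= l ^+ 2 / 2 by rewrite ge_min lexx orbT.
    by rewrite -/l1 [2 * l1]mulrC -ler_pdivlMr.
  move/le_trans; apply; rewrite -addrA lerD2l.
  set P1 := p * _ * (A * l * _); set P2 := p * _ * (A * expR _).
  pose W := p * (A * 2) `^ (p - 1) * A.
  have e1 : pi *+ 2 * P1 <= 1 / s%:R.
    rewrite (_ : _ * _ = B * l); last by rewrite /B /P1; ring.
    rewrite /l invfM mulrCA mul1r ler_piMr ?invr_ge0 ?(ltW sR)//.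
    by rewrite ler_pdivrMr ?ltr_wpDl// mul1r lerDl.
  have e2 : pi *+ 2 * P2 <= pi *+ 2 * W / s%:R.
    rewrite -[leRHS]mulrA ler_wpM2l// /P2 /W -[leRHS]mulrA.
    rewrite ler_wpM2l ?mulr_ge0 ?powR_ge0 ?(ltW p0)// ler_wpM2l//.
    rewrite expRN lef_pV2 ?posrE ?expR_gt0//.
    by rewrite (le_trans _ (expR_ge1Dx _))// lerDr.
  rewrite (_ : c / s%:R = (1 + Cp) * q * (3 / s%:R) +
    (1 / s%:R + pi *+ 2 * W / s%:R)); last by rewrite /c /W; ring.
  by rewrite lerD2l mulrDr lerD.
apply/ler_addgt0Pr => e e0.
pose s := (Num.truncn (c / e)).+1.
have sR : c / e < s%:R by rewrite truncnS_gt.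
rewrite (le_trans (bound s _))// lerD2l ler_pdivrMr ?ltr0n// mulrC.
by rewrite -ler_pdivrMr// ltW.
Qed.

End torus_waves.

(** * The Hilbert transform on the torus *)

Section conjugate_kernel.
Context {R : realType}.
Implicit Types (n : nat) (a x s t e : R).

Lemma pi2_ge0 : 0 <= pi *+ 2 :> R. Proof. by rewrite mulrn_wge0 ?pi_ge0. Qed.

Lemma pi2E : pi *+ 2 = 2 * pi :> R. Proof. by rewrite mulr_natl. Qed.

(** The modified Dirichlet kernel [1 + 2 cos s + ... + 2 cos ((n - 1) s) + cos (n s)] for positive
    [n], which is [sin (n s) * cot (s / 2)]. *)
Fixpoint dirichlet n s : R :=
  if n is n'.+1 then dirichlet n' s + cos (n'%:R * s) + cos (n%:R * s) else 0.

Lemma dirichletE n s :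
  dirichlet n s * sin (s / 2) = sin (n%:R * s) * cos (s / 2).
Proof.
elim: n => [|n IHn]; first by rewrite !mul0r sin0 mul0r.
rewrite [dirichlet _ _]/= !mulrDl IHn.
set u := n%:R * s + s / 2.
have -> : n.+1%:R * s = u + s / 2 by rewrite /u -natr1; field.
have -> : n%:R * s = u - s / 2 by rewrite /u; field.
clearbody u; by rewrite cosB sinB cosD sinD; ring.
Qed.

Lemma continuous_cosM (k : R) : continuous (fun s => cos (k * s)).
Proof.
have := @continuous_affine _ k 0 _ (@continuous_cos R).
by under eq_fun do rewrite addr0.
Qed.

Lemma continuous_dirichlet n : continuous (dirichlet n).
Proof.
elim: n => [|n IHn] x; first exact: cvg_cst.
by apply: cvgD; [apply: cvgD; [exact: IHn|exact: continuous_cosM]|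
  exact: continuous_cosM].
Qed.

Lemma sin_natpi n : sin (n%:R * pi) = 0 :> R.
Proof.
elim: n => [|n IHn]; first by rewrite mul0r sin0.
by rewrite -natr1 mulrDl mul1r sinDpi IHn oppr0.
Qed.

Lemma rint_cosM n : rint 0 pi (fun s => cos (n.+1%:R * s)) = 0.
Proof.
have nz : n.+1%:R != 0 :> R by rewrite pnatr_eq0.
have := @rint_affine_gt0 R 0 pi n.+1%:R 0 cos (pi_ge0 R) (ltr0Sn _ _)
  (@continuous_cos R).
under eq_fun do rewrite addr0.
have dsin x : 0 <= x <= n.+1%:R * pi -> is_derive x (1 : R) sin (cos x).
  by move=> _; exact: is_derive_sin.
rewrite !addr0 mulr0 (rint_FTC _ (@continuous_cos R) dsin); last first.
  by rewrite mulr_ge0// pi_ge0.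
by rewrite sin0 sin_natpi subrr => /eqP; rewrite mulf_eq0 (negbTE nz) => /eqP.
Qed.

Lemma rint_dirichlet n : rint 0 pi (dirichlet n.+1) = pi.
Proof.
elim: n => [|n IHn].
  rewrite [dirichlet 1](_ : _ = fun s => 1 + cos (1%:R * s)); last first.
    by apply/funext => s /=; rewrite add0r mul0r cos0.
  rewrite rintD; [|by move=> ?; exact: cvg_cst|exact: continuous_cosM].
  by rewrite rint_cosM rint_cst ?pi_ge0// subr0 mul1r addr0.
rewrite [dirichlet _](_ : _ = fun s => (dirichlet n.+1 s + cos (n.+1%:R * s)) +
  cos (n.+2%:R * s))//.
rewrite rintD; [|move=> s|exact: continuous_cosM]; last first.
  by apply: cvgD; [exact: continuous_dirichlet|exact: continuous_cosM].
rewrite rintD; [|exact: continuous_dirichlet|exact: continuous_cosM].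
by rewrite IHn !rint_cosM !addr0.
Qed.

(* The kernel [cot (s / 2)], continuously truncated at periodic distance [e]
   from its poles. *)
Definition cotr e s : R :=
  cos (s / 2) * sin (s / 2) / Num.max (sin (s / 2) ^+ 2) (sin (e / 2) ^+ 2).

Lemma continuous_cotr e : 0 < e < pi *+ 2 -> continuous (cotr e).
Proof.
move=> /andP[e0 e2] s.
have sh (f : R -> R) : continuous f -> {for s, continuous (fun s => f (s / 2))}.
  move=> cf; have := @continuous_affine _ 2^-1 0 _ cf s.
  rewrite [X in continuous_at _ X](_ : _ = fun s => f (s / 2))//.
  by apply/funext => y; rewrite addr0 mulrC.
have se : 0 < sin (e / 2) ^+ 2.
  rewrite exprn_gt0// sin_gt0_pi// divr_gt0//= ltr_pdivrMr//.
  by rewrite mulr_natr.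
apply: cvgM; first by apply: cvgM; apply: sh;
  [exact: continuous_cos|exact: continuous_sin].
apply: cvgV; first by rewrite gt_eqF// lt_max se orbT.
apply: (@continuous_max _ _ (fun s => sin (s / 2) ^+ 2)
  (fun=> sin (e / 2) ^+ 2)); last exact: cvg_cst.
by apply: cvgM; apply: sh; exact: continuous_sin.
Qed.

Lemma cotrN e s : cotr e (- s) = - cotr e s.
Proof. by rewrite /cotr mulNr cosN sinN sqrrN mulrN mulNr. Qed.

Lemma cotr_periodic e s : cotr e (s + pi *+ 2) = cotr e s.
Proof.
rewrite /cotr mulrDl [pi *+ 2]mulr2n mulrDl -splitr sinDpi cosDpi sqrrN.
by rewrite mulrNN.
Qed.

Lemma cotrE_half e s : 0 < e -> e <= s <= pi ->
  cotr e s = cos (s / 2) / sin (s / 2).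
Proof.
move=> e0 /andP[es spi].
have es2 : e / 2 <= s / 2 by rewrite ler_pM2r.
have sp2 : s / 2 <= pi / 2 by rewrite ler_pM2r.
have e20 : 0 < e / 2 by rewrite divr_gt0.
have pi0 := @pi_gt0 R.
have se0 : 0 < sin (e / 2) by apply: sin_gt0_pi; rewrite e20/=; lra.
have ss : sin (e / 2) <= sin (s / 2).
  move: es2; rewrite le_eqVlt => /predU1P[->//|es2]; apply: ltW.
  by rewrite ltr_sin// in_itv/=; apply/andP; split; lra.
have s0 : 0 < sin (s / 2) by exact: lt_le_trans ss.
rewrite /cotr max_l; last by rewrite ler_sqr ?nnegrE ?(ltW se0) ?(ltW s0).
by rewrite expr2 invfM mulrA mulfK ?gt_eqF.
Qed.

Lemma cotrE e s : 0 < e -> e <= s <= pi *+ 2 - e ->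
  cotr e s = cos (s / 2) / sin (s / 2).
Proof.
move=> e0 /andP[es se]; have [spi|pis] := leP s pi.
  by rewrite cotrE_half// es.
have -> : cotr e s = - cotr e (pi *+ 2 - s).
  by rewrite -cotrN opprB -(cotr_periodic e (s - _)) subrK.
rewrite cotrE_half//; last by apply/andP; split; rewrite ?mulr2n; lra.
have -> : (pi *+ 2 - s) / 2 = - (s / 2) + pi by rewrite mulr2n; field.
by rewrite sinDpi cosDpi sinN cosN opprK mulNr opprK.
Qed.

End conjugate_kernel.

(** * The principal value of a wave *)

Section torus_principal_value.
Context {R : realType}.
Implicit Types (n : nat) (a x s t e : R).

Lemma cos_wave_sub n a x s :
  cos_wave n a (x - s) 0 - cos_wave n a (x + s) 0 =
  2 * sin_wave n a x 0 * sin (n%:R * s).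
Proof.
rewrite !cos_wave_x !mulrN cosN sinN /sin_wave; case: eqP => [->|_].
  by rewrite mul0r sin0; ring.
by ring.
Qed.

Lemma wave_cotr n a x e s : 0 < e -> e <= s <= pi ->
  cos_wave n a (x - s) 0 * cotr e s - cos_wave n a (x + s) 0 * cotr e s =
  2 * sin_wave n a x 0 * dirichlet n s.
Proof.
move=> e0 es; rewrite -mulrBl cos_wave_sub cotrE_half// -!mulrA; congr (_ * (_ * _)).
have [e1 s1] := andP es.
have s0 : sin (s / 2) != 0.
  rewrite gt_eqF// sin_gt0_pi//; have := @pi_gt0 R.
  by move=> pi0; apply/andP; split; lra.
by rewrite [LHS]mulrA -dirichletE mulfK.
Qed.

(** Folding the distances [s] and [2 pi - s] onto [[e, pi]] produces the difference of the values at
    [x - s] and [x + s]; multiplied by the cotangent, it is the Dirichlet kernel. *)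
Lemma rint_wave_cotr n a x e : 0 < e -> e <= pi ->
  rint (x + e) (x + pi *+ 2 - e)
    (fun t => cos_wave n a t 0 * cotr e (x - t)) =
  2 * sin_wave n a x 0 * rint e pi (dirichlet n).
Proof.
move=> e0 epi; have pi0 := @pi_gt0 R.
have e2 : 0 < e < pi *+ 2 by rewrite e0 mulr2n/=; lra.
have cc := continuous_cotr e2; have cw := @continuous_cos_wave R n a 0.
have cg (k c : R) : continuous (fun s => cos_wave n a (x + k * s) 0 * cotr e s).
  move=> s; apply: cvgM; last exact: cc.
  have := @continuous_affine _ k x _ cw s.
  rewrite [X in continuous_at _ X](_ : _ = fun s => cos_wave n a (x + k * s) 0)//.
  by apply/funext => y; rewrite addrC.
have cp : continuous (fun s => cos_wave n a (x + s) 0 * cotr e s).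
  by have := cg 1 0; under eq_fun do rewrite mul1r.
have cm : continuous (fun s => cos_wave n a (x - s) 0 * cotr e s).
  by have := cg (-1) 0; under eq_fun do rewrite mulN1r.
pose g s := - (cos_wave n a (x + s) 0 * cotr e s).
have cg' : continuous g by move=> s; apply: cvgN; exact: cp.
have gE t : cos_wave n a t 0 * cotr e (x - t) = g (t + - x).
  rewrite /g (_ : x + (t + - x) = t); last by ring.
  by rewrite -mulrN -cotrN opprB.
under eq_fun do rewrite gE.
rewrite rint_shift//; last by rewrite mulr2n; lra.
have -> : x + e + - x = e by ring.
have -> : x + pi *+ 2 - e + - x = pi *+ 2 - e by ring.
rewrite (@rint_split _ e pi)//; last by rewrite mulr2n; lra.
have -> : rint pi (pi *+ 2 - e) g =
    rint e pi (fun s => cos_wave n a (x - s) 0 * cotr e s).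
  have -> : (fun s => cos_wave n a (x - s) 0 * cotr e s) =
      (fun s => (fun u => g (u + pi *+ 2)) (- s)).
    apply/funext => s; rewrite /g cotr_periodic cotrN mulrN opprK.
    by rewrite addrA cos_wave_periodic.
  rewrite (@rint_opp _ e pi (fun u => g (u + pi *+ 2)))//; last first.
    have := @continuous_affine _ 1 (pi *+ 2) _ cg'.
    by under eq_fun do rewrite mul1r.
  rewrite rint_shift//; last by rewrite lerN2.
  have -> : - pi + pi *+ 2 = pi :> R by rewrite mulr2n; ring.
  by rewrite addrC.
rewrite addrC -rintD//.
rewrite -rintZ; last exact: continuous_dirichlet.
apply: eq_Rintegral => s; rewrite inE/= in_itv/= => es.
by rewrite /g wave_cotr.
Qed.

Lemma pv_torus_set x e : torus R x -> 0 < e -> e < pi ->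
  torus R `&` [set t | e < `|x - t| < 2 * pi - e] =
  (`[- pi, x - e[ `|` `]x + e, pi[) `&` `]x - (2 * pi - e), x + (2 * pi - e)[
  :> set R.
Proof.
rewrite /torus/= in_itv/= => /andP[x1 x2] e0 epi; apply/seteqP; split => t /=.
  rewrite !in_itv/= => -[/andP[t1 t2]].
  have [xt|xt] := ltP t x.
    rewrite gtr0_norm ?subr_gt0// => /andP[h1 h2].
    by split; [left; rewrite t1/=; lra|apply/andP; split; lra].
  rewrite ler0_norm ?subr_le0// => /andP[h1 h2].
  by split; [right; rewrite t2 andbT; lra|apply/andP; split; lra].
rewrite !in_itv/= => -[[|] /andP[t1 t2] /andP[t3 t4]].
  have h : `|x - t| = x - t by rewrite gtr0_norm// subr_gt0; lra.
  rewrite h; split; apply/andP; split; lra.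
have h : `|x - t| = t - x by rewrite ltr0_norm ?opprB// subr_lt0; lra.
rewrite h; split; apply/andP; split; lra.
Qed.

Lemma Rintegral_itv_cc (l r : bool) (u v : R) (g : R -> R) : continuous g ->
  (\int[lebesgue_measure]_(t in [set` Interval (BSide l u) (BSide r v)]) g t)%R
  = rint u v g.
Proof.
move=> cg; have ig (I : interval R) : [set` I] `<=` `[u, v] ->
    lebesgue_measure.-integrable [set` I] (EFin \o g).
  by move=> Iuv; apply: integrableS (integrable_itv u v cg) => //.
case: l; case: r; rewrite /rint.
- by apply: Rintegral_itv_bndo_bndc; apply: ig; exact: subset_itv_co_cc.
- by [].
- rewrite Rintegral_itv_bndo_bndc; last by apply: ig; exact: subset_itv_oo_cc.
  by apply: Rintegral_itv_obnd_cbnd; apply: ig; exact: subset_itv_oc_cc.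
- by apply: Rintegral_itv_obnd_cbnd; apply: ig; exact: subset_itv_oc_cc.
Qed.

Lemma continuous_wave_cotr n a x e : 0 < e < pi *+ 2 ->
  continuous (fun t => cos_wave n a t 0 * cotr e (x - t)).
Proof.
move=> e2 t; apply: cvgM; first exact: continuous_cos_wave.
have := @continuous_affine _ (-1) x _ (continuous_cotr e2) t.
rewrite [X in continuous_at _ X](_ : _ = fun t => cotr e (x - t))//.
by apply/funext => y; rewrite mulN1r addrC.
Qed.

(** At [x = - pi] the domain of integration is one interval. Elsewhere, for small [e], it is two
    intervals, and moving the left one by a period makes it adjacent to the right one. *)
Lemma pv_torus_truncated n a x e : torus R x -> 0 < e -> e < pi ->
  (x = - pi \/ e < x + pi /\ e < pi - x) ->
  (\int[lebesgue_measure]_(t in torus R `&`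
        [set t | (e < `|x - t| < 2 * pi - e)%R])
      (cos_wave n a t 0 * (cos ((x - t) / 2) / sin ((x - t) / 2))))%R =
  2 * sin_wave n a x 0 * rint e pi (dirichlet n).
Proof.
move=> Tx e0 epi xe; have pi0 := @pi_gt0 R.
have e2 : 0 < e < pi *+ 2 by rewrite e0 mulr2n/=; lra.
pose g t := cos_wave n a t 0 * cotr e (x - t).
have cg : continuous g by exact: continuous_wave_cotr.
rewrite -rint_wave_cotr ?(ltW epi)// -/g.
transitivity (\int[lebesgue_measure]_(t in torus R `&`
    [set t | (e < `|x - t| < 2 * pi - e)%R]) g t)%R.
  apply: eq_Rintegral => t; rewrite inE/= => -[_ /andP[h1 h2]]; rewrite /g; congr (_ * _).
  have [xt|tx] := leP 0 (x - t).
    by rewrite cotrE// pi2E -(ger0_norm xt) (ltW h1) (ltW h2).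
  rewrite ltr0_norm// in h1 h2.
  rewrite -[x - t]opprK cotrN cotrE//; last by rewrite pi2E (ltW h1) (ltW h2).
  by rewrite opprK mulNr cosN sinN invrN mulrN opprK.
rewrite pv_torus_set//.
case: xe => [xpi|[xe1 xe2]].
  rewrite (_ : _ `&` _ = `]x + e, x + pi *+ 2 - e[%classic); last first.
    apply/seteqP; split => t /=; rewrite !in_itv/= xpi mulr2n.
      by move=> [[|] /andP[h1 h2] /andP[h3 h4]]; apply/andP; split; lra.
    by move=> /andP[h1 h2]; split; [right|]; apply/andP; split; lra.
  by rewrite Rintegral_itv_cc.
rewrite (_ : _ `&` _ = `[- pi, x - e[%classic `|` `]x + e, pi[%classic);
  last first.
  apply/seteqP; split => t /=; first by move=> [].
  move=> h; split => //; move: h; rewrite !in_itv/=.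
  by move=> [|] /andP[h1 h2]; apply/andP; split; lra.
rewrite Rintegral_setU//; last 2 first.
- apply: (integrableS _ _ _ (integrable_itv (- pi) pi cg)) => //.
  + exact: measurableU.
  + move=> t /=; rewrite !in_itv/=.
    by move=> [|] /andP[h1 h2]; apply/andP; split; lra.
- apply/disj_setPRL => t /=; rewrite !in_itv/= => /andP[h1 h2] /andP[h3 h4].
  by lra.
rewrite !Rintegral_itv_cc//.
have -> : rint (- pi) (x - e) g = rint pi (x + pi *+ 2 - e) g.
  have gT t : g (t + pi *+ 2) = g t.
    rewrite /g cos_wave_periodic -(cotr_periodic e (x - (t + _))).
    by congr (_ * cotr e _); ring.
  have -> : rint (- pi) (x - e) g = rint (- pi) (x - e) (fun t => g (t + pi *+ 2)).
    by congr rint; apply/funext => t; rewrite gT.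
  rewrite rint_shift//; last by lra.
  have -> : - pi + pi *+ 2 = pi :> R by rewrite mulr2n; ring.
  by rewrite addrAC.
rewrite addrC -rint_split//; first by lra.
by rewrite mulr2n; lra.
Qed.

(** After folding no singularity is left: up to a constant factor, the truncated integral is
    [F pi - F e] with a primitive [F] of the Dirichlet kernel, continuous at [e = 0]. *)
Lemma pv_torus_wave n a x : torus R x ->
  pv_torus (fun t => cos_wave n a t 0) x = sin_wave n a x 0.
Proof.
move=> Tx; have pi0 := @pi_gt0 R; have cD := @continuous_dirichlet R n.
have [F dF] := primitive_exists (-1) cD.
have dF' (u v y : R) : 0 <= u -> u <= y <= v -> is_derive y 1 F (dirichlet n y).
  move=> u0 /andP[uy _]; apply: dF.
  by rewrite (lt_le_trans _ (le_trans u0 uy))// ltrN10.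
have FE e : 0 <= e -> e <= pi -> rint e pi (dirichlet n) = F pi - F e.
  by move=> e0 epi; rewrite (rint_FTC epi cD (fun y => @dF' e pi y e0)).
have cF : {for 0, continuous F}.
  apply: differentiable_continuous; apply/derivable1_diffP.
  by have [] := dF 0 (ltrN10 R).
have [x1 x2] : - pi <= x /\ x < pi.
  by move: Tx; rewrite /torus/= in_itv/= => /andP[].
have xpi : x = - pi \/ 0 < x + pi.
  move: x1; rewrite le_eqVlt => /predU1P[->|]; first by left.
  by rewrite -subr_gt0 opprK; right.
have Fx : \forall e \near 0^'+, x = - pi \/ e < x + pi.
  have [xE|x0] := xpi; near=> e; first by left.
  by right; near: e; exact: nbhs_right_lt.
rewrite /pv_torus; apply: cvg_lim; first exact: Rhausdorff.
apply: (@cvg_trans _ ((fun e => (2 * pi)^-1 *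
    (2 * sin_wave n a x 0 * (F pi - F e))) @ 0^'+)).
  apply: near_eq_cvg; near=> e.
  have e0 : 0 < e by [].
  have epi : e < pi by near: e; exact: nbhs_right_lt.
  rewrite pv_torus_truncated ?FE ?(ltW e0) ?(ltW epi)//.
  have : x = - pi \/ e < x + pi by near: e; exact: Fx.
  move=> [->|?]; [by left|right; split=> //].
  by near: e; apply: nbhs_right_lt; rewrite subr_gt0.
have SE : sin_wave n a x 0 =
    (2 * pi)^-1 * (2 * sin_wave n a x 0 * (F pi - F 0)).
  rewrite -FE ?(ltW pi0)//; case: n {cD dF dF' FE} => [|n].
    by rewrite /sin_wave eqxx mulr0 mul0r mulr0.
  by rewrite rint_dirichlet mulrAC mulKf// gt_eqF// mulr_gt0.
rewrite [X in _ `=>` nbhs X]SE.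
apply: cvgM; first exact: cvg_cst.
apply: cvgM; first exact: cvg_cst.
apply: cvgB; first exact: cvg_cst.
exact: cvg_at_right_filter.
Unshelve. all: by end_near. Qed.

Lemma cos_waveE n t : cos_wave n 0 t 0 = cos (n%:R * t).
Proof. by rewrite /cos_wave mulr0 oppr0 expR0 mul1r addr0. Qed.

Lemma cos_wave_sinE n t : cos_wave n (- (pi / 2)) t 0 = sin (n%:R * t).
Proof. by rewrite /cos_wave mulr0 oppr0 expR0 mul1r cosBpihalf. Qed.

(** [pv_torus] integrates over one fixed period, so its values are compared with the conjugate wave
    only at points of that period. *)
Definition wave_pair (f g : R -> R) := exists n a,
  (forall t, f t = cos_wave n a t 0) /\
  (forall t, torus R t -> g t = sin_wave n a t 0).

Lemma hilbert_torus_wave f g : hilbert_torus R f g -> wave_pair f g.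
Proof.
case=> n h.
  exists n, 0; split => [t|t Tt]; first by rewrite cos_waveE.
  rewrite -pv_torus_wave// (_ : h = fun t => cos_wave n 0 t 0)//.
  by apply/funext => s; rewrite cos_waveE.
exists n, (- (pi / 2)); split => [t|t Tt]; first by rewrite cos_wave_sinE.
rewrite -pv_torus_wave// (_ : h = fun t => cos_wave n (- (pi / 2)) t 0)//.
by apply/funext => s; rewrite cos_wave_sinE.
Qed.

End torus_principal_value.

Lemma poweR_inv_le (R : realType) (p C : R) (I : \bar R) :
  0 < p -> 0 <= C -> (0 <= I)%E ->
  (I `^ p^-1 <= C%:E)%E = (I <= (C `^ p)%:E)%E.
Proof.
move=> p0 C0; have pN : p != 0 by rewrite gt_eqF.
case: I => [r|_|//]; last by rewrite poweRyr ?invr_eq0// !leye_eq.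
rewrite lee_fin => r0; rewrite poweR_EFin !lee_fin.
have rE : r = (r `^ p^-1) `^ p by rewrite -powRrM mulVf// powRr1.
apply/idP/idP => h.
  by rewrite rE ge0_ler_powR ?nnegrE ?powR_ge0// ltW.
have -> : C = (C `^ p) `^ p^-1 by rewrite -powRrM divff// powRr1.
by rewrite ge0_ler_powR ?nnegrE ?powR_ge0// invr_ge0 ltW.
Qed.

Lemma Lp_integral_ge0 (R : realType) (X : normedModType R) (D : set R) (p : R)
    (F : R -> X) : (0 <= \int[lebesgue_measure]_(x in D) (`|F x| `^ p)%:E)%E.
Proof. by apply: integral_ge0 => t _; rewrite lee_fin powR_ge0. Qed.

Section torus_opnorm.
Context {R : realType} {X : normedModType R}.
Variables (p C : R).
Hypotheses (p1 : 1 < p) (C0 : 0 <= C) (WB : walk_bound X p (C `^ p)).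

Lemma integral_torus (f : R -> R) : continuous f ->
  (\int[lebesgue_measure]_(x in torus R) (f x)%:E = (rint (- pi) pi f)%:E)%E.
Proof.
move=> cf; rewrite -(Rintegral_itv_cc true true)//.
rewrite /Rintegral fineK//; apply: integrable_fin_num; first exact: measurable_itv.
apply: (integrableS _ _ _ (integrable_itv (- pi) pi cf)) => //.
exact: subset_itv_co_cc.
Qed.

Lemma opnorm_torus_le : (opnorm X (torus R) p (hilbert_torus R) <= C%:E)%E.
Proof.
have p0 : 0 < p by exact: lt_trans p1.
apply: ge_ereal_sup => _ [n [f [g [x [Hfg Lf ->]]]]].
have [nn /choice [aa wE]] := choice (fun k => hilbert_torus_wave (Hfg k)).
rewrite /Lp_norm poweR_inv_le//; last exact: Lp_integral_ge0.
pose U t := \sum_k cos_wave (nn k) (aa k) t 0 *: x k.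
pose V t := \sum_k sin_wave (nn k) (aa k) t 0 *: x k.
have cU : continuous (fun t => `|U t| `^ p).
  apply: continuous_norm_powR; first exact: ltW.
  by apply: continuous_vsum => k; exact: continuous_cos_wave.
have cV : continuous (fun t => `|V t| `^ p).
  apply: continuous_norm_powR; first exact: ltW.
  by apply: continuous_vsum => k; exact: continuous_sin_wave.
have fU : tensor_sum f x = U.
  by apply/funext => t; apply: eq_bigr => k _; rewrite (wE k).1.
have -> : (\int[lebesgue_measure]_(t in torus R) (`|tensor_sum g x t| `^ p)%:E =
    \int[lebesgue_measure]_(t in torus R) (`|V t| `^ p)%:E)%E.
  apply: eq_integral => t /[!inE] Tt; congr ((`|_| `^ p)%:E).
  by apply: eq_bigr => k _; rewrite (wE k).2.
move: Lf; rewrite /Lp_norm poweR_inv_le//; last exact: Lp_integral_ge0.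
rewrite powR1 fU (integral_torus cU) (integral_torus cV) !lee_fin => IU.
have := torus_waves (ltW p1) (powR_ge0 C p) WB nn aa x.
by move=> /le_trans; apply; rewrite ler_piMr// powR_ge0.
Qed.

End torus_opnorm.

(** * The Hilbert transform on the line *)

Section polynomial_approximation.
Context {R : realType}.
Implicit Types (phi : nat -> R) (x u v l e : R) (n k : nat).

(* Bernstein polynomials of [phi], as the expectation of [phi] along a walk that
   moves right with probability [(1 + u) / 2]. *)
Fixpoint bernstein phi n k : {poly R} :=
  if n is n'.+1 then
    (2^-1)%:P * ((1 + 'X) * bernstein phi n' k.+1 +
                 (1 - 'X) * bernstein phi n' k)
  else (phi k)%:P.

Lemma bernsteinS phi n k u : (bernstein phi n.+1 k).[u] =
  ((1 + u) * (bernstein phi n k.+1).[u] + (1 - u) * (bernstein phi n k).[u]) / 2.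
Proof. by rewrite /= !hornerE; field. Qed.

Lemma bernstein_le phi psi n k u : -1 <= u <= 1 ->
  (forall j, phi j <= psi j) ->
  (bernstein phi n k).[u] <= (bernstein psi n k).[u].
Proof.
move=> /andP[u1 u2] pp; elim: n k => [|n IHn] k; first by rewrite !hornerE.
rewrite !bernsteinS ler_pM2r// lerD//.
  by rewrite ler_wpM2l//; lra.
by rewrite ler_wpM2l//; lra.
Qed.

Lemma bernstein_affine phi (c d : R) n k u :
  (bernstein (fun j => c * phi j + d) n k).[u] =
  c * (bernstein phi n k).[u] + d.
Proof.
elim: n k => [|n IHn] k; first by rewrite !hornerE.
by rewrite !bernsteinS !IHn; field.
Qed.

(** Squared bias plus variance of the walk: a step with success probability [(1 + u) / 2] has
    variance [(1 - u ^+ 2) / 4]. *)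
Lemma bernstein_sqr n k (c u : R) :
  (bernstein (fun j => (j%:R - c) ^+ 2) n k).[u] =
  (k%:R + n%:R * ((1 + u) / 2) - c) ^+ 2 + n%:R * ((1 - u ^+ 2) / 4).
Proof.
elim: n k => [|n IHn] k; first by rewrite /= !hornerE; ring.
by rewrite bernsteinS !IHn -!natr1; field.
Qed.

(** The distance [|node j - u|] is majorised by [((node j - u) ^+ 2 / l + l) / 2], whose expectation
    the variance controls; [n >= l ^- 2] makes both terms of order [l]. *)
Lemma lipschitz_poly_approx (phi : R -> R) (L e : R) : 0 <= L -> 0 < e ->
  (forall u v, `|phi u - phi v| <= L * `|u - v|) ->
  exists Q : {poly R}, forall u, -1 <= u <= 1 -> `|Q.[u] - phi u| <= e.
Proof.
move=> L0 e0 Lphi.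
pose l := e / (L + 1); have l0 : 0 < l by rewrite divr_gt0// ltr_wpDl.
pose n := (Num.truncn (l ^- 2)).+1.
have n0 : 0 < n%:R :> R by rewrite ltr0n.
have nl : l ^- 2 <= n%:R by rewrite ltW// truncnS_gt.
pose node j : R := 2 * j%:R / n%:R - 1.
exists (bernstein (phi \o node) n 0) => u u1.
pose w j : R := L * (2 / (l * n%:R ^+ 2)) * (j%:R - n%:R * ((1 + u) / 2)) ^+ 2 +
  L * l / 2.
have wE j : `|phi (node j) - phi u| <= w j.
  rewrite (le_trans (Lphi _ _))//.
  have -> : w j = L * ((node j - u) ^+ 2 / l + l) / 2.
    by rewrite /w /node; field; rewrite !gt_eqF.
  rewrite -mulrA ler_wpM2l// ler_pdivlMr// -[_ ^+ 2]real_normK ?num_real//.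
  rewrite -(@ler_pM2r _ l)// mulrDl divfK ?gt_eqF//.
  by have := sqr_ge0 (`|node j - u| - l); rewrite sqrrB; lra.
have low : - ((bernstein w n 0).[u]) + phi u <= (bernstein (phi \o node) n 0).[u].
  rewrite -mulN1r -(bernstein_affine w).
  apply: bernstein_le => // j; have := wE j; rewrite ler_norml => /andP[h _].
  by rewrite mulN1r /=; lra.
have up : (bernstein (phi \o node) n 0).[u] <= (bernstein w n 0).[u] + phi u.
  rewrite -[(bernstein w n 0).[u]]mul1r -(bernstein_affine w).
  apply: bernstein_le => // j; have := wE j; rewrite ler_norml => /andP[_ h].
  by rewrite mul1r /=; lra.
have we : (bernstein w n 0).[u] <= e.
  rewrite /w (bernstein_affine (fun j => (j%:R - n%:R * ((1 + u) / 2)) ^+ 2)).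
  rewrite bernstein_sqr add0r subrr expr0n add0r.
  have -> : L * (2 / (l * n%:R ^+ 2)) * (n%:R * ((1 - u ^+ 2) / 4)) =
      L * ((1 - u ^+ 2) * (l ^- 2 / n%:R) * l) / 2.
    by field; rewrite !gt_eqF.
  have h1 : (1 - u ^+ 2) * (l ^- 2 / n%:R) * l <= l.
    rewrite ler_piMl ?(ltW l0)// mulr_ile1//.
    - by have [? ?] := andP u1; rewrite subr_ge0 expr2; nra.
    - by rewrite divr_ge0 ?invr_ge0 ?exprn_ge0 ?(ltW l0).
    - by rewrite gerBl sqr_ge0.
    - by rewrite ler_pdivrMr// mul1r.
  have h2 : L * l <= e.
    rewrite /l mulrCA ler_piMr ?(ltW e0)// ler_pdivrMr ?ltr_wpDl// mul1r.
    by rewrite lerDl.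
  by have := ler_wpM2l L0 h1; lra.
by rewrite ler_norml; apply/andP; split; lra.
Qed.

Lemma poly_primitive (Q : {poly R}) (c : R) :
  exists q : {poly R}, q^`() = Q /\ q.[0] = c.
Proof.
exists (\poly_(i < (size Q).+1) (if i is j.+1 then Q`_j / j.+1%:R else c)).
split; last by rewrite horner_coef0 coef_poly.
apply/polyP => i; rewrite coef_deriv coef_poly ltnS.
case: ltnP => [_|sQ]; first by rewrite -[LHS]mulr_natr divfK// pnatr_eq0.
by rewrite mul0rn nth_default.
Qed.

(** The polynomial is a primitive of an approximation of [dphi], normalised at 0. This makes the
    error itself [e]-Lipschitz, which is what the conjugate operator can absorb. *)
Lemma C1_poly_approx (phi dphi : R -> R) (L e : R) : 0 <= L -> 0 < e ->
  (forall u, is_derive u 1 phi (dphi u)) ->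
  (forall u v, `|dphi u - dphi v| <= L * `|u - v|) ->
  exists q : {poly R}, (forall u, -1 <= u <= 1 -> `|q.[u] - phi u| <= e) /\
    (forall u v, -1 <= u <= 1 -> -1 <= v <= 1 ->
      `|(q.[u] - phi u) - (q.[v] - phi v)| <= e * `|u - v|).
Proof.
move=> L0 e0 dphiE Ldphi; have [Q QE] := lipschitz_poly_approx L0 e0 Ldphi.
have [q [dq q0]] := poly_primitive Q (phi 0); exists q.
have dr u : is_derive u 1 (fun u => q.[u] - phi u) (Q.[u] - dphi u).
  by rewrite -dq; apply: is_deriveB.
have lip u v : -1 <= u <= 1 -> -1 <= v <= 1 ->
    `|(q.[u] - phi u) - (q.[v] - phi v)| <= e * `|u - v|.
  wlog vu : u v / v <= u.
    move=> hw; have [/hw//|/ltW/hw h] := leP v u.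
    by move=> u1 v1; rewrite distrC [`|u - v|]distrC; exact: h.
  move=> /andP[u1 u2] /andP[v1 v2].
  have dr' y : y \in `]v, u[ ->
      is_derive y 1 (fun u => q.[u] - phi u) ((fun u => Q.[u] - dphi u) y).
    by move=> _; exact: dr.
  have cr : {within `[v, u], continuous (fun u => q.[u] - phi u)}.
    apply: derivable_within_continuous => y _.
    by have [] := dr y.
  have [y /[!in_itv]/= /andP[vy yu] ->] := MVT_segment vu dr' cr.
  rewrite normrM ler_wpM2r//; apply: QE.
  by rewrite (le_trans v1)//= (le_trans yu).
split=> // u u1; have := lip u 0 u1; rewrite q0 subrr !subr0.
move=> /(_ _)/le_trans; apply; first by rewrite lerN10 ler01.
by rewrite ler_piMr ?(ltW e0)// ler_norml.
Qed.

End polynomial_approximation.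

(** * Trigonometric polynomials and their conjugates *)

Section trigonometric_polynomials.
Context {R : realType}.
Implicit Types (f g : R -> R) (n : nat) (a c t : R).

Definition wave f g := exists n a,
  f = (fun t => cos_wave n a t 0) /\ g = (fun t => sin_wave n a t 0).

(** An inductive generation by waves, so that properties pass from waves to all trigonometric
    polynomials without Fourier coefficients. *)
Inductive conj_pair : (R -> R) -> (R -> R) -> Prop :=
| conj_pair_wave n a :
    conj_pair (fun t => cos_wave n a t 0) (fun t => sin_wave n a t 0)
| conj_pairD f1 g1 f2 g2 : conj_pair f1 g1 -> conj_pair f2 g2 ->
    conj_pair (fun t => f1 t + f2 t) (fun t => g1 t + g2 t)
| conj_pairZ c f g : conj_pair f g ->
    conj_pair (fun t => c * f t) (fun t => c * g t).

Lemma conj_pair_continuous f g : conj_pair f g -> continuous f /\ continuous g.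
Proof.
elim=> {f g} [n a|f1 g1 f2 g2 _ [cf1 cg1] _ [cf2 cg2]|c f g _ [cf cg]].
- by split; [exact: continuous_cos_wave|exact: continuous_sin_wave].
- by split=> t; apply: cvgD; [exact: cf1|exact: cf2|exact: cg1|exact: cg2].
- by split=> t; apply: cvgM; [exact: cvg_cst|exact: cf|exact: cvg_cst|exact: cg].
Qed.

Lemma conj_pair_periodic f g : conj_pair f g ->
  (forall t, f (t + pi *+ 2) = f t) /\ (forall t, g (t + pi *+ 2) = g t).
Proof.
elim=> {f g} [n a|f1 g1 f2 g2 _ [cf1 cg1] _ [cf2 cg2]|c f g _ [cf cg]].
- by split=> t; rewrite ?cos_wave_periodic ?sin_wave_periodic.
- by split=> t; rewrite ?cf1 ?cf2 ?cg1 ?cg2.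
- by split=> t; rewrite ?cf ?cg.
Qed.

Lemma conj_pair_extends (X : normedModType R) f g (x : X) : conj_pair f g ->
  extends wave (fun t => f t *: x) (fun t => g t *: x).
Proof.
elim=> {f g} [n a|f1 g1 f2 g2 _ H1 _ H2|c f g _ H].
- by apply: extends1; exists n, a.
- under eq_fun do rewrite scalerDl; under [X in extends _ _ X]eq_fun do rewrite scalerDl.
  exact: extendsD.
- under eq_fun do rewrite -scalerA; under [X in extends _ _ X]eq_fun do rewrite -scalerA.
  exact: extendsZ.
Qed.

(** Product-to-sum formula, with frequency 0 apart because it has no lower neighbour. The conjugate
    of the product is only claimed to exist; it is not [sin t * g t] in general. *)
Lemma conj_pair_sin f g : conj_pair f g ->
  exists h, conj_pair (fun t => sin t * f t) h.
Proof.
elim=> {f g} [n a|f1 g1 f2 g2 _ [h1 H1] _ [h2 H2]|c f g _ [h H]].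
- case: n => [|n].
    exists (fun t => cos a * sin_wave 1 (- (pi / 2)) t 0).
    have -> : (fun t => sin t * cos_wave 0 a t 0) =
        (fun t => cos a * cos_wave 1 (- (pi / 2)) t 0).
      apply/funext => t; rewrite cos_wave_sinE /cos_wave mul1r !mul0r oppr0 expR0.
      by rewrite add0r mul1r mulrC.
    by apply: conj_pairZ; exact: conj_pair_wave.
  exists (fun t => 2^-1 * sin_wave n.+2 (a - pi / 2) t 0 +
    - 2^-1 * sin_wave n (a - pi / 2) t 0).
  have -> : (fun t => sin t * cos_wave n.+1 a t 0) =
      (fun t => 2^-1 * cos_wave n.+2 (a - pi / 2) t 0 +
       - 2^-1 * cos_wave n (a - pi / 2) t 0).
    apply/funext => t; rewrite /cos_wave !mulr0 oppr0 expR0 !mul1r !addrA !cosBpihalf.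
    set u := n.+1%:R * t + a.
    have -> : n.+2%:R * t + a = u + t by rewrite /u -natr1; ring.
    have -> : n%:R * t + a = u - t by rewrite /u -natr1; ring.
    by clearbody u; rewrite sinD sinB; field.
  by apply: conj_pairD; apply: conj_pairZ; exact: conj_pair_wave.
- exists (fun t => h1 t + h2 t).
  by under eq_fun do rewrite mulrDr; exact: conj_pairD.
- exists (fun t => c * h t).
  by under eq_fun do rewrite mulrCA; exact: conj_pairZ.
Qed.

Lemma conj_pair_cst c : conj_pair (fun=> c) (fun=> 0).
Proof.
have := conj_pairZ c (conj_pair_wave 0 0).
rewrite (_ : (fun t => c * cos_wave 0 0 t 0) = (fun=> c)); last first.
  by apply/funext => t; rewrite cos_waveE mul0r cos0 mulr1.
rewrite (_ : (fun t => c * sin_wave 0 0 t 0) = (fun=> 0))//.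
by apply/funext => t; rewrite /sin_wave eqxx mulr0.
Qed.

Lemma conj_pair_poly (q : {poly R}) :
  exists g, conj_pair (fun t => q.[sin t]) g.
Proof.
elim/poly_ind: q => [|q c [g H]].
  by exists (fun=> 0); under eq_fun do rewrite horner0; exact: conj_pair_cst.
have [h Hh] := conj_pair_sin H; exists (fun t => h t + 0).
under eq_fun do rewrite hornerMXaddC mulrC.
by apply: conj_pairD => //; exact: conj_pair_cst.
Qed.

End trigonometric_polynomials.

Lemma extends_sum (R : realType) (X : normedModType R) T n
    (F G : 'I_n -> R -> X) : (forall k, extends T (F k) (G k)) ->
  extends T (fun t => \sum_k F k t) (fun t => \sum_k G k t).
Proof.
elim: n F G => [|n IHn] F G H.
  under eq_fun do rewrite big_ord0; under [X in extends _ _ X]eq_fun do rewrite big_ord0.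
  exact: extends0.
under eq_fun do rewrite big_ord_recl.
under [X in extends _ _ X]eq_fun do rewrite big_ord_recl.
by apply: extendsD => //; exact: IHn.
Qed.

Lemma conj_pair_torus (R : realType) (X : normedModType R) (p Cp : R) :
  1 <= p -> 0 <= Cp -> walk_bound X p Cp ->
  forall n (f g : 'I_n -> R -> R) (x : 'I_n -> X),
  (forall k, conj_pair (f k) (g k)) ->
  rint (- pi) pi (fun t => `|tensor_sum g x t| `^ p) <=
  Cp * rint (- pi) pi (fun t => `|tensor_sum f x t| `^ p).
Proof.
move=> p1 Cp0 WB n f g x fg.
have [m [F [G [y [FG -> ->]]]]] : extends wave (tensor_sum f x) (tensor_sum g x).
  by apply: extends_sum => k; exact: conj_pair_extends.
have [nn /choice [aa wE]] := choice FG.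
have -> : F = (fun k t => cos_wave (nn k) (aa k) t 0).
  by apply/funext => k; case: (wE k).
have -> : G = (fun k t => sin_wave (nn k) (aa k) t 0).
  by apply/funext => k; case: (wE k).
exact: torus_waves.
Qed.

(** * Folded singular integrals *)

Section singular_integrals.
Context {R : realType}.
Implicit Types (f g h K : R -> R) (a b c k l s t x y L : R).

(** The left end is left out, since the kernels below are singular at 0. *)
Definition roint a b h : R := (\int[lebesgue_measure]_(s in `]a, b]) h s)%R.

Definition tame a b h c := forall s, a < s <= b ->
  {for s, continuous h} /\ `|h s| <= c.

Lemma tame_integrable a b h c : tame a b h c ->
  lebesgue_measure.-integrable `]a, b] (EFin \o h).
Proof.
move=> th; apply: measurable_bounded_integrable => //.
- have [ab|ba] := leP b a; first by rewrite set_itv_ge ?measure0// bnd_simp -leNgt.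
  have mE : lebesgue_measure (`]a, b]%classic : set R) = (b - a)%:E.
    by rewrite lebesgue_measure_itv/= lte_fin ba.
  by have := ltry (b - a); rewrite -mE.
- apply: subspace_continuous_measurable_fun => //.
  apply: continuous_in_subspaceT => s; rewrite inE/= in_itv/= => sab.
  by have [] := th s sab.
- exists c; split; first exact: num_real.
  move=> u cu s /=; rewrite in_itv/= => sab.
  by have [_ /le_trans] := th s sab; apply; exact: ltW.
Qed.

Lemma tame_sub a b h c a' b' : a <= a' -> b' <= b -> tame a b h c -> tame a' b' h c.
Proof.
by move=> aa bb th s /andP[s1 s2]; apply: th; rewrite (le_lt_trans aa)//= (le_trans s2).
Qed.

Lemma norm_roint_le a b h c : a <= b -> tame a b h c -> `|roint a b h| <= c * (b - a).
Proof.
move=> ab th; have ih := tame_integrable th.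
have tc : tame a b (fun=> c) `|c| by move=> s _; split=> //; exact: cvg_cst.
have <- : roint a b (fun=> c) = c * (b - a).
  rewrite /roint Rintegral_cst//; congr (_ * _).
  have mE : lebesgue_measure (`]a, b]%classic : set R) = (b - a)%:E.
    rewrite lebesgue_measure_itv/= lte_fin; move: ab.
    by rewrite le_eqVlt => /predU1P[->|->//]; rewrite ltxx subrr.
  exact: (congr1 fine mE).
rewrite /roint (le_trans (le_normr_Rintegral _ _))//.
apply: le_Rintegral => //.
- by apply: integrable_norm.
- exact: tame_integrable tc.
- by move=> s /=; rewrite in_itv/= => /th[].
Qed.

Lemma rointB a b g h c c' : tame a b g c -> tame a b h c' ->
  roint a b (fun s => g s - h s) = roint a b g - roint a b h.
Proof. by move=> tg th; apply: RintegralB => //; apply: tame_integrable; eassumption. Qed.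

Lemma rointD a b g h c c' : tame a b g c -> tame a b h c' ->
  roint a b (fun s => g s + h s) = roint a b g + roint a b h.
Proof. by move=> tg th; apply: RintegralD => //; apply: tame_integrable; eassumption. Qed.

Lemma rointZ a b k h c : tame a b h c ->
  roint a b (fun s => k * h s) = k * roint a b h.
Proof. by move=> th; apply: RintegralZl => //; apply: tame_integrable; eassumption. Qed.

Lemma eq_roint a b g h : (forall s, a < s <= b -> g s = h s) -> roint a b g = roint a b h.
Proof. by move=> gh; apply: eq_Rintegral => s; rewrite inE/= in_itv/=; exact: gh. Qed.

Lemma roint_split a b c h l : a <= b -> b <= c -> tame a c h l ->
  roint a c h = roint a b h + roint b c h.
Proof.
move=> ab bc th; rewrite /roint -Rintegral_setU//.
- congr (Rintegral _ _ _); apply/seteqP; split=> s /=; rewrite !in_itv/=.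
    by move=> /andP[as_ sc]; have [sb|bs] := leP s b; [left; rewrite as_|right].
  by move=> [|] /andP[h1 h2]; apply/andP; split=> //;
    [exact: le_trans bc|exact: le_lt_trans h1].
- rewrite (_ : _ `|` _ = `]a, c]%classic); first exact: tame_integrable th.
  apply/seteqP; split=> s /=; rewrite !in_itv/=.
    by move=> [|] /andP[h1 h2]; apply/andP; split=> //;
      [exact: le_trans bc|exact: le_lt_trans h1].
  by move=> /andP[as_ sc]; have [sb|bs] := leP s b; [left; rewrite as_|right].
- apply/disj_setPRL => s /=; rewrite !in_itv/= => /andP[h1 _] /andP[_ h2].
  by move: (le_lt_trans h2 h1); rewrite ltxx.
Qed.

Lemma roint_rint a b h : continuous h -> roint a b h = rint a b h.
Proof. by move=> ch; rewrite /roint (Rintegral_itv_cc false false). Qed.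

Definition lip l f := forall u v, `|f u - f v| <= l * `|u - v|.

Lemma lip_continuous l f : lip l f -> continuous f.
Proof.
move=> lf s; apply/cvgrPdist_le => e e0; near=> t.
rewrite (le_trans (lf s t))//.
have l1 : 0 < `|l| + 1 by rewrite ltr_wpDl.
apply: (@le_trans _ _ ((`|l| + 1) * `|s - t|)).
  by rewrite ler_wpM2r// (le_trans (ler_norm l))// lerDl.
rewrite mulrC -ler_pdivlMr//; near: t.
by apply: cvgr_dist_le; [exact: cvg_id|rewrite divr_gt0].
Unshelve. all: by end_near. Qed.

(** The bound [4 / s] covers both [s^-1] and the dilated cotangent; the 4 comes from
    [quarter_le_sin]. *)
Definition kernel a K := forall s, 0 < s <= a ->
  {for s, continuous K} /\ `|s * K s| <= 4.

Definition diffk f K x s : R := (f (x - s) - f (x + s)) * K s.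

(** The principal value folded about [x]. For Lipschitz [f] the integrand is bounded, so no limit is
    taken. *)
Definition conjk a f K x : R := pi^-1 * roint 0 a (diffk f K x).

Lemma diffk_continuous f K x s : continuous f -> {for s, continuous K} ->
  {for s, continuous (diffk f K x)}.
Proof.
move=> cf cK; apply: cvgM; last exact: cK.
apply: cvgB.
- have := @continuous_affine _ (-1) x _ cf s.
  rewrite [X in continuous_at _ X](_ : _ = fun s => f (x - s))//.
  by apply/funext => y; rewrite mulN1r addrC.
- have := @continuous_affine _ 1 x _ cf s.
  rewrite [X in continuous_at _ X](_ : _ = fun s => f (x + s))//.
  by apply/funext => y; rewrite mul1r addrC.
Qed.

Lemma diffk_tame a f K l x : 0 <= l -> lip l f -> kernel a K ->
  tame 0 a (diffk f K x) (8 * l).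
Proof.
move=> l0 lf kK s sa; have [cK Ks] := kK s sa; have /andP[s0 _] := sa.
split; first by apply: diffk_continuous => //; exact: lip_continuous lf.
rewrite /diffk normrM; apply: (@le_trans _ _ (l * (2 * s) * `|K s|)).
  rewrite ler_wpM2r// (le_trans (lf _ _))//.
  have -> : x - s - (x + s) = - (2 * s) by ring.
  by rewrite normrN ger0_norm// mulr_ge0// ltW.
move: Ks; rewrite normrM (gtr0_norm s0) => Ks.
rewrite (_ : l * (2 * s) * `|K s| = 2 * l * (s * `|K s|)); last by ring.
by rewrite (_ : 8 * l = 2 * l * 4); [rewrite ler_wpM2l// mulr_ge0|ring].
Qed.

Lemma norm_conjk_le a f K l x : 0 <= a -> 0 <= l -> lip l f -> kernel a K ->
  `|conjk a f K x| <= 8 * l * a.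
Proof.
move=> a0 l0 lf kK; rewrite /conjk normrM.
have := norm_roint_le a0 (diffk_tame x l0 lf kK); rewrite subr0 => H.
apply: (@le_trans _ _ (1 * (8 * l * a))); last by rewrite mul1r.
have pi0 := @pi_gt0 R; rewrite ler_pM// gtr0_norm ?invr_gt0// invf_le1//.
by rewrite (le_trans _ (pi_ge2 R))// ler1n.
Qed.

Lemma conjkB a f g K l k x : 0 <= l -> 0 <= k -> lip l f -> lip k g ->
  kernel a K -> conjk a (fun t => f t - g t) K x = conjk a f K x - conjk a g K x.
Proof.
move=> l0 k0 lf lg kK; rewrite /conjk -mulrBr; congr (_ * _).
rewrite -(rointB (diffk_tame x l0 lf kK) (diffk_tame x k0 lg kK)).
by apply: eq_roint => s _; rewrite /diffk; ring.
Qed.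

Lemma quarter_le_sin x : 0 <= x <= pi / 2 -> x / 4 <= sin x.
Proof.
move=> /andP[x0 xpi]; pose z := x / 2.
have z0 : 0 <= z by rewrite /z divr_ge0.
have z1 : z <= 1.
  by rewrite ler_pdivrMr// mul1r (le_trans xpi)// ltW// pihalf_lt2.
have -> : x = z *+ 2 by rewrite /z mulr2n -splitr.
have h1 : z / 2 <= sin z.
  have := norm_sin_sub_le z; rewrite ler_norml (ger0_norm z0) => /andP[h _].
  have : z ^+ 3 <= z by rewrite exprSr ler_piMl// expr_le1.
  by lra.
have h2 : 2^-1 <= cos z.
  have : z ^+ 2 <= 1 by rewrite expr_le1.
  by have := onem_cos_le z; lra.
rewrite sin_mulr2n -mulr_natr.
have : z / 2 * 2^-1 <= cos z * sin z.
  by rewrite mulrC ler_pM// ?invr_ge0// divr_ge0.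
by lra.
Qed.

(* [cot (s / 2)] dilated by [L] *)
Definition cotk (L s : R) : R := cos (s / (2 * L)) / sin (s / (2 * L)) / (2 * L).

Lemma cotk_sin L s : 0 < L -> 0 < s <= pi * L ->
  0 < s / (2 * L) <= pi / 2 /\ 0 < sin (s / (2 * L)).
Proof.
move=> L0 /andP[s0 sL]; have h : 0 < s / (2 * L) <= pi / 2.
  rewrite divr_gt0 ?mulr_gt0//= ler_pdivrMr ?mulr_gt0//.
  by rewrite (_ : pi / 2 * (2 * L) = pi * L)//; field.
split=> //; have /andP[h1 h2] := h.
rewrite (lt_le_trans _ (quarter_le_sin _))// ?divr_gt0 ?mulr_gt0//.
by rewrite (ltW h1) h2.
Qed.

Lemma cotk_kernel L : 0 < L -> kernel (pi * L) (cotk L).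
Proof.
move=> L0 s sL; have [/andP[u0 upi] su] := cotk_sin L0 sL.
have L2 : 0 < 2 * L by rewrite mulr_gt0.
split.
  have cu : {for s, continuous (fun s => s / (2 * L))}.
    by apply: cvgM; [exact: cvg_id|exact: cvg_cst].
  apply: cvgM; last exact: cvg_cst.
  apply: cvgM.
    by apply: continuous_comp => //; exact: continuous_cos.
  apply: cvgV; first by rewrite gt_eqF.
  by apply: continuous_comp => //; exact: continuous_sin.
rewrite /cotk; set u := s / (2 * L) in u0 upi su *.
rewrite (_ : s * _ = u * (cos u / sin u)); last by rewrite /u; ring.
move: u0 upi su; move: u => u u0 upi su.
rewrite normrM normf_div (gtr0_norm u0) (gtr0_norm su) mulrA ler_pdivrMr//.
have : u * `|cos u| <= u by rewrite ler_piMr ?(ltW u0)// cos_max.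
have : u / 4 <= sin u by rewrite quarter_le_sin// (ltW u0).
by lra.
Qed.

Lemma cotk_sub_le L s : 0 < L -> 0 < s <= pi * L ->
  `|s * (cotk L s - s^-1)| <= (s / L) ^+ 2.
Proof.
move=> L0 sL; have [/andP[u0 upi] su] := cotk_sin L0 sL.
have [s0 _] := andP sL.
rewrite /cotk; set u := s / (2 * L) in u0 upi su *.
have -> : s * (cos u / sin u / (2 * L) - s^-1) = (u * (cos u - 1) + (u - sin u)) / sin u.
  transitivity (u * (cos u / sin u) - 1); last by field; rewrite gt_eqF.
  rewrite mulrBr divff ?gt_eqF//; congr (_ - 1); rewrite /u; ring.
have -> : s / L = 2 * u by rewrite /u; field; rewrite gt_eqF.
rewrite normrM normfV (gtr0_norm su) ler_pdivrMr//.
have h1 : `|u * (cos u - 1)| <= u ^+ 3 / 2.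
  rewrite normrM (gtr0_norm u0) distrC (ger0_norm (onem_cos_ge0 u)).
  by rewrite exprS -mulrA ler_wpM2l ?(ltW u0)// onem_cos_le.
have h2 : `|u - sin u| <= u ^+ 3 / 2.
  by have := norm_sin_sub_le u; rewrite distrC (gtr0_norm u0).
have h3 : u / 4 <= sin u by rewrite quarter_le_sin// (ltW u0).
have h4 : (2 * u) ^+ 2 * (u / 4) <= (2 * u) ^+ 2 * sin u.
  by rewrite ler_wpM2l// sqr_ge0.
rewrite (le_trans (ler_normD _ _))// (le_trans (lerD h1 h2))// (le_trans _ h4)//.
by rewrite (_ : _ * (u / 4) = u ^+ 3 / 2 + u ^+ 3 / 2)//; field.
Qed.

Lemma inv_kernel a : kernel a (fun s => s^-1).
Proof.
move=> s /andP[s0 _]; split; last by rewrite divff ?gt_eqF// normr1 ler1n.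
by apply: cvgV; [rewrite gt_eqF|exact: cvg_id].
Qed.

(** The Dirichlet kernel again, now dilated; unlike the statement for [pv_torus], the formula holds
    at every real [x]. *)
Lemma conjk_wave L n a x : 0 < L ->
  conjk (pi * L) (fun t => cos_wave n a (t / L) 0) (cotk L) x =
  sin_wave n a (x / L) 0.
Proof.
move=> L0; have L2 : 0 < 2 * L by rewrite mulr_gt0.
have cD := @continuous_dirichlet R n; have pi0 := @pi_gt0 R.
pose D t := dirichlet n (L^-1 * t + 0).
have cD' : continuous D by exact: continuous_affine.
transitivity (pi^-1 * roint 0 (pi * L)
    (fun s => sin_wave n a (x / L) 0 * (L^-1 * D s))).
  congr (_ * _); apply: eq_roint => s sL.
  have [_ su] := cotk_sin L0 sL.
  rewrite /diffk [(x - s) / L]mulrBl [(x + s) / L]mulrDl cos_wave_sub /cotk.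
  have -> : s / (2 * L) = s / L / 2 by field; rewrite gt_eqF.
  rewrite /D addr0 [L^-1 * s]mulrC.
  have sn : sin (s / L / 2) != 0.
    by rewrite (_ : s / L / 2 = s / (2 * L)) ?gt_eqF//; field; rewrite gt_eqF.
  have -> : dirichlet n (s / L) = sin (n%:R * (s / L)) * cos (s / L / 2) / sin (s / L / 2).
    by rewrite -dirichletE mulfK.
  by move: sn; set v := s / L; clearbody v => sn; field; rewrite sn gt_eqF.
have cD1 : continuous (fun s => L^-1 * D s).
  by move=> s; apply: cvgM; [exact: cvg_cst|exact: cD'].
rewrite roint_rint; last by move=> s; apply: cvgM; [exact: cvg_cst|exact: cD1].
rewrite rintZ// rintZ// rint_affine_gt0 ?mulr_ge0 ?invr_gt0 ?(ltW pi0) ?(ltW L0)//.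
rewrite mulr0 !addr0 (_ : L^-1 * (pi * L) = pi); last by field; rewrite gt_eqF.
case: n {cD D cD' cD1} => [|n]; first by rewrite /sin_wave eqxx mul0r mulr0.
by rewrite rint_dirichlet mulrCA mulVf ?mulr1// gt_eqF.
Qed.

End singular_integrals.

(** * Test functions and the principal value on the line *)

Section test_functions.
Context {R : realType}.
Implicit Types (f df : R -> R) (l M e x Y s t : R).

Definition bump f df l M := [/\ 0 <= l /\ 1 <= M, forall t, M <= `|t| -> f t = 0,
  forall t, is_derive t 1 f (df t), forall t, `|df t| <= l & lip l df].

Lemma lip_derive f df l : (forall t, is_derive t 1 f (df t)) ->
  (forall t, `|df t| <= l) -> lip l f.
Proof.
move=> dfE dfl.
have H u v : u <= v -> `|f v - f u| <= l * `|v - u|.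
  move=> uv.
  have cf : {within `[u, v], continuous f}.
    by apply: derivable_within_continuous => y _; have [] := dfE y.
  have [y _ ->] := MVT_segment uv (fun y _ => dfE y) cf.
  by rewrite normrM ler_wpM2r.
move=> u v; have [/H|/ltW/H//] := leP u v.
by rewrite distrC [`|v - u|]distrC.
Qed.

Lemma derive_outside f df M : (forall t, M < `|t| -> f t = 0) ->
  (forall t, is_derive t 1 f (df t)) -> forall t, M < `|t| -> df t = 0.
Proof.
move=> f0 dfE t Mt.
have nf : \near t, f t = (fun=> 0) t.
  have ct : `|s| @[s --> t] --> `|t| by apply: cvg_norm; exact: cvg_id.
  have H : \forall s \near t, M < `|s| by exact: cvgr_gt ct M Mt.
  by apply: filterS H => s; exact: f0.
have [_ <-] := dfE t; rewrite (near_eq_derive _ nf).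
exact: derive_cst.
Qed.

Lemma continuous_support_bounded f M : continuous f ->
  (forall t, M < `|t| -> f t = 0) -> exists2 l, 0 <= l & forall t, `|f t| <= l.
Proof.
move=> cf f0; have MM : - `|M| <= `|M| by rewrite lerNl (le_trans _ (normr_ge0 M))// oppr_le0.
have cn : {within `[- `|M|, `|M|], continuous (fun t => `|f t|)}.
  by apply: continuous_subspaceT => t; apply: cvg_norm; exact: cf.
have [c _ fc] := EVT_max MM cn.
exists `|f c| => // t.
have [tM|Mt] := leP `|t| `|M|; first by apply: fc; rewrite in_itv/= -ler_norml.
by rewrite f0 ?normr0// (le_lt_trans (ler_norm M)).
Qed.

Lemma test_function_bump f : test_function f -> exists df l M, bump f df l M.
Proof.
move=> [smooth [M f0]].
have d0 t : is_derive t 1 f (derive1n 1 f t).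
  by rewrite derive1n1 derive1E; apply: DeriveDef => //; exact: (smooth 0).
have d1 t : is_derive t 1 (derive1n 1 f) (derive1n 2 f t).
  by rewrite (derive1nS _ 1) derive1E; apply: DeriveDef => //; exact: (smooth 1%N).
have c n : continuous (derive1n n f).
  by move=> t; apply: differentiable_continuous; apply/derivable1_diffP; exact: smooth.
have f1 := derive_outside f0 d0; have f2 := derive_outside f1 d1.
have [l1 l10 b1] := continuous_support_bounded (c 1%N) f1.
have [l2 l20 b2] := continuous_support_bounded (c 2%N) f2.
exists (derive1n 1 f), (Num.max l1 l2), (`|M| + 1); split => //.
- by rewrite le_max l10 lerDr.
- move=> t Mt; apply: f0; rewrite (lt_le_trans _ Mt)//.
  by rewrite (le_lt_trans (ler_norm M))// ltrDl.
- by move=> t; rewrite le_max b1.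
- by apply: lip_derive d1 _ => t; rewrite le_max b2 orbT.
Qed.

(* [s^-1], continuously truncated at distance [e] from the origin *)
Definition invk e s : R := s / Num.max (s ^+ 2) (e ^+ 2).

Lemma continuous_invk e : 0 < e -> continuous (invk e).
Proof.
move=> e0 s; have e2 : 0 < e ^+ 2 by rewrite exprn_gt0.
apply: cvgM; first exact: cvg_id.
apply: cvgV; first by rewrite gt_eqF// lt_max e2 orbT.
apply: (@continuous_max _ _ (fun s => s ^+ 2) (fun=> e ^+ 2)); last exact: cvg_cst.
exact: exprn_continuous.
Qed.

Lemma invkE e s : 0 < e -> e <= `|s| -> invk e s = s^-1.
Proof.
move=> e0 es; have s0 : s != 0 by rewrite -normr_gt0 (lt_le_trans e0).
rewrite /invk max_l; last by rewrite -[s ^+ 2]real_normK ?num_real// lerXn2r ?nnegrE ?(ltW e0).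
by rewrite expr2 invfM mulrA divff// mul1r.
Qed.

Lemma invkN e s : invk e (- s) = - invk e s.
Proof. by rewrite /invk sqrrN mulNr. Qed.

(** Beyond distance [Y] from [x] the function vanishes, so the integral is over two bounded
    intervals, which are folded about [x]. *)
Lemma pv_line_truncated f M x Y e : continuous f ->
  (forall t, M <= `|t| -> f t = 0) -> `|x| + M <= Y -> 0 < e -> e < Y ->
  (\int[lebesgue_measure]_(t in [set t | (e < `|x - t|)%R]) (f t / (x - t)))%R =
  roint e Y (diffk f (fun s => s^-1) x).
Proof.
move=> cf f0 xY e0 eY.
pose g t := f t * invk e (x - t).
have cI := continuous_invk e0.
have cg : continuous g.
  move=> t; apply: cvgM; first exact: cf.
  have := @continuous_affine _ (-1) x _ cI t.
  rewrite [X in continuous_at _ X](_ : _ = fun t => invk e (x - t))//.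
  by apply/funext => y; rewrite mulN1r addrC.
have cs (k c : R) : continuous (fun s => g (k * s + c)) by exact: continuous_affine.
transitivity (\int[lebesgue_measure]_(t in
    `[x - Y, x - e[%classic `|` `]x + e, x + Y]%classic) g t)%R.
  rewrite Rintegral_mkcond [RHS]Rintegral_mkcond; congr Rintegral.
  apply/funext => t; rewrite !patchE; case: ifPn => [|].
    rewrite inE/= => et; case: ifPn => [_|].
      by rewrite /g invkE// ltW.
    rewrite notin_setE/= !in_itv/= => tD; rewrite f0 ?mul0r//.
    have : Y <= `|x - t|.
      rewrite leNgt; apply/negP => tY; apply: tD.
      move: et tY; have [xt|tx] := leP 0 (x - t).
        by rewrite (ger0_norm xt) => h1 h2; left; apply/andP; split; lra.
      by rewrite (ltr0_norm tx) => h1 h2; right; apply/andP; split; lra.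
    by have := ler_normB x t; lra.
  rewrite notin_setE/= => et; case: ifPn => //.
  rewrite inE/= !in_itv/= => tD; exfalso; apply: et.
  case: tD => /andP[t1 t2]; first by rewrite gtr0_norm; lra.
  by rewrite ltr0_norm; lra.
rewrite Rintegral_setU//; last 2 first.
- apply: (integrableS _ _ _ (integrable_itv (x - Y) (x + Y) cg)) => //.
  + exact: measurableU.
  + move=> t /=; rewrite !in_itv/=.
    by move=> [|] /andP[h1 h2]; apply/andP; split; lra.
- apply/disj_setPRL => t /=; rewrite !in_itv/= => /andP[h1 h2] /andP[h3 h4].
  by lra.
rewrite !Rintegral_itv_cc//.
have -> : rint (x + e) (x + Y) g = rint e Y (fun s => g (s + x)).
  by rewrite rint_shift ?(ltW eY)// ![_ + x]addrC.
have -> : rint (x - Y) (x - e) g = rint e Y (fun s => g (- s + x)).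
  have cs1 : continuous (fun s => g (s + x)).
    by have := cs 1 x; under eq_fun do rewrite mul1r.
  rewrite (rint_opp (ltW eY) cs1) rint_shift ?lerN2 ?(ltW eY)//.
  by rewrite ![_ + x]addrC.
have cs1 : continuous (fun s => g (s + x)).
  by have := cs 1 x; under eq_fun do rewrite mul1r.
have csN : continuous (fun s => g (- s + x)).
  by have := cs (-1) x; under eq_fun do rewrite mulN1r.
rewrite -rintD// -roint_rint; last first.
  by move=> s; apply: cvgD; [exact: csN|exact: cs1].
apply: eq_roint => s /andP[es _]; rewrite /g /diffk.
have -> : x - (- s + x) = s by ring.
have -> : x - (s + x) = - s by ring.
rewrite invkN invkE//; last by rewrite gtr0_norm ?(ltW es)// (lt_trans e0).
by rewrite [- s + x]addrC [s + x]addrC; ring.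
Qed.

(** The folded integrand is at most [8 * l], so before division by pi the truncation at [e] changes
    the integral by at most [8 * l * e]. *)
Lemma pv_lineE f l M x Y : 0 <= l -> lip l f ->
  (forall t, M <= `|t| -> f t = 0) -> `|x| + M <= Y -> 0 < Y ->
  pv_line f x = conjk Y f (fun s => s^-1) x.
Proof.
move=> l0 lf f0 xY Y0; have cf := lip_continuous lf.
pose h := diffk f (fun s => s^-1) x.
have th a b : 0 <= a -> tame a b h (8 * l).
  move=> a0; apply: tame_sub a0 (lexx b) _.
  exact: (diffk_tame x l0 lf (@inv_kernel R b)).
apply: cvg_lim; first exact: Rhausdorff.
apply: (@cvg_trans _ ((fun e => pi^-1 * roint e Y h) @ 0^'+)).
  apply: near_eq_cvg; near=> e.
  have eY : e < Y by near: e; exact: nbhs_right_lt.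
  by rewrite (pv_line_truncated cf f0 xY).
apply: cvgM; first exact: cvg_cst.
have l1 : 0 < 8 * l + 1 by rewrite ltr_wpDl// mulr_ge0.
apply/cvgrPdist_le => d d0; near=> e.
have e0 : 0 < e by [].
have eY : e <= Y by near: e; exact: nbhs_right_le.
rewrite (roint_split (ltW e0) eY (th 0 Y (lexx 0))) addrK.
rewrite (le_trans (norm_roint_le (ltW e0) (th 0 e (lexx 0))))// subr0.
apply: (@le_trans _ _ ((8 * l + 1) * e)); first by rewrite ler_wpM2r ?(ltW e0)// lerDl.
rewrite mulrC -ler_pdivlMr//; near: e; apply: nbhs_right_le.
by rewrite divr_gt0.
Unshelve. all: by end_near. Qed.

End test_functions.

(** * Periodic models of a test function *)

Section dilated_conjugate.
Context {R : realType}.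
Implicit Types (f g df : R -> R) (l k M L T e x Y s t u v : R).

Lemma conjkD a f g K l k x : 0 <= l -> 0 <= k -> lip l f -> lip k g ->
  kernel a K -> conjk a (fun t => f t + g t) K x = conjk a f K x + conjk a g K x.
Proof.
move=> l0 k0 lf lg kK; rewrite /conjk -mulrDr; congr (_ * _).
rewrite -(rointD (diffk_tame x l0 lf kK) (diffk_tame x k0 lg kK)).
by apply: eq_roint => s _; rewrite /diffk; ring.
Qed.

Lemma conjkZ a c f K l x : 0 <= l -> lip l f ->
  kernel a K -> conjk a (fun t => c * f t) K x = c * conjk a f K x.
Proof.
move=> l0 lf kK; rewrite /conjk mulrCA -(rointZ c (diffk_tame x l0 lf kK)).
by congr (_ * _); apply: eq_roint => s _; rewrite /diffk; ring.
Qed.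

Lemma lip_sin : lip 1 (@sin R).
Proof. by apply: (@lip_derive _ sin cos) => t; exact: cos_max. Qed.

Lemma lip_cos : lip 1 (@cos R).
Proof.
apply: (@lip_derive _ cos (fun t => - sin t)) => t.
by rewrite normrN sin_max.
Qed.

Lemma lip_wave n a : lip n%:R (fun t : R => cos_wave n a t 0).
Proof.
move=> u v; rewrite /cos_wave mulr0 oppr0 expR0 !mul1r.
rewrite (le_trans (lip_cos _ _))// mul1r opprD addrACA subrr addr0 -mulrBr.
by rewrite normrM ger0_norm.
Qed.

(** Turns the abstract conjugate into an integral at every point. The Lipschitz bound is carried
    through the induction because linearity of [conjk] needs it. *)
Lemma conj_pair_conjk L f g : 0 < L -> conj_pair f g ->
  (exists2 l, 0 <= l & lip l (fun t => f (t / L))) /\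
  forall x, conjk (pi * L) (fun t => f (t / L)) (cotk L) x = g (x / L).
Proof.
move=> L0; have kL := cotk_kernel L0.
elim=> {f g} [n a|f1 g1 f2 g2 _ [[l l0 H1] E1] _ [[k k0 H2] E2]|c f g _ [[l l0 H] E]].
- split; last by move=> x; exact: conjk_wave.
  exists (n%:R / L); first by rewrite divr_ge0// ltW.
  move=> u v; rewrite (le_trans (lip_wave _ _ _ _))//.
  by rewrite -mulrBl normrM (gtr0_norm (x := L^-1)) ?invr_gt0// mulrAC mulrA.
- split.
    exists (l + k); first by rewrite addr_ge0.
    move=> u v; rewrite opprD addrACA mulrDl (le_trans (ler_normD _ _))//.
    by apply: lerD; [exact: H1|exact: H2].
  by move=> x; rewrite (conjkD _ l0 k0 H1 H2 kL) E1 E2.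
- split.
    exists (`|c| * l); first by rewrite mulr_ge0.
    move=> u v; rewrite -mulrBr normrM -mulrA ler_wpM2l//; exact: H.
  by move=> x; rewrite (conjkZ _ _ l0 H kL) E.
Qed.

Lemma quarter_le_norm_sin u : `|u| <= pi / 2 -> `|u| / 4 <= `|sin u|.
Proof.
have H v : 0 <= v -> v <= pi / 2 -> v / 4 <= `|sin v|.
  move=> v0 vpi; apply: le_trans (ler_norm _).
  by apply: quarter_le_sin; rewrite v0.
have [u0|u0] := leP 0 u; first by rewrite ger0_norm//; exact: H.
rewrite ltr0_norm// => upi; rewrite -normrN -sinN; apply: H => //.
by rewrite oppr_ge0 ltW.
Qed.

Section bump.
Variables (f df : R -> R) (l M : R).
Hypothesis bf : bump f df l M.

Lemma bump_lip : lip l f.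
Proof. by case: bf => _ _ d0 d1 _; exact: lip_derive d0 d1. Qed.

Lemma bump_le t : `|f t| <= 2 * l * M.
Proof.
case: bf => -[l0 M1] f0 _ _ _; have M0 : 0 <= M by exact: le_trans M1.
have [Mt|tM] := leP M `|t|; first by rewrite f0// normr0 !mulr_ge0.
have fM : f M = 0 by apply: f0; rewrite ger0_norm.
have := bump_lip t M; rewrite fM subr0 => /le_trans; apply.
rewrite [2 * l]mulrC -mulrA ler_wpM2l// (le_trans (ler_normB _ _))//.
by rewrite (ger0_norm M0) mulr_natl mulr2n lerD2r ltW.
Qed.

Definition dil L t := f (L * sin (t / L)).

Lemma norm_divL L u : 0 < L -> `|u / L| = `|u| / L.
Proof. by move=> L0; rewrite normrM (gtr0_norm (x := L^-1))// invr_gt0. Qed.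

Lemma lip_dil L : 0 < L -> lip l (dil L).
Proof.
move=> L0 u v; have [[l0 _] _ _ _ _] := bf.
rewrite (le_trans (bump_lip _ _))// ler_wpM2l// -mulrBr normrM (gtr0_norm L0).
rewrite (le_trans (ler_wpM2l (ltW L0) (lip_sin _ _)))// mul1r -mulrBl norm_divL//.
by rewrite mulrCA divff ?mulr1// gt_eqF.
Qed.

(** Between the bump at 0 and its mirror image at [pi * L], the bound [|sin u| >= |u| / 4], used
    from either side, gives [|L sin (t / L)| >= M]. *)
Lemma dil_far L t : 0 < L -> 4 * M <= `|t| -> `|t| <= pi * L - 4 * M -> dil L t = 0.
Proof.
move=> L0 Mt tL; have [[_ M1] f0 _ _ _] := bf; apply: f0.
rewrite normrM (gtr0_norm L0) mulrC -ler_pdivrMr//.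
have uE := norm_divL t L0; set u := t / L in uE *.
have M4 : M / L <= `|u| / 4.
  by rewrite uE -mulrA [L^-1 / 4]mulrC mulrA ler_pM2r ?invr_gt0// ler_pdivlMr// mulrC.
have [upi|piu] := leP `|u| (pi / 2).
  by rewrite (le_trans M4)// quarter_le_norm_sin.
have upi : M / L <= (pi - `|u|) / 4.
  rewrite uE (_ : pi - _ = (pi * L - `|t|) / L); last by field; rewrite gt_eqF.
  by rewrite -mulrA [L^-1 / 4]mulrC mulrA ler_pM2r ?invr_gt0// ler_pdivlMr// mulrC; lra.
have M0 : 0 <= M / L by rewrite divr_ge0 ?(ltW L0)// (le_trans _ M1).
have -> : `|sin u| = `|sin (pi - `|u|)|.
  by rewrite addrC sinDpi sinN opprK; case: (ger0P u) => _ //;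
    rewrite sinN normrN.
have h0 : 0 <= pi - `|u| by lra.
rewrite (le_trans upi)// -{1}(ger0_norm h0) quarter_le_norm_sin// ger0_norm//; lra.
Qed.

Lemma dil_sub_le L t : 0 < L -> `|L * sin (t / L) - t| <= `|t| ^+ 3 / (2 * L ^+ 2).
Proof.
move=> L0; have -> : L * sin (t / L) - t = L * (sin (t / L) - t / L).
  by rewrite mulrBr [L * (t / L)]mulrCA divff ?mulr1// gt_eqF.
rewrite normrM (gtr0_norm L0) (le_trans (ler_wpM2l (ltW L0) (norm_sin_sub_le _)))//.
rewrite norm_divL// le_eqVlt; apply/predU1P; left; field.
by rewrite gt_eqF.
Qed.

(** Mean value theorem: in the derivative of [dil L - f], the factor [cos (t / L)] accounts for
    [T ^+ 2] and the displaced argument of [df] for [T ^+ 3]. *)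
Lemma dil_near L T u v : 0 < L -> `|u| <= T -> `|v| <= T ->
  `|(dil L u - f u) - (dil L v - f v)| <=
  l * (T ^+ 2 + T ^+ 3) / (2 * L ^+ 2) * `|u - v|.
Proof.
move=> L0; have [[l0 _] _ d0 d1 d2] := bf.
have dr t : is_derive t 1 (fun t => dil L t - f t)
    (df (L * sin (t / L)) * cos (t / L) - df t).
  apply: is_deriveB.
  have dsin : is_derive t 1 (fun t => L * sin (L^-1 * t + 0)) (L * (L^-1 * cos (t / L))).
    apply: is_deriveZ; apply: is_derive_affine; rewrite addr0 mulrC.
    exact: is_derive_sin.
  have E : (fun t => L * sin (L^-1 * t + 0)) = (fun t => L * sin (t / L)).
    by apply/funext => w; rewrite addr0 mulrC [L^-1 * w]mulrC mulrC.
  rewrite E mulrA divff ?mul1r ?gt_eqF// in dsin.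
  exact: is_derive1_comp.
have db t : `|t| <= T -> `|df (L * sin (t / L)) * cos (t / L) - df t| <=
    l * (T ^+ 2 + T ^+ 3) / (2 * L ^+ 2).
  move=> tT; have T0 : 0 <= T by exact: le_trans tT.
  rewrite (_ : _ - df t = - (df (L * sin (t / L)) * (1 - cos (t / L))) +
    (df (L * sin (t / L)) - df t)); last by ring.
  rewrite (le_trans (ler_normD _ _))// normrN normrM (ger0_norm (onem_cos_ge0 _)).
  rewrite (_ : l * _ / _ = l * (T ^+ 2 / (2 * L ^+ 2)) + l * (T ^+ 3 / (2 * L ^+ 2)));
    last by ring.
  rewrite lerD//.
    rewrite ler_pM ?onem_cos_ge0// (le_trans (onem_cos_le _))//.
    rewrite -[(t / L) ^+ 2]real_normK ?num_real// norm_divL// expr_div_n -mulrA.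
    rewrite (_ : T ^+ 2 / (2 * L ^+ 2) = T ^+ 2 * (L ^- 2 / 2)); last first.
      by field; rewrite gt_eqF.
    rewrite ler_wpM2r ?mulr_ge0 ?invr_ge0 ?exprn_ge0 ?(ltW L0)//.
    by rewrite lerXn2r ?nnegrE.
  rewrite (le_trans (d2 _ _))// ler_wpM2l// (le_trans (dil_sub_le _ L0))//.
  rewrite ler_wpM2r ?invr_ge0 ?mulr_ge0 ?exprn_ge0 ?(ltW L0)//.
  by rewrite lerXn2r ?nnegrE.
wlog uv : u v / v <= u.
  move=> hw; have [/hw//|/ltW/hw h] := leP v u.
  by move=> u1 v1; rewrite distrC [`|u - v|]distrC; exact: h.
move=> uT vT.
have cr : {within `[v, u], continuous (fun t => dil L t - f t)}.
  by apply: derivable_within_continuous => y _; have [] := dr y.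
have [y /[!in_itv]/= /andP[vy yu] ->] := MVT_segment uv (fun y _ => dr y) cr.
rewrite normrM ler_wpM2r//; apply: db; move: uT vT; rewrite !ler_norml.
by move=> /andP[_ h1] /andP[h2 _]; rewrite (le_trans h2)//= (le_trans yu).
Qed.

(** For [s] between [reach x] and [pi * L - reach x], both [x - s] and [x + s] lie where [dil_far]
    applies. *)
Definition reach x : R := `|x| + 4 * M + 1.

Definition near_const x : R := l * ((`|x| + reach x) ^+ 2 + (`|x| + reach x) ^+ 3).

Lemma conjk_dil_near x L s : 1 <= L -> 2 * reach x <= L -> 0 < s <= reach x ->
  `|diffk (dil L) (cotk L) x s - diffk f (fun s => s^-1) x s| <=
  (4 * near_const x + 2 * l * reach x ^+ 2) / L ^+ 2.
Proof.
move=> L1 YL sY; have L0 : 0 < L by exact: lt_le_trans L1.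
have [s0 sY'] := andP sY; have [[l0 M1] _ _ _ _] := bf.
have sL : 0 < s <= pi * L.
  rewrite s0/= (le_trans sY')// (@le_trans _ _ L)//.
    by have Y0 := le_trans (ltW s0) sY'; lra.
  by rewrite ler_peMl ?(ltW L0)// (le_trans _ (pi_ge2 R))// ler1n.
have [_ K4] := cotk_kernel L0 sL; have K1 := cotk_sub_le L0 sL.
pose T := `|x| + reach x.
have T1 : `|x - s| <= T by rewrite (le_trans (ler_normB _ _))// lerD2l gtr0_norm.
have T2 : `|x + s| <= T by rewrite (le_trans (ler_normD _ _))// lerD2l gtr0_norm.
have xs : `|x - s - (x + s)| = 2 * s.
  by rewrite (_ : x - s - (x + s) = - (2 * s)); [rewrite normrN gtr0_norm ?mulr_gt0|ring].
pose A := (dil L (x - s) - f (x - s)) - (dil L (x + s) - f (x + s)).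
pose B := f (x - s) - f (x + s).
have hA : `|A| <= l * (T ^+ 2 + T ^+ 3) / (2 * L ^+ 2) * (2 * s).
  by rewrite -xs; exact: dil_near.
have hB : `|B| <= l * (2 * s) by rewrite -xs; exact: bump_lip.
have -> : diffk (dil L) (cotk L) x s - diffk f (fun s => s^-1) x s =
    A * cotk L s + B * (cotk L s - s^-1) by rewrite /diffk /A /B; ring.
rewrite (le_trans (ler_normD _ _))// [leRHS]mulrDl lerD// normrM.
  apply: (le_trans (ler_wpM2r (normr_ge0 _) hA)).
  move: K4; rewrite normrM (gtr0_norm s0) => K4.
  rewrite (_ : _ * (2 * s) * `|cotk L s| =
    near_const x / L ^+ 2 * (s * `|cotk L s|)); last first.
    by rewrite /near_const -/T; field; rewrite gt_eqF.
  rewrite (_ : 4 * near_const x / L ^+ 2 = near_const x / L ^+ 2 * 4); last by ring.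
  have T0 : 0 <= T by exact: le_trans T1.
  rewrite ler_wpM2l// /near_const -/T mulr_ge0 ?invr_ge0 ?exprn_ge0 ?(ltW L0)//.
  by rewrite mulr_ge0// addr_ge0 ?exprn_ge0.
apply: (le_trans (ler_wpM2r (normr_ge0 _) hB)).
move: K1; rewrite normrM (gtr0_norm s0) => K1.
rewrite (_ : l * (2 * s) * _ = 2 * l * (s * `|cotk L s - s^-1|)); last by ring.
rewrite -[leRHS]mulrA ler_wpM2l ?mulr_ge0// (le_trans K1)// expr_div_n.
rewrite ler_wpM2r ?invr_ge0 ?exprn_ge0 ?(ltW L0)// lerXn2r ?nnegrE ?(ltW s0)//.
exact: le_trans (ltW s0) _.
Qed.

Definition dil_const x : R :=
  (4 * near_const x + 2 * l * reach x ^+ 2) * reach x + 16 * l * M * reach x.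

(** Three ranges of [s]. Up to [reach x] the integrand is close to that of [pv_line]; in the middle
    it vanishes; on the last stretch, of length [reach x], the mirrored bump is met, but there the
    kernel is at most [4 / L]. *)
Lemma conjk_dil_le x L : 1 <= L -> 2 * reach x <= L ->
  `|conjk (pi * L) (dil L) (cotk L) x - pv_line f x| <= dil_const x / L.
Proof.
move=> L1 YL; have L0 : 0 < L by exact: lt_le_trans L1.
have [[l0 M1] f0 _ _ _] := bf; have pi2 := pi_ge2 R.
have M0 : 0 <= M by exact: le_trans M1.
pose Y := reach x; have x0 := normr_ge0 x.
have YE : Y = `|x| + 4 * M + 1 by [].
have Y0 : 0 < Y by rewrite YE; lra.
have Yx : `|x| + M <= Y by rewrite YE; lra.
rewrite (pv_lineE l0 bump_lip f0 Yx Y0) /conjk -mulrBr normrM.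
have piL : 2 * L <= pi * L by rewrite ler_pM2r.
have kL := cotk_kernel L0; have tL := diffk_tame x l0 (lip_dil L0) kL.
have tf := diffk_tame x l0 bump_lip (@inv_kernel _ Y).
have YL' : 2 * Y <= L by [].
have Y1 : Y <= pi * L - Y by lra.
have Y2 : pi * L - Y <= pi * L by lra.
have Y3 : Y <= pi * L by lra.
set h := diffk _ _ _ in tL *; set h' := diffk _ _ _ in tf *.
rewrite (roint_split (ltW Y0) Y3 tL).
have tL2 : tame Y (pi * L) h (8 * l) by exact: tame_sub (ltW Y0) (lexx _) tL.
rewrite (roint_split Y1 Y2 tL2).
have -> : roint Y (pi * L - Y) h = 0.
  have t0 : tame Y (pi * L - Y) h 0.
    move=> s /andP[Ys sY]; have [|cs _] := tL s.
      by apply/andP; split; lra.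
    split=> //; rewrite /h /diffk.
    have xs : - `|x| <= x <= `|x| by rewrite -ler_norml.
    have [xs1 xs2] := andP xs.
    rewrite !dil_far ?subrr ?mul0r ?normr0//.
    - by rewrite ger0_norm; lra.
    - by rewrite ger0_norm; lra.
    - by rewrite ler0_norm; lra.
    - by rewrite ler0_norm; lra.
  have := norm_roint_le Y1 t0; rewrite mul0r => h0.
  by apply/eqP; rewrite -normr_le0.
rewrite add0r addrAC -(rointB (tame_sub (lexx 0) Y3 tL) tf).
have b1 : `|roint 0 Y (fun s => h s - h' s)| <=
    (4 * near_const x + 2 * l * Y ^+ 2) / L ^+ 2 * Y.
  rewrite -[X in _ <= _ * X]subr0; apply: norm_roint_le; first exact: ltW.
  move=> s sY; split; last exact: conjk_dil_near.
  have [s0 sY'] := andP sY.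
  have [|c1 _] := tL s; first by rewrite s0 (le_trans sY').
  by have [//|c2 _] := tf s; apply: cvgB.
have b2 : `|roint (pi * L - Y) (pi * L) h| <= 4 * l * M * (4 / L) * Y.
  rewrite [X in _ <= _ * X](_ : Y = pi * L - (pi * L - Y)); last by ring.
  apply: norm_roint_le => // s /andP[s1 s2].
  have s0 : 0 < s by lra.
  have sL : 0 < s <= pi * L by rewrite s0.
  have [cs _] := tL s sL; split=> //; rewrite /h /diffk normrM ler_pM//.
    rewrite (le_trans (ler_normB _ _))// (_ : 4 * l * M = 2 * l * M + 2 * l * M); last by ring.
    by apply: lerD; exact: bump_le.
  have [_] := kL s sL; rewrite normrM (gtr0_norm s0) mulrC -ler_pdivlMr// => /le_trans; apply.
  by rewrite ler_pM2l// lef_pV2 ?posrE//; lra.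
set r1 := roint 0 Y _ in b1 *; set r2 := roint _ _ h in b2 *.
have L2 : L ^- 2 <= L^-1.
  by rewrite lef_pV2 ?posrE ?exprn_gt0// expr2 ler_peMr// ltW.
have nc0 : 0 <= (4 * near_const x + 2 * l * Y ^+ 2) * Y.
  have nY : 0 <= Y by exact: ltW.
  have xY : 0 <= `|x| + reach x by exact: addr_ge0.
  rewrite mulr_ge0// addr_ge0 ?mulr_ge0 ?exprn_ge0//.
  exact: addr_ge0 (exprn_ge0 2 xY) (exprn_ge0 3 xY).
have b1' : `|r1| <= (4 * near_const x + 2 * l * Y ^+ 2) * Y / L.
  rewrite (le_trans b1)// mulrAC ler_wpM2l//.
have b12 : `|r1 + r2| <= dil_const x / L.
  rewrite (le_trans (ler_normD _ _))// (le_trans (lerD b1' b2))//.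
  rewrite /dil_const -/Y le_eqVlt; apply/predU1P; left; ring.
rewrite (le_trans _ b12)// ler_piMl//.
rewrite gtr0_norm ?invr_gt0 ?pi_gt0// invf_le1 ?pi_gt0// (le_trans _ pi2)//.
by rewrite ler1n.
Qed.

Lemma dil_poly_approx L e : 0 < L -> 0 < e -> exists q : {poly R},
  (forall t, `|dil L t - q.[sin (t / L)]| <= e) /\
  lip (e / L) (fun t => dil L t - q.[sin (t / L)]).
Proof.
move=> L0 e0; have [[l0 _] _ d0 _ d2] := bf.
have dphi u : is_derive u 1 (fun u => f (L * u)) (L * df (L * u)).
  have := @is_derive_affine _ L 0 f u (df (L * u)).
  rewrite addr0 => /(_ (d0 _)).
  by under eq_fun do rewrite addr0.
have lphi u v : `|L * df (L * u) - L * df (L * v)| <= L ^+ 2 * l * `|u - v|.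
  rewrite -mulrBr normrM (gtr0_norm L0) expr2 -!mulrA ler_pM2l//.
  rewrite (le_trans (d2 _ _))// -mulrBr normrM (gtr0_norm L0).
  by rewrite mulrCA.
have L2 : 0 <= L ^+ 2 * l by rewrite mulr_ge0 ?exprn_ge0 ?(ltW L0).
have [q [q1 q2]] := C1_poly_approx L2 e0 dphi lphi.
have sb u : -1 <= (sin u : R) <= 1 by rewrite -ler_norml sin_max.
exists q; split=> [t|u v]; first by rewrite distrC; exact: q1.
rewrite (_ : _ - (_ - _) = - ((q.[sin (u / L)] - f (L * sin (u / L))) -
  (q.[sin (v / L)] - f (L * sin (v / L))))); last by rewrite /dil; ring.
rewrite normrN.
rewrite (le_trans (q2 _ _ (sb _) (sb _)))// -mulrA ler_wpM2l ?(ltW e0)//.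
by rewrite (le_trans (lip_sin _ _))// mul1r -mulrBl norm_divL// mulrC.
Qed.

Definition approx_const x : R := dil_const x + 32.

(** The tolerance [L ^- 2] keeps the error integrated over length [pi * L] of order [1 / L]. Its
    Lipschitz constant [L ^- 2 / L] yields, by [norm_conjk_le], the bound [8 * pi * L ^- 2], below
    [32 / L]. *)
Lemma dil_approx L : 1 <= L -> exists q g,
  [/\ conj_pair (fun t => q.[sin t]) g,
      forall t, `|dil L t - q.[sin (t / L)]| <= L ^- 2 &
      forall x, 2 * reach x <= L -> `|g (x / L) - pv_line f x| <= approx_const x / L].
Proof.
move=> L1; have L0 : 0 < L by exact: lt_le_trans L1.
have [[l0 _] _ _ _ _] := bf.
have e0 : 0 < L ^- 2 by rewrite invr_gt0 exprn_gt0.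
have [q [q1 q2]] := dil_poly_approx L0 e0.
have [g qg] := conj_pair_poly q; exists q, g; split=> // x YL.
have [[k k0 lq] <-] := conj_pair_conjk L0 qg.
have kL := cotk_kernel L0; have lL := lip_dil L0.
have e1 : 0 <= L ^- 2 / L by rewrite divr_ge0 ?(ltW e0) ?(ltW L0).
have piL : 0 <= pi * L by rewrite mulr_ge0 ?pi_ge0 ?(ltW L0).
have := norm_conjk_le x piL e1 q2 kL.
rewrite (conjkB x l0 k0 lL lq kL) => b1.
have b2 := conjk_dil_le L1 YL.
have b1' : `|conjk (pi * L) (fun t => q.[sin (t / L)]) (cotk L) x -
    conjk (pi * L) (dil L) (cotk L) x| <= 32 / L.
  rewrite distrC (le_trans b1)//.
  rewrite (_ : 8 * (L ^- 2 / L) * (pi * L) = 8 * pi * L ^- 2); last first.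
    by field; rewrite gt_eqF.
  rewrite ler_pM ?mulr_ge0 ?pi_ge0 ?(ltW e0)//.
    by have := @pihalf_lt2 R; lra.
  by rewrite lef_pV2 ?posrE ?exprn_gt0// expr2 ler_peMr// ltW.
rewrite (_ : approx_const x / L = 32 / L + dil_const x / L); last first.
  by rewrite /approx_const; ring.
rewrite (le_trans _ (lerD b1' b2))//.
by rewrite (le_trans _ (ler_normD _ _))// addrA subrK.
Qed.

Lemma dil_central L t : 0 < L -> `|t| <= pi * L / 2 ->
  `|dil L t - f t| <= 32 * l * M ^+ 3 / L ^+ 2.
Proof.
move=> L0 tL; have [[l0 M1] f0 _ _ _] := bf.
have M0 : 0 <= M by exact: le_trans M1.
have [tM|Mt] := leP `|t| (4 * M).
  rewrite (le_trans (bump_lip _ _))//.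
  rewrite (le_trans (ler_wpM2l l0 (dil_sub_le _ L0)))//.
  rewrite (_ : 32 * l * M ^+ 3 / L ^+ 2 = l * ((4 * M) ^+ 3 / (2 * L ^+ 2))); last first.
    by field; rewrite gt_eqF.
  rewrite ler_wpM2l// ler_wpM2r ?invr_ge0 ?mulr_ge0 ?exprn_ge0 ?(ltW L0)//.
  by rewrite lerXn2r ?nnegrE// mulr_ge0.
rewrite /dil !f0 ?subrr ?normr0 ?divr_ge0 ?mulr_ge0 ?exprn_ge0 ?(ltW L0)//.
- by lra.
- rewrite normrM (gtr0_norm L0) mulrC -ler_pdivrMr//.
  have tpi : `|t / L| <= pi / 2.
    by rewrite norm_divL// ler_pdivrMr// mulrAC.
  rewrite (le_trans _ (quarter_le_norm_sin tpi))// norm_divL//.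
  by rewrite mulrAC ler_pM2r ?invr_gt0// ler_pdivlMr// mulrC ltW.
Qed.

End bump.

End dilated_conjugate.

Lemma cvg_harmonic_rate (R : realType) (X : normedModType R) (u : nat -> X)
    (l : X) (a c : R) :
  (forall m, a <= m.+1%:R -> `|u m - l| <= c / m.+1%:R) -> u m @[m --> \oo] --> l.
Proof.
move=> H; apply/cvgrPdist_le => e e0.
have h1 := nbhs_infty_ger a; have h2 := nbhs_infty_ger (c / e).
apply: filterS2 h1 h2 => m am cm.
have m1 : m%:R <= m.+1%:R :> R by rewrite ler_nat.
rewrite distrC (le_trans (H m (le_trans am m1)))//.
by rewrite ler_pdivrMr ?ltr0n// mulrC -ler_pdivrMr// (le_trans cm).
Qed.

(** * Passage to the limit on the line *)

Section fatou_norm.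
Context {R : realType} {X : normedModType R}.
Variables (p : R) (p1 : 1 <= p).

Lemma fatou_norm (V : nat -> R -> X) (A : nat -> R) (H : R -> X) (b c : R) :
  (forall m, continuous (V m)) -> (forall m, m%:R <= A m) ->
  (forall y, V m y @[m --> \oo] --> H y) ->
  (forall m, rint (- A m) (A m) (fun y => `|V m y| `^ p) <= b + c / m.+1%:R) ->
  (\int[lebesgue_measure]_y (`|H y| `^ p)%:E <= b%:E)%E.
Proof.
move=> cV mA VH Vb.
pose f m := (fun y => (`|V m y| `^ p)%:E) \_ `[- A m, A m] : R -> \bar R.
have cVp m : continuous (fun y => `|V m y| `^ p) by exact: continuous_norm_powR.
have mf m : measurable_fun setT (f m).
  apply/(measurable_restrictT _ _).1; first exact: measurable_itv.
  apply: measurableT_comp => //; apply: measurable_funTS.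
  exact: continuous_measurable_fun.
have f0 m y : setT y -> (0 <= f m y)%E.
  by move=> _; rewrite /f patchE; case: ifP => // _; rewrite lee_fin powR_ge0.
have fH y : limn_einf (fun m => f m y) = (`|H y| `^ p)%:E.
  apply: (cvg_limn_einf_sup _).1.
  apply: (@cvg_trans _ ((fun m => (`|V m y| `^ p)%:E) @ \oo)).
    apply: near_eq_cvg; have := nbhs_infty_ger `|y|; apply: filterS => m ym.
    rewrite /f patchE; case: ifPn => //.
    by rewrite notin_setE/= in_itv/= -ler_norml (le_trans ym).
  apply: cvg_EFin; first by apply: nearW.
  have ch := @continuous_norm_powR R R^o p id p1 (fun x => @cvg_id _ _).
  have -> : fine \o (fun m => (`|V m y| `^ p)%:E) =
      (fun r : R => `|r| `^ p) \o (fun m => `|V m y|).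
    by apply/funext => m /=; rewrite normr_id.
  have := ch `|H y|; rewrite /continuous_at normr_id => chH.
  exact: cvg_comp (cvg_norm (VH y)) chH.
have -> : (\int[lebesgue_measure]_y (`|H y| `^ p)%:E =
    \int[lebesgue_measure]_y limn_einf (fun m => f m y))%E.
  by apply: eq_integral => y _; rewrite fH.
apply: le_trans.
  exact: (@fatou _ (measurableTypeR R) R lebesgue_measure setT measurableT f mf f0).
apply/lee_addgt0Pr => e e0; rewrite limn_einf_lim.
apply: lime_le; first exact: is_cvg_einfs.
have h := nbhs_infty_ger (c / e); apply: filterS h => m cm.
apply: (@le_trans _ _ (\int[lebesgue_measure]_y f m y)%E).
  by apply: ereal_inf_lbound; exists m => /=.
rewrite /f -integral_mkcond rint_EFin// -EFinD lee_fin (le_trans (Vb m))// lerD2l.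
rewrite ler_pdivrMr ?ltr0n// mulrC -ler_pdivrMr// (le_trans cm)//.
by rewrite ler_nat.
Qed.

End fatou_norm.

Section half_period.
Context {R : realType}.
Implicit Types f g h : R -> R.

Lemma rint_half_period h : continuous h -> (forall t, h (t + pi *+ 2) = h t) ->
  (forall t, h (pi - t) = h t) ->
  rint (- pi) pi h = 2 * rint (- (pi / 2)) (pi / 2) h.
Proof.
move=> ch hT hS; have pi0 := @pi_gt0 R.
have h0 : - (pi / 2) <= pi / 2 :> R by lra.
have h1 : pi / 2 <= 3 * (pi / 2) :> R by lra.
have := @rint_periodic R (pi *+ 2) (- pi) (- (pi / 2)) h ch pi2_ge0 hT.
have -> : - pi + pi *+ 2 = pi :> R by rewrite mulr2n addrA addNr add0r.
have -> : - (pi / 2) + pi *+ 2 = 3 * (pi / 2) :> R by rewrite pi2E; field.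
move=> ->; rewrite (rint_split h0 h1 ch) [RHS]mulr_natl [RHS]mulr2n; congr (_ + _).
have chp : continuous (fun u => h (u + pi)).
  by have := @continuous_affine R 1 pi h ch; under eq_fun do rewrite mul1r.
have -> : h = (fun t => h (- t + pi)) by apply/funext => t; rewrite addrC hS.
rewrite (rint_opp h1 chp) rint_shift//; last by lra.
have -> : - (3 * (pi / 2)) + pi = - (pi / 2) :> R by field.
have -> : - (pi / 2) + pi = pi / 2 :> R by field.
by congr rint; apply/funext => t; rewrite addrC hS.
Qed.

(** The reflection of [t] in [pi / 2] exchanges the points [t - s] and [t + s] in the folded
    integral, which changes its sign. *)
Lemma conj_pair_antisym f g : conj_pair f g -> (forall t, f (pi - t) = f t) ->
  forall t, g (pi - t) = - g t.
Proof.
move=> fg fS t; have [[l l0 lf] E] := conj_pair_conjk ltr01 fg.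
have k1 := cotk_kernel (@ltr01 R).
have fE : (fun t => f (t / 1)) = f by apply/funext => s; rewrite divr1.
rewrite fE in lf E.
rewrite -[pi - t]divr1 -[in RHS](divr1 t) -!E /conjk -mulrN -mulN1r.
rewrite -(rointZ _ (diffk_tame t l0 lf k1)); congr (_ * _).
apply: eq_roint => s _; rewrite /diffk.
have -> : pi - t - s = pi - (t + s) by ring.
have -> : pi - t + s = pi - (t - s) by ring.
by rewrite !fS; ring.
Qed.

End half_period.

Section line_opnorm.
Context {R : realType} {X : normedModType R}.
Variables (p Cp : R).
Hypotheses (p1 : 1 <= p) (Cp0 : 0 <= Cp) (WB : walk_bound X p Cp).
Variables (n : nat) (x : 'I_n -> X).

Lemma tensor_sum_sub_le (f g : 'I_n -> R -> R) (s t : R) (c : 'I_n -> R) :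
  (forall k, `|f k s - g k t| <= c k) ->
  `|tensor_sum f x s - tensor_sum g x t| <= \sum_k c k * `|x k|.
Proof.
move=> fg; rewrite /tensor_sum -sumrB (le_trans (ler_norm_sum _ _ _))//.
by apply: ler_sum => k _; rewrite -scalerBl normrZ ler_wpM2r.
Qed.

Lemma continuous_tensor_sum (f : 'I_n -> R -> R) : (forall k, continuous (f k)) ->
  continuous (tensor_sum f x).
Proof. exact: continuous_vsum. Qed.

Lemma continuous_dilate (h : R -> X) (L : R) : continuous h ->
  continuous (fun t : R => h (t / L)).
Proof.
move=> ch t; apply: continuous_comp; last exact: ch.
by apply: cvgM; [exact: cvg_id|exact: cvg_cst].
Qed.

Lemma rint_dilate (h : R -> R) (a L : R) : 0 <= a -> 0 < L -> continuous h ->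
  rint (- (a * L)) (a * L) (fun t => h (t / L)) = L * rint (- a) a h.
Proof.
move=> a0 L0 ch; have aL : - (a * L) <= a * L.
  by rewrite (@le_trans _ _ 0) ?oppr_le0 ?mulr_ge0 ?(ltW L0).
have Li : 0 < L^-1 by rewrite invr_gt0.
have := rint_affine_gt0 0 aL Li ch; rewrite !addr0.
have -> : L^-1 * (a * L) = a by field; rewrite gt_eqF.
have -> : L^-1 * - (a * L) = - a by field; rewrite gt_eqF.
move=> <-.
rewrite mulrA divff ?gt_eqF// mul1r.
by congr rint; apply/funext => t; rewrite addr0 mulrC.
Qed.

(** By the symmetries each integral over a period is twice the one over the central half; this
    factor and the dilation factor [L] occur on both sides and cancel. *)
Lemma dilated_torus (f g : 'I_n -> R -> R) (L : R) : 0 < L ->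
  (forall k, conj_pair (f k) (g k)) -> (forall k t, f k (pi - t) = f k t) ->
  rint (- (pi / 2 * L)) (pi / 2 * L) (fun t => `|tensor_sum g x (t / L)| `^ p) <=
  Cp * rint (- (pi / 2 * L)) (pi / 2 * L) (fun t => `|tensor_sum f x (t / L)| `^ p).
Proof.
move=> L0 fg fS; have pi0 : 0 <= pi / 2 :> R by rewrite divr_ge0 ?pi_ge0.
have cf : continuous (fun t => `|tensor_sum f x t| `^ p).
  apply: continuous_norm_powR => //; apply: continuous_tensor_sum => k.
  by have [] := conj_pair_continuous (fg k).
have cg : continuous (fun t => `|tensor_sum g x t| `^ p).
  apply: continuous_norm_powR => //; apply: continuous_tensor_sum => k.
  by have [] := conj_pair_continuous (fg k).
rewrite (rint_dilate pi0 L0 cf) (rint_dilate pi0 L0 cg) mulrCA ler_pM2l//.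
have := conj_pair_torus p1 Cp0 WB x fg.
rewrite rint_half_period//; last 2 first.
- move=> t; congr (`|_| `^ p); apply: eq_bigr => k _.
  by have [_ ->] := conj_pair_periodic (fg k).
- move=> t; congr (_ `^ p); rewrite -normrN /tensor_sum -sumrN; congr `|_|.
  by apply: eq_bigr => k _; rewrite (conj_pair_antisym (fg k) (fS k)) scaleNr opprK.
rewrite rint_half_period//; last 2 first.
- move=> t; congr (`|_| `^ p); apply: eq_bigr => k _.
  by have [-> _] := conj_pair_periodic (fg k).
- by move=> t; congr (`|_| `^ p); apply: eq_bigr => k _; rewrite fS.
by rewrite mulrCA ler_pM2l.
Qed.

Lemma line_bound (f : 'I_n -> R -> R) (b : R) : (forall k, test_function (f k)) ->
  (\int[lebesgue_measure]_t (`|tensor_sum f x t| `^ p)%:E <= b%:E)%E ->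
  (\int[lebesgue_measure]_t (`|tensor_sum (fun k => pv_line (f k)) x t| `^ p)%:E
   <= (Cp * b)%:E)%E.
Proof.
move=> tf Fb; have p0 : 0 < p by exact: lt_le_trans p1.
have [df /choice [l /choice [M bf]]] := choice (fun k => test_function_bump (tf k)).
have dilP (z : nat * 'I_n) : exists qg : {poly R} * (R -> R),
    [/\ conj_pair (fun t => qg.1.[sin t]) qg.2,
    forall t, `|dil (f z.2) z.1.+1%:R t - qg.1.[sin (t / z.1.+1%:R)]| <=
      z.1.+1%:R ^- 2 &
    forall y, 2 * reach (M z.2) y <= z.1.+1%:R ->
      `|qg.2 (y / z.1.+1%:R) - pv_line (f z.2) y| <=
      approx_const (l z.2) (M z.2) y / z.1.+1%:R].
  have L1 : 1 <= z.1.+1%:R :> R by rewrite ler1n.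
  by have [q [g qg]] := dil_approx (bf z.2) L1; exists (q, g).
have [qg qgP] := choice dilP.
pose q m k t := (qg (m, k)).1.[sin t]; pose g m k := (qg (m, k)).2.
have qgm m k : conj_pair (q m k) (g m k) by have [] := qgP (m, k).
have cF : continuous (tensor_sum f x).
  by apply: continuous_tensor_sum => k; exact: lip_continuous (bump_lip (bf k)).
have cFp : continuous (fun t => `|tensor_sum f x t| `^ p).
  exact: continuous_norm_powR.
(* [c0 / L ^+ 2] with [L = m.+1] bounds the distance of the polynomial to [f] on the central half
   period; [B] bounds the norms of both. *)
pose c0 := \sum_k (1 + 32 * l k * M k ^+ 3) * `|x k|.
pose B := c0 + \sum_k (2 * l k * M k) * `|x k|.
have lM k : 0 <= l k /\ 0 <= M k.
  by have [[l0 M1] _ _ _ _] := bf k; split=> //; exact: le_trans M1.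
have c00 : 0 <= c0.
  apply: sumr_ge0 => k _; have [? ?] := lM k.
  by rewrite mulr_ge0// addr_ge0// !mulr_ge0// exprn_ge0.
have close m t : `|t| <= pi / 2 * m.+1%:R ->
    `|tensor_sum (q m) x (t / m.+1%:R) - tensor_sum f x t| <= c0 / m.+1%:R ^+ 2.
  move=> tm; have L0 : 0 < m.+1%:R :> R by rewrite ltr0n.
  rewrite /c0 mulr_suml.
  have -> : \sum_k (1 + 32 * l k * M k ^+ 3) * `|x k| / m.+1%:R ^+ 2 =
      \sum_k (m.+1%:R ^- 2 + 32 * l k * M k ^+ 3 / m.+1%:R ^+ 2) * `|x k|.
    by apply: eq_bigr => k _; ring.
  apply: tensor_sum_sub_le => k; have [_ q1 _] := qgP (m, k).
  rewrite mulrAC in tm.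
  have := dil_central (bf k) L0 tm => h2.
  have h1 := q1 t; rewrite distrC/= in h1.
  by rewrite (le_trans _ (lerD h1 h2))// (le_trans _ (ler_normD _ _))// addrA subrK.
have FB t : `|tensor_sum f x t| <= B - c0.
  rewrite /B addrAC subrr add0r (le_trans (ler_norm_sum _ _ _))//.
  by apply: ler_sum => k _; rewrite normrZ ler_wpM2r// (bump_le (bf k)).
(* Lipschitz constant of the [p]-th power times [c0 / L ^+ 2] times the length [pi * L] gives
   [c1 / L]. *)
pose c1 := p * B `^ (p - 1) * c0 * pi.
apply: (@fatou_norm _ _ p p1 (fun m t => tensor_sum (g m) x (t / m.+1%:R))
  (fun m => pi / 2 * m.+1%:R) _ (Cp * b) (Cp * c1)).
- move=> m; apply: continuous_dilate; apply: continuous_tensor_sum => k.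
  by have [] := conj_pair_continuous (qgm m k).
- move=> m; rewrite (@le_trans _ _ m.+1%:R) ?ler_nat//.
  by rewrite ler_peMl// pihalf_ge1.
- move=> y; apply: (@cvg_harmonic_rate _ _ _ _ (\sum_k 2 * reach (M k) y)
    (\sum_k approx_const (l k) (M k) y * `|x k|)) => m ym.
  rewrite mulr_suml.
  have -> : \sum_k approx_const (l k) (M k) y * `|x k| / m.+1%:R =
      \sum_k approx_const (l k) (M k) y / m.+1%:R * `|x k|.
    by apply: eq_bigr => k _; rewrite mulrAC.
  apply: tensor_sum_sub_le => k; have [_ _] := qgP (m, k); apply.
  apply: le_trans ym; rewrite (bigD1 k)//= lerDl; apply: sumr_ge0 => j _.
  have [_ Mj] := lM j.
  by rewrite mulr_ge0// /reach !addr_ge0// mulr_ge0.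
- move=> m; have L0 : 0 < m.+1%:R :> R by rewrite ltr0n.
  have qS k t : q m k (pi - t) = q m k t.
    by rewrite /q; congr (_.[_]); rewrite addrC sinDpi sinN opprK.
  apply: (le_trans (dilated_torus L0 (qgm m) qS)).
  rewrite -[Cp * c1 / _]mulrA -mulrDr ler_wpM2l//.
  set A := pi / 2 * m.+1%:R; have A0 : - A <= A 
    by rewrite (@le_trans _ _ 0) ?oppr_le0// mulr_ge0// divr_ge0 ?pi_ge0.
  apply: (@le_trans _ _ (rint (- A) A (fun t => `|tensor_sum f x t| `^ p +
      p * B `^ (p - 1) * (c0 / m.+1%:R ^+ 2)))).
    apply: le_rint.
    + apply: continuous_norm_powR => //; apply: continuous_dilate.
      apply: continuous_tensor_sum => k.
      by have [] := conj_pair_continuous (qgm m k).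
    + by move=> t; apply: cvgD; [exact: cFp|exact: cvg_cst].
    + move=> t /andP[t1 t2]; have tA : `|t| <= A by rewrite ler_norml t1.
      have tc := close m t tA.
      have c0L : c0 / m.+1%:R ^+ 2 <= c0.
        by rewrite ler_pdivrMr ?exprn_gt0// ler_peMr// expr_ge1// ler1n.
      have UB : `|tensor_sum (q m) x (t / m.+1%:R)| <= B.
        rewrite -(subrK (tensor_sum f x t) (tensor_sum (q m) x _)).
        rewrite (le_trans (ler_normD _ _))// (_ : B = c0 + (B - c0)); last by ring.
        by rewrite lerD ?(le_trans tc).
      rewrite (le_trans (@powR_lipschitz _ p B _ `|tensor_sum f x t| p1 _ _))//.
        by rewrite normr_ge0.
      rewrite lerD2l ler_wpM2l ?mulr_ge0 ?powR_ge0 ?(ltW p0)//.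
      exact: le_trans (ler_dist_dist _ _) tc.
  rewrite rintD//; last by move=> t; exact: cvg_cst.
  rewrite rint_cst// lerD//.
    rewrite -lee_fin -rint_EFin// (le_trans _ Fb)//.
    apply: ge0_subset_integral => //.
    apply: measurableT_comp => //; exact: continuous_measurable_fun.
  rewrite /c1 /A le_eqVlt; apply/predU1P; left; field.
  by rewrite gt_eqF.
Qed.

End line_opnorm.

Lemma opnorm_line_le (R : realType) (X : normedModType R) (p C : R) :
  1 < p -> 0 <= C -> walk_bound X p (C `^ p) ->
  (opnorm X setT p (hilbert_line R) <= C%:E)%E.
Proof.
move=> p1 C0 WB; have p0 : 0 < p by exact: lt_trans p1.
apply: ge_ereal_sup => _ [n [f [g [x [Hfg Lf ->]]]]].
rewrite /Lp_norm poweR_inv_le//; last exact: Lp_integral_ge0.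
have gE : g = (fun k => pv_line (f k)) by apply/funext => k; case: (Hfg k).
have tf k : test_function (f k) by case: (Hfg k).
move: Lf; rewrite /Lp_norm poweR_inv_le//; last exact: Lp_integral_ge0.
rewrite powR1 gE -[C `^ p]mulr1.
by apply: line_bound => //; [exact: ltW|exact: powR_ge0].
Qed.

(** An unbounded shift makes the inequality trivial, so its norm may be taken to be a real number
    [C]. *)
Lemma opnorm_shift_cases (R : realType) (a b : \bar R) :
  (0 <= b)%E -> (forall C : R, 0 <= C -> b = C%:E -> (a <= C%:E)%E) -> (a <= b)%E.
Proof.
case: b => [C|_ _|//]; last by rewrite leey.
by rewrite lee_fin => C0; exact.
Qed.

Theorem theorem2p1 (R : realType) (X : completeNormedModType R) (p : R)
    (X_UMD : UMD X) (p_gt1 : 1 < p) :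
  [/\ (opnorm X setT p (hilbert_line R) <=
         opnorm X setT p (shift_line R))%E,
      (opnorm X setT p (hilbert_line R) <=
         opnorm X `[0%R, 1%R[ p (shift_unit R))%E,
      (opnorm X (torus R) p (hilbert_torus R) <=
         opnorm X setT p (shift_line R))%E
    & (opnorm X (torus R) p (hilbert_torus R) <=
         opnorm X `[0%R, 1%R[ p (shift_unit R))%E].
Proof.
have p0 : 0 < p by exact: lt_trans p_gt1.
split; apply: opnorm_shift_cases (opnorm_ge0 _ _ p0) _ => C C0 SC.
- apply: opnorm_line_le => // S step al be mu mv hmu hmv N s.
  exact: (shift_line_walk hmu hmv p0 SC).
- apply: opnorm_line_le => // S step al be mu mv hmu hmv N s.
  exact: (shift_unit_walk hmu hmv p0 SC).
- apply: opnorm_torus_le => // S step al be mu mv hmu hmv N s.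
  exact: (shift_line_walk hmu hmv p0 SC).
- apply: opnorm_torus_le => // S step al be mu mv hmu hmv N s.
  exact: (shift_unit_walk hmu hmv p0 SC).
Qed.
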